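(* Let $s\ge p>2$ be integers. If $$\Delta>0,\qquad \Psi(\lambda_1^* )>0\qquad\text{and}\qquad \Psi(\lambda_{2\to1F})>0,$$ then there exist constants $\lambda_{1\to2},\lambda_{2\to2F},\lambda_{2\to1}$ with $0<\lambda_{1\to2}<\lambda_{2\to2F}<\lambda_{2\to1F}<\lambda_{2\to1}<1$ such that the spherical model with mixture $\xi(x)=\lambda x^p+(1-\lambda)x^s$ is at zero temperature (i) 1-RSB when $\lambda\in[0,\lambda_{1\to2}]\cup[\lambda_{2\to1},1]$; (ii) 2-RSB when $\lambda\in(\lambda_{1\to2},\lambda_{2\to2F}]$; (iii) 2-FRSB when $\lambda\in(\lambda_{2\to2F},\lambda_{2\to1F})$; (iv) 1-FRSB when $\lambda\in[\lambda_{2\to1F},\lambda_{2\to1})$.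
   Context: Parisi measure at zero temperature. The spherical model with mixture $\xi$ is the centered Gaussian field $H_N$ on $S_N=\{\sigma\in\mathbb R^N:\sum_i\sigma_i^2=N\}$ with covariance $\mathbb E H_N(\sigma^1)H_N(\sigma^2)=N\xi\big(\tfrac1N\sum_i\sigma^1_i\sigma^2_i\big)$. Let $\mathcal K$ be the set of measures on $[0,1]$ of the form $\nu(dx)=\mathbf 1_{[0,1)}(x)\gamma(x)\,dx+\Delta_0\,\delta_{\{1\}}(dx)$, with $\gamma$ nonnegative, right-continuous and nondecreasing on $[0,1)$ and $\Delta_0>0$. For $\nu\in\mathcal K$ put $$\mathcal Q(\nu)=\frac12\Big(\int_0^1\xi'(x)\,\nu(dx)+\int_0^1\frac{dx}{\nu((x,1])}\Big).$$ The functional $\mathcal Q$ has a unique minimizer $\nu_P(dx)=\gamma_P(x)\mathbf 1_{[0,1)}(x)dx+\Delta_P\delta_{\{1\}}(dx)$ in $\mathcal K$, called the Parisi measure at zero temperature. Let $\rho_P$ be the measure on $[0,1)$ with $\rho_P([0,x])=\gamma_P(x)$ for $x\in[0,1)$. Terminology (at zero temperature). - $k$-RSB ($k\ge0$): the support of $\rho_P$ consists of exactly $k$ points of $[0,1)$ (so together with the point $1$ there are $k+1$ points). - 1-FRSB: there exist $q\in(0,1)$, $m>0$ and a strictly increasing function $w$ such that either $\nu_P(dx)=m\mathbf 1_{[0,q)}(x)dx+w(x)\mathbf 1_{[q,1)}(x)dx+\Delta_P\delta_{\{1\}}(dx)$, or $\nu_P(dx)=w(x)\mathbf 1_{[0,q)}(x)dx+m\mathbf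 1_{[q,1)}(x)dx+\Delta_P\delta_{\{1\}}(dx)$. - 2-FRSB: there exist $0\le q_1<q_2<1$, $m_1>0$, $m_2>0$ and a strictly increasing function $w$ such that $\nu_P(dx)=m_1\mathbf 1_{[0,q_1)}(x)dx+w(x)\mathbf 1_{[q_1,q_2)}(x)dx+m_2\mathbf 1_{[q_2,1)}(x)dx+\Delta_P\delta_{\{1\}}(dx)$. Quantities. For $\xi(x)=\lambda x^p+(1-\lambda)x^s$ (derivatives in $x$) set $$\Psi(\lambda)=-\frac{\xi'(1)-1}{\xi''(1)}-\log\Big(\frac{\xi''(1)}{\xi'(1)}\Big)+1-\frac{2}{\xi'(1)}+\frac{\xi''(1)}{\xi'(1)^2},$$ $$Q(\lambda)=(s-p)^2(s^2-3s+2+p^2+3ps-3p)\lambda^2-s(s-p)(2s^2-6s+4-p^2+3ps-3p)\lambda+s^2(s-1)(s-2),$$ $$\Delta=s^2-6(p-1)s+(p-1)(p+7),$$ $$S(\lambda)=s^3(s-1)^2(s-2)(1-\lambda)^2+p^3(p-1)^2(p-2)\lambda^2-2p(p-1)s(s-1)\big[(p-2)(p-3)+(s-2)(s-3)-3(p-2)(s-2)\big]\lambda(1-\lambda).$$ If $\Delta>0$, $Q$ has two real roots $\lambda_1^*<\lambda_2^*$, and $S$ has two real roots $\lambda_{2\to1F}<\lambda'_{2\to1F}$. *)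

(* Defs.v *)
From mathcomp Require Import all_boot all_order all_algebra.
From mathcomp Require Import all_classical all_reals all_analysis.
Import Order.TTheory GRing.Theory Num.Theory.
Import numFieldNormedType.Exports.

Set Implicit Arguments.
Unset Strict Implicit.
Unset Printing Implicit Defensive.

Local Open Scope classical_set_scope.
Local Open Scope ring_scope.

(* Borel measures on R; a measure on [0,1] (resp. [0,1)) is represented by a
   Borel measure on R that gives mass 0 to the complement. *)
Notation borel_measure R := {measure set (measurableTypeR R) -> \bar R}.

Section ParisiMeasure.
Context {R : realType}.
Implicit Types (nu rho : borel_measure R) (g gamma xi w : R -> R) (D : R).

(* nu(dx) = 1_[0,1)(x) g(x) dx + D delta_{1}(dx) *)
Definition has_density_atom nu g D : Prop :=
  forall A : set (measurableTypeR R), measurable A ->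
    nu A = (\int[@lebesgue_measure R]_(x in A `&` `[0%R, 1%R[) (g x)%:E
            + D%:E * \d_(1%R : measurableTypeR R) A)%E.

Definition admissible_density gamma : Prop :=
  [/\ forall x, x \in `[0, 1[ -> 0 <= gamma x,
      forall x, x \in `[0, 1[ -> gamma y @[y --> x^'+] --> gamma x
    & {in `[0, 1[ &, {homo gamma : x y / x <= y}}].

Definition in_K nu : Prop :=
  exists gamma D,
    [/\ admissible_density gamma, 0 < D & has_density_atom nu gamma D].

(* The density of an element of K need not be integrable at 1.  In that case
   nu((x,1]) = +oo, whose extended-real inverse is 0, and the value is +oo. *)
Definition Qfun xi nu : \bar R :=
  ((2^-1)%:E *
    (\int[nu]_(x in `[0%R, 1%R]) (xi^`()%classic x)%:E
     + \int[@lebesgue_measure R]_(x in `[0%R, 1%R]) (nu [set` `](x : R), 1%R]%R])^-1))%E.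

Definition is_parisi_measure xi nu : Prop :=
  in_K nu /\
  forall nu', in_K nu' ->
    (Qfun xi nu <= Qfun xi nu')%E /\
    (Qfun xi nu' = Qfun xi nu ->
     forall A : set (measurableTypeR R), measurable A -> nu' A = nu A).

Definition has_cdf01 rho gamma : Prop :=
  rho (~` [set` `[0, 1[]) = 0%E /\
  forall x, x \in `[0, 1[ -> rho [set` `[0, x]] = (gamma x)%:E.

Definition support01 rho : set R :=
  [set x | (x \in `[0, 1[) /\
           forall U : set R, open U -> U x -> (0 < rho (U `&` `[0%R, 1%R[))%E].

Definition kRSB xi (k : nat) : Prop :=
  exists nu gamma D rho,
    [/\ is_parisi_measure xi nu,
        [/\ admissible_density gamma, 0 < D & has_density_atom nu gamma D],
        has_cdf01 rho gamma
      & (support01 rho #= `I_k)%card].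

Definition oneFRSB xi : Prop :=
  exists nu D q m w,
    [/\ is_parisi_measure xi nu, 0 < q < 1, 0 < m
      & ({in `[q, 1[ &, {homo w : x y / x < y}} /\
         has_density_atom nu (fun x => if x < q then m else w x) D)
        \/
        ({in `[0, q[ &, {homo w : x y / x < y}} /\
         has_density_atom nu (fun x => if x < q then w x else m) D)].

Definition twoFRSB xi : Prop :=
  exists nu D q1 q2 m1 m2 w,
    [/\ is_parisi_measure xi nu,
        [/\ 0 <= q1, q1 < q2 & q2 < 1], 0 < m1 /\ 0 < m2,
        {in `[q1, q2[ &, {homo w : x y / x < y}}
      & has_density_atom nu
          (fun x => if x < q1 then m1 else if x < q2 then w x else m2) D].

End ParisiMeasure.

Section Mixture.
Context {R : realType}.
Implicit Types (p s : nat) (l : R).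

Definition mixture p s l : R -> R := fun x => l * x ^+ p + (1 - l) * x ^+ s.

Definition Psi p s l : R :=
  let d1 := (mixture p s l)^`()%classic 1 in
  let d2 := (mixture p s l)^`(2)%classic 1 in
  - ((d1 - 1) / d2) - ln (d2 / d1) + 1 - 2 / d1 + d2 / d1 ^+ 2.

Definition Qpoly (p' s' : nat) l : R :=
  let p : R := p'%:R in
  let s : R := s'%:R in
  (s - p) ^+ 2 * (s ^+ 2 - 3 * s + 2 + p ^+ 2 + 3 * p * s - 3 * p) * l ^+ 2
  - s * (s - p) * (2 * s ^+ 2 - 6 * s + 4 - p ^+ 2 + 3 * p * s - 3 * p) * l
  + s ^+ 2 * (s - 1) * (s - 2).

Definition Delta (p' s' : nat) : R :=
  let p : R := p'%:R in
  let s : R := s'%:R in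
  s ^+ 2 - 6 * (p - 1) * s + (p - 1) * (p + 7).

Definition Spoly (p' s' : nat) l : R :=
  let p : R := p'%:R in
  let s : R := s'%:R in
  s ^+ 3 * (s - 1) ^+ 2 * (s - 2) * (1 - l) ^+ 2
  + p ^+ 3 * (p - 1) ^+ 2 * (p - 2) * l ^+ 2
  - 2 * p * (p - 1) * s * (s - 1)
    * ((p - 2) * (p - 3) + (s - 2) * (s - 3) - 3 * (p - 2) * (s - 2))
    * l * (1 - l).

Definition ordered_real_roots (f : R -> R) (a b : R) : Prop :=
  a < b /\ forall x, f x = 0 <-> x = a \/ x = b.

End Mixture.
Arguments Delta : clear implicits.

(* Main.v *)
Require Import Defs.
From HB Require Import structures.
From mathcomp Require Import all_boot all_order all_algebra.
From mathcomp Require Import all_classical all_reals all_analysis.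
From mathcomp Require Import measurable_realfun.
From mathcomp Require Import ring lra.
Import Order.TTheory GRing.Theory Num.Theory.
Import numFieldNormedType.Exports.
Set Implicit Arguments.
Unset Strict Implicit.
Unset Printing Implicit Defensive.
Local Open Scope classical_set_scope.
Local Open Scope ring_scope.

(** The Parisi measure is found explicitly and certified by duality.

    Let N x be the tail nu((x, 1]), so that 2 Q(nu) is the integral of xi' against nu plus
    the integral of 1/N. For a competitor with tail N' one has 1/N' + N'/N^2 >= 2/N, so with
    c the primitive of 1/N^2 and A the primitive of c, both zero at 0, the measure nu is
    optimal as soon as A >= xi on [0, 1], c(1) = xi'(1), A(1) = xi(1), and A touches xi
    wherever the density of nu increases. In the inequality of arithmetic and geometric means
    equality forces N' = N almost everywhere, hence uniqueness ([parisi_certificate]).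

    The candidates for N consist of affine pieces, on which the density is constant, and of a
    piece where N = h := xi''^(-1/2), on which A = xi and the density is w = - h'
    ([three_pieces]). On an affine piece with line l the defect F = xi - A satisfies
    F'' = xi'' - 1/l^2, which is negative exactly where l lies below h. What has to be shown is
    that F <= 0 between two double zeros of F at the ends of the piece.

    Up to scaling, the mixture of weight l is x^p + x^s seen on [0, X], where X decreases from
    infinity to 0 as l = lam X increases from 0 to 1. For x^p + x^s the function h is convex,
    concave and convex again, and its inflection points x1 < x2 are the roots of S, with x2 at
    the weight lambda_(2->1F) ([inflections]). A line therefore crosses the graph of h in few
    sign patterns, and this is what makes the defects nonpositive and locates the pieces.

    - There is exactly one line fitting [0, q], that is, with double zeros at 0 and q
      ([left_fit_exists], [left_fit_unique]). Its end does not exceed h for q <= xb and does for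
      q in (xb, x2], where xb lies in (x1, x2) because Psi > 0 at x2 ([critical_exists],
      [egap_after]). For X <= xb this single line is the answer, and lambda_(2->1) = lam xb.
    - For xb < X <= x2 the fit on [0, xb] is followed by h up to X, where w increases.
    - For X > x2 the graph of h ends in its convex branch and a second line is needed. Lines
      issued from (q, h q) that fit [q, X] exist with q in (xb, x2) as long as the line issued
      from xb has a negative defect at X, that is, below a threshold b ([T_zero_exists],
      [T_threshold]); lambda_(2->2F) = lam b.
    - Beyond b the middle piece has disappeared, and two lines meeting at some q <= xb, on
      or below the graph of h, fit [0, X] ([two_step]).
    - This ends at the point Xt where the single fit on [0, X] is again a certificate, with an
      inner contact point qc; lambda_(1->2) = lam Xt ([first_touch]). Contact at the end of the
      interval is excluded because the third derivative of the defect there has the sign of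
      - Q, and Q > 0 before its first root, where Psi > 0 makes the certificate fail.
      Comparing the touching fit with the other lines shows that qc < xb, that the defect
      from xb is positive at Xt, so that b < Xt, and gives the signs needed to find q in
      (qc, xb] by the intermediate value theorem. *)

(** * Measures with a density and an atom at 1 *)

Section Density.
Local Open Scope ereal_scope.
Context d (T : measurableType d) (R : realType) (mu : {measure set T -> \bar R}).
Variable g : T -> R.
Hypotheses (g_ge0 : forall x, (0 <= g x)%R) (mg : measurable_fun setT g).

Let g_ge0E x : 0 <= (g x)%:E. Proof. by rewrite lee_fin. Qed.
Let mgE : measurable_fun setT (EFin \o g).
Proof. exact/measurable_EFinP. Qed.
Hint Resolve g_ge0E mgE : core.

(** The hypotheses on g are arguments so that the measure structure can be inferred from
    the term. *)
Definition with_density of (forall x, (0 <= g x)%R) & measurable_fun setT g :=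
  fun A : set T => \int[mu]_(x in A) (g x)%:E.

Local Notation nu := (with_density g_ge0 mg).

Let nu0 : nu set0 = 0. Proof. exact: integral_set0. Qed.

Let nu_ge0 A : 0 <= nu A. Proof. exact: integral_ge0. Qed.

Let nu_sigma_additive : semi_sigma_additive nu.
Proof.
move=> /= F mF tF mUF; rewrite /with_density; apply: cvg_toP.
  apply: ereal_nondecreasing_is_cvgn => m n mn.
  by apply: lee_sum_nneg_natr => // k _ _; exact: integral_ge0.
by rewrite ge0_integral_bigcup//=; exact: measurable_funTS.
Qed.

HB.instance Definition _ := isMeasure.Build _ _ _ nu
  nu0 nu_ge0 nu_sigma_additive.

Let integral_density_indic E : measurable E ->
  \int[nu]_x (\1_E x)%:E = \int[mu]_x ((\1_E x)%:E * (g x)%:E).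
Proof.
move=> mE; rewrite integral_indic//= /with_density setIT integral_mkcond/=.
apply: eq_integral => x _; rewrite patchE indicE.
by case: ifPn => _; rewrite ?mul1e ?mul0e.
Qed.

Import HBNNSimple.

Let integral_density_nnsfun (f : {nnsfun _ >-> R}) :
  \int[nu]_x (f x)%:E = \int[mu]_x ((f x)%:E * (g x)%:E).
Proof.
under [LHS]eq_integral do rewrite fimfunE -fsumEFin//.
rewrite [LHS]ge0_integral_fsum//; last 2 first.
  - by move=> r; exact/measurable_EFinP/measurableT_comp.
  - by move=> n x _; rewrite EFinM nnfun_muleindic_ge0.
under [RHS]eq_integral.
  move=> x xD; rewrite fimfunE -fsumEFin// ge0_mule_fsuml; last first.
    by move=> r; rewrite EFinM nnfun_muleindic_ge0.
  over.
rewrite [RHS]ge0_integral_fsum//; last 2 first.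
  - move=> r; apply: emeasurable_funM => //; apply/measurable_EFinP.
    exact/measurableT_comp.
  - by move=> n x _; rewrite EFinM mule_ge0// nnfun_muleindic_ge0.
apply: eq_fsbigr => r _.
under [RHS]eq_integral do rewrite EFinM -muleA.
rewrite !integralZl_indic_nnsfun//= integral_density_indic//.
have [r0|r0] := leP 0%R r.
  rewrite ge0_integralZl//.
  - apply: emeasurable_funM => //; exact/measurable_EFinP/measurable_indic.
  - by move=> x _; rewrite mule_ge0// lee_fin.
suff -> : f @^-1` [set r] = set0.
  rewrite indic0 /=; under eq_integral do rewrite mul0e.
  by under [RHS]eq_integral do rewrite mul0e mule0; rewrite integral0 mule0.
apply/seteqP; split => // x /= fxr; move: r0.
by rewrite -fxr ltNge; have -> : (0 <= f x)%R by exact: fun_ge0.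
Qed.

(** Both sides agree on indicators, hence on simple functions, and pass to monotone
    limits. *)
Lemma integral_with_density (f : T -> \bar R) : measurable_fun setT f ->
  (forall x, 0 <= f x) -> \int[nu]_x f x = \int[mu]_x (f x * (g x)%:E).
Proof.
move=> mf f0; pose f_ := nnsfun_approx measurableT mf.
transitivity (limn (fun n => \int[nu]_x (f_ n x)%:E)).
  rewrite -monotone_convergence//=.
  - by apply: eq_integral => x _; apply/esym/cvg_lim => //=; exact: cvg_nnsfun_approx.
  - by move=> n; exact/measurable_EFinP/measurable_funTS.
  - by move=> n x _; rewrite lee_fin.
  - by move=> x _ a b ab; rewrite lee_fin//; exact/lefP/nd_nnsfun_approx.
transitivity (limn (fun n => \int[mu]_x ((f_ n x)%:E * (g x)%:E))).
  by congr (limn _); apply/funext => n; exact: integral_density_nnsfun.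
rewrite -monotone_convergence//=.
- apply: eq_integral => x _; apply/cvg_lim => //=.
  by apply: cvgeZr => //; exact: cvg_nnsfun_approx.
- by move=> n; apply: emeasurable_funM => //; exact/measurable_EFinP/measurable_funTS.
- by move=> n x _; rewrite mule_ge0// lee_fin.
- move=> x _ a b ab; apply: lee_wpmul2r => //; rewrite lee_fin.
  exact/lefP/nd_nnsfun_approx.
Qed.

End Density.

Section Tail.
Local Open Scope ereal_scope.
Context {R : realType}.
Local Notation leb := (@lebesgue_measure R).
Implicit Types (f g : R -> R) (D : R).

(** The preimage of a ray under a monotone function is an interval. *)
Lemma monotone_measurable (I : set R) (f : R -> \bar R) : is_interval I ->
  {in I &, {homo f : x y / (x <= y)%R >-> x <= y}} -> measurable_fun I f.
Proof.
move=> itvI f_nd mI.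
apply: (measurability (@ErealGenCInfty.G R)) => //.
  exact: ErealGenCInfty.measurableE.
move=> /= _ [_] [r] -> <-; apply: is_interval_measurable.
move=> s t/= [Is fs] [It ft] u /andP[su ut].
have Iu : I u by apply: (itvI s t) => //; rewrite su.
split => //; move: fs ft; rewrite !in_itv/= !andbT => fs ft.
by rewrite (le_trans fs)// f_nd ?inE.
Qed.

Lemma admissible_measurable f : admissible_density f -> measurable_fun `[(0:R)%R, 1%R[ f.
Proof.
move=> [_ _ f_nd]; apply/measurable_EFinP; apply: monotone_measurable.
  exact: interval_is_interval.
by move=> x y /[!inE] x01 y01 xy; rewrite lee_fin f_nd.
Qed.

(** Extending by zero turns a density on [0,1) into one on the whole line. *)
Definition ext01 f : R -> R := f \_ `[(0:R)%R, 1%R[.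

Lemma ext01_ge0 f : (forall x, x \in `[0%R, 1%R[ -> (0 <= f x)%R) ->
  forall x, (0 <= ext01 f x)%R.
Proof. by move=> f0 x; rewrite /ext01 patchE; case: ifPn => // /[!inE] /f0. Qed.

Lemma ext01_measurable f : measurable_fun `[(0:R)%R, 1%R[ f ->
  measurable_fun setT (ext01 f).
Proof. by move=> mf; exact: (proj1 (measurable_restrictT f (measurable_itv _)) mf). Qed.

Lemma ext01E f x : x \in `[0%R, 1%R[ -> ext01 f x = f x.
Proof. by move=> x01; rewrite /ext01 patchE mem_set. Qed.

Lemma integral_ext01 f (A : set R) :
  \int[leb]_(x in A) (ext01 f x)%:E = \int[leb]_(x in A `&` `[0%R, 1%R[) (f x)%:E.
Proof.
rewrite integral_mkcondr; apply: eq_integral => x _; rewrite /ext01 !patchE.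
by case: ifPn.
Qed.

Section DensityAtom.
Variables (f : R -> R) (D : R).
Hypotheses (f0 : forall x, x \in `[0%R, 1%R[ -> (0 <= f x)%R)
  (mf : measurable_fun `[(0:R)%R, 1%R[ f) (D0 : (0 <= D)%R).

Definition density_atom :=
  measure_add (with_density leb (ext01_ge0 f0) (ext01_measurable mf))
    (mscale (NngNum D0) (dirac (1%R : measurableTypeR R))).

Lemma density_atomP : has_density_atom density_atom f D.
Proof.
move=> A mA; rewrite /density_atom /measure_add/= /msum 2!big_ord_recl/= big_ord0 adde0; congr (_ + _).
exact: integral_ext01.
Qed.

Lemma integral_density_atom (nu : borel_measure R) (k : R -> \bar R) :
  has_density_atom nu f D -> measurable_fun setT k -> (forall x, 0 <= k x) ->
  \int[nu]_(x in `[0%R, 1%R]) k x =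
  \int[leb]_(x in `[0%R, 1%R[) (k x * (f x)%:E) + D%:E * k 1%R.
Proof.
move=> nuE mk k0.
have m01 : measurable (`[0%R, 1%R] : set (measurableTypeR R)).
  exact: measurable_itv.
rewrite integral_mkcond.
have mk1 : measurable_fun setT (k \_ `[(0:R)%R, 1%R]).
  exact: (proj1 (measurable_restrictT _ (measurable_itv _)) (measurable_funTS mk)).
have k10 x : 0 <= (k \_ `[(0:R)%R, 1%R]) x by apply: erestrict_ge0.
rewrite (@eq_measure_integral _ _ _ _ density_atom); last first.
  by move=> A mA _; rewrite nuE// density_atomP.
rewrite /density_atom ge0_integral_measure_add//.
rewrite integral_with_density// ge0_integral_mscale// integral_dirac//=.
rewrite diracE mem_set// mul1e patchE mem_set; last by rewrite /= in_itv/= ler01 lexx.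
congr (_ + _).
rewrite [RHS]integral_mkcond; apply: eq_integral => x _.
rewrite /ext01 !patchE.
case: (boolP (x \in `[(0:R)%R, 1%R[%classic)) => x01; last by rewrite mule0.
rewrite mem_set//=; move: x01; rewrite inE/= !in_itv/= => /andP[-> /ltW ->].
by [].
Qed.

Lemma density_atom_tail (nu : borel_measure R) (x : R) : has_density_atom nu f D ->
  (0 <= x < 1)%R ->
  nu [set` `](x : R), 1%R]%R] = \int[leb]_(y in `]x, 1%R[) (f y)%:E + D%:E.
Proof.
move=> nuE /andP[x0 x1]; rewrite nuE; last exact: measurable_itv.
rewrite diracE mem_set ?mule1; last by rewrite /= in_itv/= x1 lexx.
congr (\int[leb]_(y in _) _ + _).
apply/seteqP; split => y /=; rewrite !in_itv/=.
  by move=> [/andP[-> _] /andP[_ ->]].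
by move=> /andP[xy y1]; rewrite xy y1 (ltW y1) (le_trans x0 (ltW xy)).
Qed.

End DensityAtom.
End Tail.

(** * Integrals against monotone weights *)

Section LayerCake.
Local Open Scope ereal_scope.
Context {R : realType}.
Local Notation leb := (@lebesgue_measure R).
Implicit Types (f g : R -> R) (D : R).

(** The superlevel sets of a nondecreasing density are final segments of [0, 1). *)
Lemma upset01 (U : set R) : U `<=` `[0%R, 1%R[ ->
  (forall x y, U x -> y \in `[0%R, 1%R[ -> (x <= y)%R -> U y) ->
  exists2 t, (0 <= t <= 1)%R & U = `[t, 1%R[%classic \/ U = `]t, 1%R[%classic.
Proof.
move=> U01 Uup; have [->|/set0P[u Uu]] := eqVneq U set0.
  by exists 1%R; [rewrite ler01 lexx|left; rewrite set_itvco0].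
have U0 x : U x -> (0 <= x < 1)%R by move=> /U01; rewrite /= in_itv.
have hl : has_inf U.
  by split; [exists u|exists 0%R => x /U0 /andP[]].
have t0 : (0 <= inf U)%R by apply: lb_le_inf; [exists u|move=> x /U0 /andP[]].
have tu x : U x -> (inf U <= x)%R by move=> Ux; apply: ge_inf => //; case: hl.
have t1 : (inf U <= 1)%R by rewrite (le_trans (tu _ Uu))// ltW//; case/andP: (U0 _ Uu).
have Ugt x : (inf U < x < 1)%R -> U x.
  move=> /andP[/(inf_lt (ex_intro _ _ Uu : U !=set0))[v Uv vx] x1]; apply: (Uup v) => //; last exact: ltW.
  by rewrite in_itv/= x1 andbT (le_trans _ (ltW vx))//; case/andP: (U0 _ Uv).
exists (inf U); first by rewrite t0.
have [Ut|nUt] := pselect (U (inf U)); [left|right]; apply/seteqP; split => x /=;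
    rewrite in_itv/=.
- by move=> Ux; rewrite tu//; case/andP: (U0 _ Ux).
- move=> /andP[]; rewrite le_eqVlt => /orP[/eqP <-//|tx x1].
  by apply: Ugt; rewrite tx.
- move=> Ux; have /andP[_ ->] := U0 _ Ux; rewrite andbT lt_neqAle tu// andbT.
  by apply/eqP => tE; apply: nUt; rewrite tE.
- exact: Ugt.
Qed.

Section comparison.
Variable f : R -> R.
Hypotheses (f0 : forall x, x \in `[0%R, 1%R[ -> (0 <= f x)%R)
  (f_nd : {in `[0%R, 1%R[ &, {homo f : x y / (x <= y)%R}}).

Let mf : measurable_fun `[(0:R)%R, 1%R[ f.
Proof.
apply/measurable_EFinP; apply: monotone_measurable.
  exact: interval_is_interval.
by move=> x y /[!inE] x01 y01 xy; rewrite lee_fin f_nd.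
Qed.

Let S := [set z : measurableTypeR R * measurableTypeR R |
  (0 <= z.1)%R && (z.1 < ext01 f z.2)%R].

Let mS : measurable S.
Proof.
have -> : S = (fst @^-1` `[0%R, +oo[) `&`
    [set z | (z.1 < ext01 f z.2)%R].
  by apply/seteqP; split => z /=; rewrite in_itv/= andbT => /andP.
apply: measurableI.
  by rewrite -[X in measurable X]setTI; apply: measurable_fst => //; exact: measurable_itv.
rewrite -[X in measurable X]setTI.
have : measurable_fun setT (fun z : measurableTypeR R * measurableTypeR R =>
    (z.1 < ext01 f z.2)%R).
  apply: measurable_fun_ltr; first exact: measurable_fst.
  by apply: measurableT_comp (ext01_measurable mf) _; exact: measurable_snd.
move=> /(_ measurableT [set true]); apply => //.
Qed.

Let H g (z : measurableTypeR R * measurableTypeR R) : \bar R :=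
  (ext01 g z.2 * \1_S z)%:E.

Section one.
Variable g : R -> R.
Hypotheses (g0 : forall x, x \in `[0%R, 1%R[ -> (0 <= g x)%R)
  (mg : measurable_fun `[(0:R)%R, 1%R[ g).

Let mH : measurable_fun setT (H g).
Proof.
apply/measurable_EFinP; apply: measurable_funM; last exact: measurable_indic.
by apply: measurableT_comp (ext01_measurable mg) _; exact: measurable_snd.
Qed.

Let H0 z : 0 <= H g z.
Proof. by rewrite lee_fin mulr_ge0// ext01_ge0. Qed.

(** Fubini on the region under the graph of f. *)
Lemma layer_cake :
  \int[leb]_(y in `[0%R, 1%R[) (g y * f y)%:E =
  \int[leb]_s \int[leb]_y H g (s, y).
Proof.
rewrite (fubini_tonelli (H g) mH H0) integral_mkcond; apply: eq_integral => y _.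
rewrite patchE; case: ifPn => y01; last first.
  rewrite [RHS]integral0_eq// => s _.
  by rewrite /H/= /ext01 patchE (negbTE y01) mul0r.
have y01' : y \in `[0%R, 1%R[ by rewrite inE in y01.
under eq_integral do rewrite /H EFinM /=.
rewrite ge0_integralZl//; last 2 first.
  - apply/measurable_EFinP.
    by apply: (measurableT_comp (measurable_indic mS)); exact: measurable_pair2.
  - by rewrite lee_fin ext01_ge0.
transitivity ((g y)%:E * \int[leb]_s (\1_(`[0%R, f y[%classic : set R) s)%:E); last first.
  rewrite ext01E//; congr (_ * _); apply: eq_integral => s _; congr EFin.
  rewrite !indicE; congr (nat_of_bool _)%:R.
  by apply/idP/idP; rewrite !inE /S/= in_itv/= ext01E.
rewrite integral_indic//= setIT lebesgue_measure_itv/= lte_fin.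
case: ifPn => [_|]; first by rewrite sube0.
by rewrite -leNgt => fy; rewrite (@le_anti _ R (f y) 0%R) ?fy ?f0// mulr0 mule0.
Qed.

Lemma layer_section s : (0 <= s)%R ->
  \int[leb]_y H g (s, y) = \int[leb]_(y in [set y | (s < ext01 f y)%R]) (ext01 g y)%:E.
Proof.
move=> s0; rewrite [RHS]integral_mkcond; apply: eq_integral => y _.
rewrite /H patchE indicE/=.
have -> : ((s, y) \in S) = (y \in [set y | (s < ext01 f y)%R]).
  by apply/idP/idP; rewrite !inE /S/= s0.
by case: ifPn; rewrite ?mulr1 ?mulr0.
Qed.

End one.

(** A nondecreasing nonnegative weight is a superposition of indicators of
    the final segments of [0,1); hence it is enough to compare the two
    integrands on final segments. *)
Lemma le_integral_nondecreasing_weight g1 g2 :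
  (forall x, x \in `[0%R, 1%R[ -> (0 <= g1 x)%R) ->
  (forall x, x \in `[0%R, 1%R[ -> (0 <= g2 x)%R) ->
  measurable_fun `[(0:R)%R, 1%R[ g1 -> measurable_fun `[(0:R)%R, 1%R[ g2 ->
  (forall t, (0 <= t <= 1)%R -> \int[leb]_(y in `[t, 1%R[) (g1 y)%:E <=
                          \int[leb]_(y in `[t, 1%R[) (g2 y)%:E) ->
  \int[leb]_(y in `[0%R, 1%R[) (g1 y * f y)%:E <=
  \int[leb]_(y in `[0%R, 1%R[) (g2 y * f y)%:E.
Proof.
move=> g10 g20 mg1 mg2 g12; rewrite !layer_cake//.
have mH g : measurable_fun `[(0:R)%R, 1%R[ g -> measurable_fun setT (H g).
  move=> mg; apply/measurable_EFinP; apply: measurable_funM; last exact: measurable_indic.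
  by apply: measurableT_comp (ext01_measurable mg) _; exact: measurable_snd.
have H0 g : (forall x, x \in `[0%R, 1%R[ -> (0 <= g x)%R) -> forall z, 0 <= H g z.
  by move=> g0 z; rewrite lee_fin mulr_ge0// ext01_ge0.
apply: ge0_le_integral => //.
- by move=> s _; apply: integral_ge0 => y _; exact: H0.
- exact: (measurable_fun_fubini_tonelli_F (H g1) (mH _ mg1) (H0 _ g10)).
- exact: (measurable_fun_fubini_tonelli_F (H g2) (mH _ mg2) (H0 _ g20)).
move=> s _; have [s0|s0] := leP 0%R s; last first.
  rewrite [leLHS]integral0_eq => [|y _].
    by apply: integral_ge0 => y _; exact: H0.
  by rewrite /H indicE/= memNset ?mulr0// /S/= leNgt s0.
rewrite !layer_section//.
have [| |t t01 UE] := @upset01 [set y | (s < ext01 f y)%R].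
- move=> y /=; rewrite /ext01 patchE; case: ifPn => [|_]; first by rewrite inE.
  by rewrite ltNge s0.
- move=> x y /= sx y01 xy; rewrite ext01E//.
  move: sx; rewrite /ext01 patchE; case: ifPn => [|_]; last by rewrite ltNge s0.
  by rewrite inE/= => x01 /lt_le_trans; apply; exact: f_nd.
have U01 : [set y | (s < ext01 f y)%R] `<=` `[0%R, 1%R[.
  case/andP: t01 => t0 t1.
  by case: UE => -> y /=; rewrite !in_itv/= => /andP[ty ->]; rewrite andbT;
    rewrite (le_trans t0)// ltW.
rewrite !integral_ext01 !(setIidl U01); case: UE => ->; first exact: g12.
have sub : `]t, 1%R[%classic `<=` (`[0%R, 1%R[%classic : set R).
  by case/andP: t01 => t0 t1 y /=; rewrite !in_itv/= => /andP[/ltW ty ->];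
    rewrite (le_trans t0).
rewrite !integral_itv_obnd_cbnd//; first exact: g12.
- by apply/measurable_EFinP; exact: measurable_funS mg2.
- by apply/measurable_EFinP; exact: measurable_funS mg1.
Qed.

End comparison.
End LayerCake.

(** * Primitives and tails *)

Section Primitive.
Context {R : realType}.
Local Notation leb := (@lebesgue_measure R).
Implicit Types (f g G : R -> R) (a b c x y : R).

(** The integrals are half-open so that the pieces of a piecewise density glue along their
    common endpoint. *)
Definition primitive_on G g a b :=
  [/\ measurable_fun `[a, b[ g, forall x, x \in `[a, b[ -> 0 <= g x
    & forall x y, a <= x -> x <= y -> y <= b ->
      (\int[leb]_(t in `[x, y[) (g t)%:E = (G y - G x)%:E)%E].

Lemma primitive_on_cat G g a b c : a <= b -> b <= c ->
  primitive_on G g a b -> primitive_on G g b c -> primitive_on G g a c.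
Proof.
move=> ab bc [mab gab iab] [mbc gbc ibc].
have g0 x : x \in `[a, c[ -> 0 <= g x.
  rewrite in_itv/= => /andP[ax xc].
  by have [xb|bx] := ltP x b; [apply: gab|apply: gbc]; rewrite in_itv/= ?ax ?bx.
have mg : measurable_fun `[a, c[ g.
  by rewrite (@itv_bndbnd_setU _ _ _ (BLeft b)) ?bnd_simp//; apply/measurable_funU.
split => // x y ax xy yc.
have [yb|/ltW bY] := leP y b; first exact: iab.
have [bx|/ltW xb] := leP b x; first exact: ibc.
have sub : `[x, y[%classic `<=` (`[a, c[%classic : set R).
  by move=> t/=; rewrite !in_itv/= => /andP[xt ty]; rewrite (le_trans ax xt) (lt_le_trans ty).
rewrite (@itv_bndbnd_setU _ _ _ (BLeft b)) ?bnd_simp// ge0_integral_setU//.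
- by rewrite iab// ibc// -EFinD; congr EFin; ring.
- rewrite -itv_bndbnd_setU ?bnd_simp//; apply/measurable_EFinP.
  exact: measurable_funS mg.
- move=> t; rewrite -itv_bndbnd_setU ?bnd_simp// => /sub tac.
  by rewrite lee_fin g0.
- apply/disj_set2P/seteqP; split => t //=; rewrite !in_itv/=.
  by move=> [/andP[_ tb] /andP[bt _]]; move: tb; rewrite ltNge bt.
Qed.

(** The pointwise equality is only asked on [a, b) so that a density may jump at b. *)
Lemma primitive_on_derive G g G0 g0 a b :
  (forall x, x \in `[a, b] -> is_derive x 1 G0 (g0 x)) ->
  (forall x, x \in `[a, b] -> {for x, continuous g0}) ->
  (forall x, x \in `[a, b] -> 0 <= g0 x) ->
  (forall x, x \in `[a, b] -> G x = G0 x) ->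
  (forall x, x \in `[a, b[ -> g x = g0 x) ->
  primitive_on G g a b.
Proof.
move=> dG cg g0_ge0 GE gE.
have co_cc x : x \in `[a, b[ -> x \in `[a, b].
  by rewrite !in_itv/= => /andP[-> /ltW].
have wcg : {within `[a, b], continuous g0}.
  apply: continuous_in_subspaceT => x /[!inE] xab; exact: cg.
have mg0 : measurable_fun `[a, b] g0.
  exact: subspace_continuous_measurable_fun.
have mg : measurable_fun `[a, b[ g.
  apply: (eq_measurable_fun g0).
    by move=> x /[!inE]/= xab; rewrite gE.
  by apply: measurable_funS mg0 => // x; exact: co_cc.
split => //.
  by move=> x xab; rewrite gE// g0_ge0// co_cc.
move=> x y ax xy yb.
have xab : x \in `[a, b] by rewrite in_itv/= ax (le_trans xy).
have yab : y \in `[a, b] by rewrite in_itv/= yb (le_trans ax).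
have sub : {subset `[x, y] <= `[a, b]}.
  by move=> t; rewrite !in_itv/= => /andP[xt ty]; rewrite (le_trans ax xt) (le_trans ty).
move: xy; rewrite le_eqVlt => /orP[/eqP <-|xy].
  by rewrite set_itvco0 integral_set0 subrr.
transitivity (\int[leb]_(t in `[x, y[) (g0 t)%:E)%E.
  apply: eq_integral => t; rewrite inE/= in_itv/= => /andP[xt ty].
  by rewrite gE// in_itv/= (le_trans ax xt) (lt_le_trans ty).
rewrite integral_itv_bndo_bndc; last first.
  apply/measurable_EFinP; apply: measurable_funS mg0 => // t /=.
  by rewrite in_itv/= => /andP[xt ty]; apply: sub; rewrite in_itv/= xt ltW.
rewrite (@continuous_FTC2 _ g0 G0)//.
- by rewrite -EFinB !GE.
- by apply: continuous_subspaceW wcg => t /sub.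
- have dv t : t \in `[a, b] -> derivable G0 t 1 by move=> /dG[].
  have ct t : t \in `[a, b] -> {for t, continuous G0}.
    by move=> /dv /derivable1_diffP/differentiable_continuous.
  split.
  + by move=> t txy; apply: dv; apply: sub; exact: subset_itv_oo_cc txy.
  + by apply: cvg_at_right_filter; exact: ct.
  + by apply: cvg_at_left_filter; exact: ct.
- move=> t /subset_itv_oo_cc /sub /dG [_ dGt].
  by rewrite derive1E.
Qed.

End Primitive.

Section TailIntegral.
Local Open Scope ereal_scope.
Context {R : realType}.
Local Notation leb := (@lebesgue_measure R).
Implicit Types (f k c : R -> R) (D : R).

Definition tail f (x : R) := \int[leb]_(y in `]x, 1%R[) (f y)%:E.

Section one.
Variable f : R -> R.
Hypotheses (f0 : forall x, x \in `[0%R, 1%R[ -> (0 <= f x)%R)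
  (mf : measurable_fun `[(0:R)%R, 1%R[ f).

Let sub x : (0 <= x)%R -> `]x, 1%R[%classic `<=` (`[0%R, 1%R[%classic : set R).
Proof.
by move=> x0 y /=; rewrite !in_itv/= => /andP[/ltW xy ->]; rewrite (le_trans x0).
Qed.

Lemma tail_ge0 x : (0 <= x)%R -> 0 <= tail f x.
Proof. by move=> x0; apply: integral_ge0 => y /(sub x0) /f0; rewrite lee_fin. Qed.

Lemma le_tail x y : (0 <= x)%R -> (x <= y)%R -> tail f y <= tail f x.
Proof.
move=> x0 xy; apply: ge0_subset_integral => //.
- by apply/measurable_EFinP; exact: measurable_funS (sub x0) mf.
- by move=> t /(sub x0) /f0; rewrite lee_fin.
- by move=> t /=; rewrite !in_itv/= => /andP[yt ->]; rewrite (le_lt_trans xy).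
Qed.

Lemma measurable_tail : measurable_fun `[(0:R)%R, 1%R[ (tail f).
Proof.
have -> : tail f = (fun x => - (- tail f x)) by apply/funext => x; rewrite oppeK.
apply/measurableT_comp => //; apply: monotone_measurable.
  exact: interval_is_interval.
move=> x y /[!inE]/=; rewrite !in_itv/= => /andP[x0 _] _ xy.
by rewrite leeN2 le_tail.
Qed.

Lemma measurable_inv_tail D : (0 < D)%R ->
  measurable_fun `[(0:R)%R, 1%R[ (fun x => (tail f x + D%:E)^-1).
Proof.
move=> D0; apply: monotone_measurable; first exact: interval_is_interval.
move=> x y /[!inE]/=; rewrite !in_itv/= => /andP[x0 _] /andP[y0 _] xy.
have := le_tail x0 xy; move: (tail_ge0 x0) (tail_ge0 y0).
case: (tail f y) => [s| |]//; case: (tail f x) => [r| |]//.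
- rewrite !lee_fin => r0 s0 sr; rewrite -!EFinD !inver !gt_eqF ?ltr_wpDl// lee_fin.
  by rewrite lef_pV2 ?posrE ?ltr_wpDl// lerD2r.
- rewrite lee_fin => _ s0 _; rewrite -EFinD inver gt_eqF ?ltr_wpDl//.
  by rewrite lee_fin invr_ge0 addr_ge0// ltW.
Qed.

(** Fubini on the triangle x < y. *)
Lemma integral_tailM k c : primitive_on c k 0 1 -> c 0%R = 0%R ->
  \int[leb]_(x in `[0%R, 1%R[) (tail f x * (k x)%:E) =
  \int[leb]_(y in `[0%R, 1%R[) (c y * f y)%:E.
Proof.
move=> [mk k0 ik] c0.
pose S := [set z : measurableTypeR R * measurableTypeR R | (z.1 < z.2)%R].
have mS : measurable S.
  rewrite -[X in measurable X]setTI.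
  have : measurable_fun setT (fun z : measurableTypeR R * measurableTypeR R =>
    (z.1 < z.2)%R) by apply: measurable_fun_ltr.
  by move=> /(_ measurableT [set true]); apply.
pose H (z : measurableTypeR R * measurableTypeR R) : \bar R :=
  (ext01 k z.1 * ext01 f z.2 * \1_S z)%:E.
have mH : measurable_fun setT H.
  apply/measurable_EFinP; apply: measurable_funM; last exact: measurable_indic.
  apply: measurable_funM.
  - by apply: measurableT_comp (ext01_measurable mk) _; exact: measurable_fst.
  - by apply: measurableT_comp (ext01_measurable mf) _; exact: measurable_snd.
have H0 z : 0 <= H z by rewrite lee_fin !mulr_ge0// ext01_ge0.
transitivity (\int[leb]_x \int[leb]_y H (x, y)).
  rewrite integral_mkcond; apply: eq_integral => x _.
  rewrite patchE; case: ifPn => x01; last first.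
    rewrite [RHS]integral0_eq// => y _.
    by rewrite /H/= /ext01 patchE (negbTE x01) !mul0r.
  have x01' : x \in `[0%R, 1%R[ by rewrite inE in x01.
  have x0 : (0 <= x)%R by move: x01'; rewrite in_itv => /andP[].
  under eq_integral do rewrite /H -mulrA EFinM /=.
  rewrite ge0_integralZl//; last 3 first.
  - apply/measurable_EFinP; apply: measurable_funM.
      exact: ext01_measurable.
    by apply: (measurableT_comp (measurable_indic mS)); exact: measurable_pair1.
  - by move=> y _; rewrite lee_fin mulr_ge0// ext01_ge0.
  - by rewrite lee_fin ext01_ge0.
  rewrite ext01E// muleC; congr (_ * _).
  rewrite /tail [LHS]integral_mkcond; apply: eq_integral => y _.
  rewrite indicE patchE.
  have [xy|yx] := boolP ((x, y) \in S); last first.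
    rewrite mulr0 memNset//= in_itv/= => /andP[xy _].
    by move: yx; rewrite notin_setE/S/=.
  rewrite mulr1 /ext01 patchE; move: xy; rewrite inE /S/= => xy.
  have -> : (y \in `]x, 1%R[%classic) = (y \in `[(0:R)%R, 1%R[%classic).
    by apply/idP/idP; rewrite !inE/= !in_itv/= xy (le_trans x0 (ltW xy)).
  by case: ifP.
rewrite (fubini_tonelli H mH H0) [RHS]integral_mkcond; apply: eq_integral => y _.
rewrite patchE; case: ifPn => y01; last first.
  rewrite integral0_eq// => x _.
  rewrite /H/=; have -> : ext01 f y = 0%R by rewrite /ext01 patchE (negbTE y01).
  by rewrite mulr0 mul0r.
have y01' : y \in `[0%R, 1%R[ by rewrite inE in y01.
have /andP[y0 y1] : (0 <= y < 1)%R by move: y01'; rewrite in_itv.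
under eq_integral do rewrite /H (mulrC (ext01 k _)) -mulrA EFinM /=.
rewrite ge0_integralZl//; last 3 first.
- apply/measurable_EFinP; apply: measurable_funM.
    exact: ext01_measurable.
  by apply: (measurableT_comp (measurable_indic mS)); exact: measurable_pair2.
- by move=> x _; rewrite lee_fin mulr_ge0// ext01_ge0.
- by rewrite lee_fin ext01_ge0.
rewrite ext01E// EFinM muleC; congr (_ * _).
rewrite -[c y]subr0 -c0 -ik ?lexx//; last exact: ltW.
rewrite [RHS]integral_mkcond; apply: eq_integral => x _.
rewrite indicE patchE.
have [xy|yx] := boolP ((x, y) \in S); last first.
  rewrite mulr0 memNset//= in_itv/= => /andP[_ xy].
  by move: yx; rewrite notin_setE/S/=.
rewrite mulr1 /ext01 patchE; move: xy; rewrite inE /S/= => xy.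
have -> : (x \in `[(0:R)%R, y[%classic) = (x \in `[(0:R)%R, 1%R[%classic).
  by apply/idP/idP; rewrite !inE/= !in_itv/= xy (lt_trans xy y1).
by case: ifP.
Qed.

End one.
End TailIntegral.

(** * Duality certificate for the minimiser *)

Section Certificate.
Local Open Scope ereal_scope.
Context {R : realType}.
Local Notation leb := (@lebesgue_measure R).
Implicit Types (f k c : R -> R) (D : R).

(** The inequality of arithmetic and geometric means for t / n^2 and 1 / t, where t may be
    infinite. Its equality case is what makes the minimiser unique. *)
Lemma amgm_inv (n : R) (t : \bar R) : (0 < n)%R -> 0 < t ->
  (2 / n)%:E <= t * ((n ^+ 2)^-1)%:E + t^-1 /\
  (t * ((n ^+ 2)^-1)%:E + t^-1 = (2 / n)%:E -> t = n%:E).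
Proof.
move=> n0; have n2 : (0 < (n ^+ 2)^-1)%R by rewrite invr_gt0 exprn_gt0.
case: t => [r| |]// r0.
  rewrite lte_fin in r0; rewrite inver gt_eqF//= -EFinM -EFinD lee_fin.
  have e : (r / n ^+ 2 + r^-1 - 2 / n = (r - n) ^+ 2 / (r * n ^+ 2))%R.
    by field; rewrite !gt_eqF.
  split.
    rewrite -subr_ge0 e; apply: divr_ge0; first exact: sqr_ge0.
    by rewrite mulr_ge0 ?sqr_ge0// ltW.
  move=> [E]; congr EFin; apply/eqP; rewrite -subr_eq0 -sqrf_eq0.
  move: e; rewrite E subrr => /esym/eqP; rewrite mulf_eq0 => /orP[//|].
  by rewrite invr_eq0 mulf_eq0 !sqrf_eq0 (gt_eqF r0) (gt_eqF n0).
by rewrite invey adde0 gt0_mulye ?lte_fin// leey; split.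
Qed.

Lemma adm_ge0 (g : R -> R) : admissible_density g ->
  forall x, x \in `[(0:R)%R, 1%R[ -> (0 <= g x)%R.
Proof. by case. Qed.

Variables (xi N c A f : R -> R) (D m1 m2 q1 q2 : R).
Local Notation dxi := (xi^`()%classic).
Hypotheses (cdxi : continuous dxi) (dxi_ge0 : forall x, (0 <= x)%R -> (0 <= dxi x)%R).
Hypotheses (pxi : primitive_on xi dxi 0 1) (xi0 : xi 0%R = 0%R).
Hypotheses (fadm : admissible_density f) (D0 : (0 < D)%R).
Hypotheses (pN : primitive_on (fun x => - N x)%R f 0 1) (N1 : N 1%R = D)
  (N_gt0 : forall x, x \in `[0%R, 1%R] -> (0 < N x)%R).
Hypotheses (pc : primitive_on c (fun x => (N x ^+ 2)^-1)%R 0 1)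
  (c0 : c 0%R = 0%R) (c1 : c 1%R = dxi 1%R).
Hypotheses (pA : primitive_on A c 0 1) (A0 : A 0%R = 0%R) (A1 : A 1%R = xi 1%R)
  (xiA : forall x, x \in `[0%R, 1%R] -> (xi x <= A x)%R).
Hypotheses (q1_ge0 : (0 <= q1)%R) (q12 : (q1 <= q2)%R) (q2_le1 : (q2 <= 1)%R)
  (fq1 : forall x, x \in `[0%R, q1[ -> f x = m1)
  (fq2 : forall x, x \in `[q2, 1%R[ -> f x = m2)
  (cq12 : forall x, x \in `[q1, q2[ -> c x = dxi x)
  (Aq1 : A q1 = xi q1) (Aq2 : A q2 = xi q2).

Let k x : R := ((N x ^+ 2)^-1)%R.

Let energy (g : R -> R) (E : R) : \bar R := \int[leb]_(x in `[0%R, 1%R[) (dxi x * g x)%:E +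
  (E * dxi 1)%:E + \int[leb]_(x in `[0%R, 1%R[) (tail g x + E%:E)^-1.

Let Qfun_energy (nu : borel_measure R) g E : admissible_density g -> (0 < E)%R ->
  has_density_atom nu g E -> Qfun xi nu = (2^-1)%:E * energy g E.
Proof.
move=> ga E0 nuE; rewrite /Qfun; congr (_ * _).
have g0 := adm_ge0 ga; have mg := admissible_measurable ga.
congr (_ + _).
  pose d x : R := `|dxi x|%R.
  transitivity (\int[nu]_(x in `[0%R, 1%R]) (d x)%:E).
    apply: eq_integral => x; rewrite inE/= in_itv/= => /andP[x0 _].
    by rewrite /d ger0_norm// dxi_ge0.
  have md : measurable_fun setT (EFin \o d).
    apply/measurable_EFinP; apply: measurableT_comp => //.
    exact: continuous_measurable_fun.
  have d_ge0 (x : R) : 0 <= (d x)%:E by rewrite lee_fin /d normr_ge0.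
  rewrite (integral_density_atom g0 mg (ltW E0) nuE md)//.
  congr (_ + _); last by rewrite /= -EFinM /d ger0_norm// dxi_ge0.
  apply: eq_integral => x; rewrite inE/= in_itv/= => /andP[x0 _].
  by rewrite -EFinM /d ger0_norm// dxi_ge0.
transitivity (\int[leb]_(x in `[0%R, 1%R[) (nu [set` `](x : R), 1%R]%R])^-1).
  symmetry; apply: integral_itv_bndo_bndc.
  apply: eq_measurable_fun (measurable_inv_tail g0 mg E0) => x.
  rewrite inE/= in_itv/= => x01.
  by rewrite (density_atom_tail nuE).
apply: eq_integral => x; rewrite inE/= in_itv/= => x01.
by rewrite (density_atom_tail nuE).
Qed.

Let I2N := \int[leb]_(x in `[0%R, 1%R[) (2 / N x)%:E.

Let mN : measurable_fun `[(0:R)%R, 1%R[ N.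
Proof.
have [_ f0 iN] := pN; apply/measurable_EFinP.
have -> : (EFin \o N) = (fun x => - (- (N x)%:E)) by apply/funext => x; rewrite oppeK.
apply/measurableT_comp => //; apply: monotone_measurable.
  exact: interval_is_interval.
move=> x y /[!inE]/=; rewrite !in_itv/= => /andP[x0 _] /andP[_ /ltW y1] xy.
rewrite lee_fin -subr_ge0 -lee_fin -iN//.
apply: integral_ge0 => t /=; rewrite in_itv/= => /andP[xt ty].
by rewrite lee_fin f0// in_itv/= (le_trans x0 xt) (lt_le_trans ty).
Qed.

Let mk : measurable_fun `[(0:R)%R, 1%R[ k. Proof. by case: pc. Qed.

Let N_gt0' x : x \in `[0%R, 1%R[ -> (0 < N x)%R.
Proof.
by move=> x01; apply: N_gt0; move: x01; rewrite !in_itv/= => /andP[-> /ltW].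
Qed.

Let m2N : measurable_fun `[(0:R)%R, 1%R[ (fun x => (2 / N x)%:E).
Proof.
apply/measurable_EFinP; apply: (eq_measurable_fun (fun x => 2 * (k x * N x)))%R.
  move=> x /[!inE]/= /N_gt0' Nx; rewrite /k; field.
  by rewrite gt_eqF.
by apply: measurable_funM => //; exact: measurable_funM.
Qed.

Section competitor.
Variables (g : R -> R) (E : R).
Hypotheses (gadm : admissible_density g) (E0 : (0 < E)%R).

Let g0 := adm_ge0 gadm.
Let mg := admissible_measurable gadm.
(** By integral_tailM, the integrand of the functional in which c replaces xi'. *)
Let phi x := (tail g x + E%:E) * (k x)%:E + (tail g x + E%:E)^-1.

Let tE_gt0 x : (0 <= x)%R -> 0 < tail g x + E%:E.
Proof.
move=> x0; apply: (@lt_le_trans _ _ E%:E); first by rewrite lte_fin.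
by rewrite leeDr// tail_ge0.
Qed.

Let k_ge0 x : 0 <= (k x)%:E. Proof. by rewrite lee_fin invr_ge0 sqr_ge0. Qed.

Let mtE : measurable_fun `[(0:R)%R, 1%R[ (fun x => tail g x + E%:E).
Proof. by apply: emeasurable_funD => //; exact: measurable_tail. Qed.

Let mtEk : measurable_fun `[(0:R)%R, 1%R[ (fun x => (tail g x + E%:E) * (k x)%:E).
Proof. by apply: emeasurable_funM => //; exact/measurable_EFinP. Qed.

Let mphi : measurable_fun `[(0:R)%R, 1%R[ phi.
Proof. by apply: emeasurable_funD => //; exact: measurable_inv_tail. Qed.

Let in01 x : x \in `[(0:R)%R, 1%R[%classic -> (0 <= x < 1)%R.
Proof. by rewrite inE/= in_itv. Qed.

Lemma phi_energy : \int[leb]_(x in `[0%R, 1%R[) phi x =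
  \int[leb]_(x in `[0%R, 1%R[) (c x * g x)%:E + (E * dxi 1)%:E +
  \int[leb]_(x in `[0%R, 1%R[) (tail g x + E%:E)^-1.
Proof.
rewrite ge0_integralD//; first last.
- exact: measurable_inv_tail.
- by move=> x; rewrite /= in_itv/= => /andP[x0 _]; rewrite inve_ge0 ltW// tE_gt0.
- by move=> x; rewrite /= in_itv/= => /andP[x0 _]; rewrite mule_ge0// ltW// tE_gt0.
congr (_ + _).
transitivity (\int[leb]_(x in `[0%R, 1%R[) (tail g x * (k x)%:E + E%:E * (k x)%:E)).
  apply: eq_integral => x /in01/andP[x0 _].
  by rewrite ge0_muleDl ?tail_ge0// lee_fin ltW.
rewrite ge0_integralD//; first last.
- by apply: emeasurable_funM => //; exact/measurable_EFinP.
- by move=> x _; rewrite mule_ge0// lee_fin ltW.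
- by apply: emeasurable_funM; [exact: measurable_tail|exact/measurable_EFinP].
- by move=> x; rewrite /= in_itv/= => /andP[x0 _]; rewrite mule_ge0// tail_ge0.
rewrite (integral_tailM g0 mg pc)// ge0_integralZl//; last 2 first.
- exact/measurable_EFinP.
- by rewrite lee_fin ltW.
have [_ _ ->] := pc; rewrite ?ler01 ?lexx//.
by rewrite c0 subr0 c1 -EFinM.
Qed.

(** The pointwise inequality of arithmetic and geometric means, for the tail of the
    competitor against N. *)
Lemma le_I2N_phi : I2N <= \int[leb]_(x in `[0%R, 1%R[) phi x.
Proof.
apply: ge0_le_integral => //.
  by move=> x /N_gt0' Nx; rewrite lee_fin divr_ge0// ltW.
move=> x x01; have /andP[x0 _] : (0 <= x < 1)%R by move: x01; rewrite /= in_itv.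
by have [] := amgm_inv (N_gt0' x01) (tE_gt0 x0).
Qed.

(** Replacing c by xi' can only increase the pairing with a nondecreasing density: by the
    layer-cake comparison it suffices to compare on final segments, where this is A >= xi. *)
Lemma le_phi_energy : \int[leb]_(x in `[0%R, 1%R[) phi x <= energy g E.
Proof.
rewrite phi_energy; apply: leeD => //; apply: leeD => //.
have [mdxi dxi0 ixi] := pxi; have [mc c_ge0 ic] := pA; have [_ _ g_nd] := gadm.
apply: le_integral_nondecreasing_weight => // t /andP[t0 t1].
rewrite ic ?lexx// ixi ?lexx// lee_fin A1 lerD2l lerN2 xiA//.
by rewrite in_itv/= t0.
Qed.

(** Two ordered functions with the same finite integral agree almost everywhere, and then
    the equality case of the pointwise inequality identifies the tail. *)
Lemma phi_eq_tail : I2N < +oo -> \int[leb]_(x in `[0%R, 1%R[) phi x = I2N ->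
  {ae leb, forall x, `[0%R, 1%R[%classic x -> tail g x + E%:E = (N x)%:E}.
Proof.
move=> Ifin phiI.
pose del x := phi x - (2 / N x)%:E.
have mdel : measurable_fun `[(0:R)%R, 1%R[ del.
  by apply: emeasurable_funB.
have del0 x : `[(0:R)%R, 1%R[%classic x -> 0 <= del x.
  move=> x01; have /andP[x0 _] : (0 <= x < 1)%R by move: x01; rewrite /= in_itv.
  by have [h _] := amgm_inv (N_gt0' x01) (tE_gt0 x0); rewrite sube_ge0.
have N20 x : `[(0:R)%R, 1%R[%classic x -> 0 <= (2 / N x)%:E.
  by move=> /N_gt0' Nx; rewrite lee_fin divr_ge0// ltW.
have I0 : 0 <= I2N by exact: integral_ge0.
have : \int[leb]_(x in `[0%R, 1%R[) del x = 0.
  have Ifn : I2N \is a fin_num by rewrite ge0_fin_numE.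
  have : I2N + \int[leb]_(x in `[0%R, 1%R[) del x = I2N.
    rewrite -[RHS]phiI -ge0_integralD//; apply: eq_integral => x _.
    by rewrite /del addeC subeK.
  by move=> /(congr1 (fun z => z - I2N)); rewrite addeAC subee// add0e.
move=> del00.
have : \int[leb]_(x in `[0%R, 1%R[) `|del x| = 0.
  rewrite -[RHS]del00; apply: eq_integral => x; rewrite inE => x01.
  by rewrite gee0_abs// del0.
move=> /ae_eq_integral_abs => /(_ (measurable_itv _) mdel).
apply: filterS => x h x01; have /= dx := h x01.
have /andP[x0 _] : (0 <= x < 1)%R by move: x01; rewrite /= in_itv.
have [_] := amgm_inv (N_gt0' x01) (tE_gt0 x0); apply; rewrite -/(phi x).
by rewrite -[phi x](@subeK _ _ (2 / N x)%:E)// -/(del x) dx add0e.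
Qed.

End competitor.

Let sub01 x y : (0 <= x)%R -> (y <= 1)%R -> `[x, y[%classic `<=` (`[(0:R)%R, 1%R[%classic : set R).
Proof.
move=> x0 y1 t /=; rewrite !in_itv/= => /andP[xt ty].
by rewrite (le_trans x0 xt) (lt_le_trans ty y1).
Qed.

Let f0 := adm_ge0 fadm.
Let mf := admissible_measurable fadm.

Let tail_self x : (0 <= x < 1)%R -> tail f x + D%:E = (N x)%:E.
Proof.
move=> /andP[x0 x1]; rewrite /tail integral_itv_obnd_cbnd; last first.
  apply/measurable_EFinP; apply: measurable_funS mf => //.
  by move=> t /=; rewrite !in_itv/= => /andP[/ltW xt ->]; rewrite (le_trans x0).
by case: pN => _ _ ->//; [rewrite N1 -EFinD; congr EFin; ring|exact: ltW].
Qed.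

Let phi_self : \int[leb]_(x in `[0%R, 1%R[)
    ((tail f x + D%:E) * (k x)%:E + (tail f x + D%:E)^-1) = I2N.
Proof.
apply: eq_integral => x; rewrite inE => x01; have Nx := N_gt0' x01.
move: x01; rewrite /= in_itv/= => /tail_self ->.
rewrite -EFinM inver gt_eqF// -EFinD; congr EFin; rewrite /k; field.
by rewrite gt_eqF.
Qed.

Let integral_split (g : R -> R) : (forall x, x \in `[0%R, 1%R[ -> (0 <= g x)%R) ->
  measurable_fun `[(0:R)%R, 1%R[ g ->
  \int[leb]_(x in `[0%R, 1%R[) (g x)%:E = \int[leb]_(x in `[0%R, q1[) (g x)%:E +
   (\int[leb]_(x in `[q1, q2[) (g x)%:E + \int[leb]_(x in `[q2, 1%R[) (g x)%:E).
Proof.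
move=> g0 mg.
have cut (x y z : R) : (0 <= x)%R -> (x <= y)%R -> (y <= z)%R -> (z <= 1)%R ->
  \int[leb]_(t in `[x, z[) (g t)%:E =
  \int[leb]_(t in `[x, y[) (g t)%:E + \int[leb]_(t in `[y, z[) (g t)%:E.
  move=> x0 xy yz z1.
  rewrite (@itv_bndbnd_setU _ _ _ (BLeft y)) ?bnd_simp// ge0_integral_setU//.
  - rewrite -itv_bndbnd_setU ?bnd_simp//; apply/measurable_EFinP.
    by apply: measurable_funS mg => //; exact: sub01.
  - move=> t; rewrite -itv_bndbnd_setU ?bnd_simp// => /(sub01 x0 z1) /g0.
    by rewrite lee_fin.
  - apply/disj_set2P/seteqP; split => t //=; rewrite !in_itv/=.
    by move=> [/andP[_ tb] /andP[bt _]]; move: tb; rewrite ltNge bt.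
have q2_ge0 := le_trans q1_ge0 q12.
by rewrite (cut 0%R q1 1%R)// ?(le_trans q12)// (cut q1 q2 1%R).
Qed.

Let integral_const_weight (G g : R -> R) (a b m : R) : primitive_on G g 0 1 ->
  (0 <= a)%R -> (a <= b)%R -> (b <= 1)%R ->
  (forall x, x \in `[a, b[ -> f x = m) ->
  \int[leb]_(x in `[a, b[) (g x * f x)%:E = m%:E * (G b - G a)%:E.
Proof.
move=> [mg g0 ig] a0; rewrite le_eqVlt => /orP[/eqP <- _ _|ab b1 fm].
  by rewrite set_itvco0 integral_set0 subrr mule0.
have m0 : (0 <= m)%R.
  rewrite -(fm a); last by rewrite in_itv/= lexx.
  by apply: f0; rewrite in_itv/= a0 (lt_le_trans ab).
have sab := sub01 a0 b1.
rewrite -ig// ?(ltW ab)// -ge0_integralZl//.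
- apply: eq_integral => x; rewrite inE/= => xab.
  by rewrite fm// -EFinM mulrC.
- by apply/measurable_EFinP; apply: measurable_funS mg.
- by move=> x /sab /g0; rewrite lee_fin.
Qed.

(** On a piece where f is constant, pairing it with xi' or with c gives the same value
    because A = xi at the two ends; on the middle piece c = xi'. *)
Let energy_self : energy f D = I2N.
Proof.
rewrite -phi_self (phi_energy fadm D0) /energy; congr (_ + _ + _).
have [mdxi dxi0 ixi] := pxi; have [mc c_ge0 ic] := pA.
rewrite integral_split//; last 2 first.
- by move=> x x01; rewrite mulr_ge0 ?f0 ?dxi0.
- exact: measurable_funM.
rewrite [RHS]integral_split//; last 2 first.
- by move=> x x01; rewrite mulr_ge0 ?f0 ?c_ge0.
- exact: measurable_funM.
rewrite (integral_const_weight pxi _ q1_ge0 (le_trans q12 q2_le1) fq1)//.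
rewrite (integral_const_weight pA _ q1_ge0 (le_trans q12 q2_le1) fq1)//.
rewrite (integral_const_weight pxi (le_trans q1_ge0 q12) q2_le1 _ fq2)//.
rewrite (integral_const_weight pA (le_trans q1_ge0 q12) q2_le1 _ fq2)//.
rewrite Aq1 Aq2 A0 xi0 A1; congr (_ + (_ + _)).
by apply: eq_integral => x; rewrite inE/= => /cq12 ->.
Qed.

Let I2N_fin : I2N < +oo.
Proof.
have [_ _ iN] := pN.
apply: (@le_lt_trans _ _ (\int[leb]_(x in `[0%R, 1%R[) (cst (2 / D)%:E x))); last first.
  rewrite integral_cst//= lebesgue_measure_itv/= lte_fin ltr01 -EFinB -EFinM.
  exact: ltry.
apply: ge0_le_integral => //.
- by move=> x /N_gt0' Nx; rewrite lee_fin divr_ge0// ltW.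
move=> x x01; have Nx := N_gt0' x01; rewrite lee_fin ler_pM2l// lef_pV2 ?posrE//.
move: x01; rewrite /= in_itv/= => x01; rewrite -lee_fin -tail_self//.
by rewrite leeDr// tail_ge0//; case/andP: x01.
Qed.

Section uniqueness.
Variables (g : R -> R) (E : R).
Hypotheses (gadm : admissible_density g).
Hypothesis gfE : {ae leb, forall x, `[0%R, 1%R[%classic x -> tail g x + E%:E = (N x)%:E}.

Let g0 := adm_ge0 gadm.
Let mg := admissible_measurable gadm.

Let good x := tail g x + E%:E = (N x)%:E.

Let good_dense x y : (0 <= x)%R -> (x < y)%R -> (y <= 1)%R ->
  exists2 z, (x < z < y)%R & good z.
Proof.
move=> x0 xy y1; apply: contrapT => h.
case: gfE => Z [mZ Z0 ZE].
have : leb `]x, y[ <= leb Z.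
  apply: le_measure; rewrite ?inE//.
  move=> t; rewrite /= in_itv/= => /andP[xt ty]; apply: ZE => /= tg.
  apply: h; exists t; first by rewrite xt.
  apply: tg; rewrite /= in_itv/= (le_trans x0 (ltW xt))/=.
  exact: lt_le_trans ty y1.
rewrite Z0 lebesgue_measure_itv/= lte_fin xy -EFinB lee_fin.
by rewrite subr_le0 leNgt xy.
Qed.

Let good_integral x y : (0 <= x)%R -> (x < y)%R -> (y < 1)%R -> good x -> good y ->
  \int[leb]_(t in `]x, y]) (g t)%:E = (N x - N y)%:E.
Proof.
rewrite /good => x0 xy y1 gx gy.
have sub : `]x, 1%R[%classic `<=` (`[0%R, 1%R[%classic : set R).
  by move=> t /=; rewrite !in_itv/= => /andP[/ltW xt ->]; rewrite (le_trans x0).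
have : tail g x = \int[leb]_(t in `]x, y]) (g t)%:E + tail g y.
  rewrite /tail (@itv_bndbnd_setU _ _ _ (BRight y)) ?bnd_simp ?ltW// ge0_integral_setU//.
  - rewrite -itv_bndbnd_setU ?bnd_simp ?(ltW xy)//.
      by apply/measurable_EFinP; exact: measurable_funS mg.
  - move=> t; rewrite -itv_bndbnd_setU ?bnd_simp ?(ltW xy)//.
      by move=> /sub /g0; rewrite lee_fin.
  - apply/disj_set2P/seteqP; split => t //=; rewrite !in_itv/=.
    by move=> [/andP[_ tb] /andP[bt _]]; move: tb; rewrite leNgt bt.
have ty_fin : tail g y \is a fin_num.
  by move: gy; case: (tail g y).
have ty : tail g y = (N y - E)%:E.
  by rewrite EFinB -gy addeK.
have tx : tail g x = (N x - E)%:E.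
  by rewrite EFinB -gx addeK.
rewrite ty tx; case: (\int[leb]_(t in `]x, y]) _) => [r| |]//.
by rewrite -EFinD => -[e]; congr EFin; lra.
Qed.

Let mean_bounds (e : R -> R) x y z t v : admissible_density e ->
  (0 <= x)%R -> (x < z)%R -> (z < t)%R -> (t < y)%R -> (y < 1)%R ->
  \int[leb]_(t in `]z, t]) (e t)%:E = v%:E ->
  (e x * (t - z) <= v <= e y * (t - z))%R.
Proof.
move=> eadm x0 xz zt ty y1 eI; have [e0 _ e_nd] := eadm.
have me := admissible_measurable eadm.
have in01 w : (z < w <= t)%R -> [/\ w \in `[0%R, 1%R[, (x <= w)%R & (w <= y)%R].
  move=> /andP[zw wt]; rewrite in_itv/=; split.
  - by rewrite (ltW (le_lt_trans x0 (lt_trans xz zw))) (le_lt_trans wt)// (lt_trans ty).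
  - by rewrite ltW// (lt_trans xz).
  - by rewrite (le_trans wt)// ltW.
have xy : (x < y)%R by lra.
have x01 : x \in `[0%R, 1%R[ by rewrite in_itv/= x0 (lt_trans xy).
have y01 : y \in `[0%R, 1%R[ by rewrite in_itv/= y1 (ltW (le_lt_trans x0 xy)).
have lebzt : leb (`]z, t] : set R) = (t - z)%:E.
  by rewrite lebesgue_measure_itv/= lte_fin zt -EFinB.
have mezt : measurable_fun (`]z, t]%classic : set R) (EFin \o e).
  apply/measurable_EFinP; apply: measurable_funS me => // w /=.
  by rewrite in_itv/= => /in01[].
apply/andP; rewrite -!lee_fin -eI; split.
  rewrite EFinM -lebzt -integral_cst//; apply: ge0_le_integral => //.
  - by move=> w _; rewrite lee_fin e0.
  - by move=> w; rewrite /= in_itv/= => /in01[w01 xw _]; rewrite lee_fin e_nd.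
rewrite EFinM -lebzt -integral_cst//; apply: ge0_le_integral => //.
- by move=> w; rewrite /= in_itv/= => /in01[w01 _ _]; rewrite lee_fin e0.
- by move=> w; rewrite /= in_itv/= => /in01[w01 _ yw]; rewrite lee_fin e_nd.
Qed.

Let f_integral x y : (0 <= x)%R -> (x < y)%R -> (y < 1)%R ->
  \int[leb]_(t in `]x, y]) (f t)%:E = (N x - N y)%:E.
Proof.
move=> x0 xy y1.
have sub : `[x, y]%classic `<=` (`[0%R, 1%R[%classic : set R).
  by move=> t /=; rewrite !in_itv/= => /andP[xt ty]; rewrite (le_trans x0)// (le_lt_trans ty).
have mxy : measurable_fun (`[x, y]%classic : set R) (EFin \o f).
  by apply/measurable_EFinP; apply: measurable_funS mf.
rewrite integral_itv_obnd_cbnd; last first.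
  by apply: measurable_funS mxy => //; apply: subset_itvr; rewrite bnd_simp.
rewrite -integral_itv_bndo_bndc; last first.
  by apply: measurable_funS mxy => //; apply: subset_itvl; rewrite bnd_simp.
by case: pN => _ _ ->//; rewrite ?ltW//; congr EFin; ring.
Qed.

Let le_gf x y : (0 <= x)%R -> (x < y)%R -> (y < 1)%R ->
  (g x <= f y)%R /\ (f x <= g y)%R.
Proof.
move=> x0 xy y1.
have [z /andP[xz zy] gz] := good_dense x0 xy (ltW y1).
have z0 : (0 <= z)%R by rewrite (le_trans x0)// ltW.
have [t /andP[zt ty] gt] := good_dense z0 zy (ltW y1).
have t1 := lt_trans ty y1.
have /andP[gx gy] := mean_bounds gadm x0 xz zt ty y1 (good_integral z0 zt t1 gz gt).
have /andP[fx fy] := mean_bounds fadm x0 xz zt ty y1 (f_integral z0 zt t1).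
have tz : (0 < t - z)%R by rewrite subr_gt0.
by rewrite -(ler_pM2r tz) (le_trans gx fy) -(ler_pM2r tz) (le_trans fx gy).
Qed.

Let limit_le (e1 e2 : R -> R) x : (0 <= x < 1)%R ->
  e2 y @[y --> x^'+] --> e2 x ->
  (forall y, (x < y)%R -> (y < 1)%R -> (e1 x <= e2 y)%R) -> (e1 x <= e2 x)%R.
Proof.
move=> /andP[x0 x1] ce2 h; apply: (cvgr_to_ge ce2).
near=> y; apply: h; first by near: y; exact: nbhs_right_gt.
by near: y; exact: nbhs_right_lt.
Unshelve. all: by end_near. Qed.

(** Equal tails give equal integrals over almost all short intervals; a monotone
    right-continuous density is recovered from these by squeezing. *)
Lemma tail_inj : (forall x, x \in `[0%R, 1%R[ -> g x = f x) /\ E = D.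
Proof.
have gf x : x \in `[0%R, 1%R[ -> g x = f x.
  move=> x01; have x01' : (0 <= x < 1)%R by rewrite in_itv in x01.
  have [_ fr _] := fadm; have [_ gr _] := gadm; have /andP[x0 _] := x01'.
  apply/le_anti/andP; split; apply: limit_le => //; try exact: fr; try exact: gr.
  - by move=> y xy y1; case: (le_gf x0 xy y1).
  - by move=> y xy y1; case: (le_gf x0 xy y1).
split => //.
have [z /andP[z0 z1] gz] := good_dense (lexx _) ltr01 (lexx _).
have z01 : (0 <= z < 1)%R by rewrite z1 ltW.
have := tail_self z01; rewrite -gz.
have -> : tail f z = tail g z.
  apply: eq_integral => y; rewrite inE/= in_itv/= => /andP[zy y1].
  by rewrite gf// in_itv/= y1 (ltW (lt_trans z0 zy)).
move: gz; rewrite /good; case: (tail g z) => [r| |]// _ [].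
by move=> /addrI.
Qed.

End uniqueness.

(** Replacing xi' by c lowers the value at a competitor, because A >= xi, and the result is at
    least the integral of 2 / N, by the pointwise inequality; for nu itself both are
    equalities. *)
Theorem parisi_certificate (nu : borel_measure R) :
  has_density_atom nu f D -> is_parisi_measure xi nu.
Proof.
move=> nuE; have h2 : 0 < (2^-1)%:E :> \bar R by rewrite lte_fin.
have QE : Qfun xi nu = (2^-1)%:E * I2N by rewrite (Qfun_energy fadm D0 nuE) energy_self.
split; first by exists f, D.
move=> nu' [g [E [gadm E0 nu'E]]].
have Q'E := Qfun_energy gadm E0 nu'E.
have le1 := le_I2N_phi gadm E0; have le2 := le_phi_energy gadm E0.
rewrite QE Q'E; split.
  by rewrite lee_pmul2l// (le_trans le1).
move=> QQ B mB.
have EE : energy g E = I2N.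
  by apply/le_anti/andP; split; rewrite -(@lee_pmul2l _ (2^-1)%:E)// QQ.
have phiE := phi_eq_tail gadm E0 I2N_fin.
have [gf ED] : (forall x, x \in `[0%R, 1%R[ -> g x = f x) /\ E = D.
  apply: tail_inj => //; apply: phiE; apply/le_anti.
  by rewrite le1 -[X in _ <= X]EE le2.
rewrite nuE// nu'E// ED; congr (_ + _); apply: eq_integral => x.
by rewrite inE => -[_ /= x01]; rewrite gf.
Qed.

End Certificate.

(** * Sign patterns of derivatives and of convex-concave functions *)

Section Calculus.
Context {R : realType}.
Implicit Types (F G : R -> R) (a b x y : R).

Definition derive_on F F1 a b :=
  forall x, a <= x -> x <= b -> is_derive x 1 F (F1 x).

Definition C2_on F F1 F2 a b := derive_on F F1 a b /\ derive_on F1 F2 a b.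

Lemma derive_on_sub F F1 a b c d : a <= c -> d <= b ->
  derive_on F F1 a b -> derive_on F F1 c d.
Proof. by move=> ac db h x cx xd; apply: h; [exact: le_trans cx|exact: le_trans xd db]. Qed.

Lemma C2_on_sub F F1 F2 a b c d : a <= c -> d <= b ->
  C2_on F F1 F2 a b -> C2_on F F1 F2 c d.
Proof. by move=> ac db [h1 h2]; split; exact: derive_on_sub ac db _. Qed.

Lemma derive_onB F F1 G G1 a b : derive_on F F1 a b -> derive_on G G1 a b ->
  derive_on (fun x => F x - G x) (fun x => F1 x - G1 x) a b.
Proof.
move=> dF dG x ax xb; have hF := dF x ax xb; have hG := dG x ax xb.
exact: is_deriveB.
Qed.

Lemma C2_onB F F1 F2 G G1 G2 a b : C2_on F F1 F2 a b -> C2_on G G1 G2 a b ->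
  C2_on (fun x => F x - G x) (fun x => F1 x - G1 x) (fun x => F2 x - G2 x) a b.
Proof. by move=> [f1 f2] [g1 g2]; split; exact: derive_onB. Qed.

Lemma mean_value F F1 a b : a < b -> derive_on F F1 a b ->
  exists2 c, a < c < b & F b - F a = F1 c * (b - a).
Proof.
move=> ab dF; have [||c cab e] := @MVT R F F1 a b ab.
- by move=> x /[!in_itv]/= /andP[/ltW ax /ltW xb]; exact: dF.
- apply: derivable_within_continuous => x /[!in_itv]/= /andP[ax xb].
  by case: (dF x ax xb).
by exists c => //; move: cab; rewrite in_itv.
Qed.

Lemma derive_gt0 F F1 a b : a < b -> derive_on F F1 a b -> F a < F b ->
  exists2 c, a < c < b & 0 < F1 c.
Proof.
move=> ab dF Fab; have [c cab e] := mean_value ab dF; exists c => //.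
have : 0 < F1 c * (b - a) by rewrite -e subr_gt0.
by rewrite pmulr_lgt0// subr_gt0.
Qed.

Lemma derive_lt0 F F1 a b : a < b -> derive_on F F1 a b -> F b < F a ->
  exists2 c, a < c < b & F1 c < 0.
Proof.
move=> ab dF Fab; have [c cab e] := mean_value ab dF; exists c => //.
have : F1 c * (b - a) < 0 by rewrite -e subr_lt0.
by rewrite pmulr_llt0// subr_gt0.
Qed.

Lemma derive_nondecreasing F F1 a b x y : derive_on F F1 a b ->
  (forall t, a < t < b -> 0 <= F1 t) -> a <= x -> x <= y -> y <= b -> F x <= F y.
Proof.
move=> dF h ax; rewrite le_eqVlt => /orP[/eqP ->//|xy] yb; rewrite leNgt.
apply/negP => /(derive_lt0 xy (derive_on_sub ax yb dF))[c /andP[xc cy]].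
by rewrite ltNge h// (le_lt_trans ax xc) (lt_le_trans cy yb).
Qed.

Lemma derive_increasing F F1 a b x y : derive_on F F1 a b ->
  (forall t, a < t < b -> 0 < F1 t) -> a <= x -> x < y -> y <= b -> F x < F y.
Proof.
move=> dF h ax xy yb.
have [c /andP[xc cy] e] := mean_value xy (derive_on_sub ax yb dF).
rewrite -subr_gt0 e mulr_gt0 ?subr_gt0// h//.
by rewrite (le_lt_trans ax xc) (lt_le_trans cy yb).
Qed.

Lemma derive_nonincreasing F F1 a b x y : derive_on F F1 a b ->
  (forall t, a < t < b -> F1 t <= 0) -> a <= x -> x <= y -> y <= b -> F y <= F x.
Proof.
move=> dF h ax; rewrite le_eqVlt => /orP[/eqP ->//|xy] yb; rewrite leNgt.
apply/negP => /(derive_gt0 xy (derive_on_sub ax yb dF))[c /andP[xc cy]].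
by rewrite ltNge h// (le_lt_trans ax xc) (lt_le_trans cy yb).
Qed.

Lemma derive_decreasing F F1 a b x y : derive_on F F1 a b ->
  (forall t, a < t < b -> F1 t < 0) -> a <= x -> x < y -> y <= b -> F y < F x.
Proof.
move=> dF h ax xy yb.
have [c /andP[xc cy] e] := mean_value xy (derive_on_sub ax yb dF).
rewrite -subr_lt0 e nmulr_rlt0 ?subr_gt0// h//.
by rewrite (le_lt_trans ax xc) (lt_le_trans cy yb).
Qed.

(** The derivative F1 must rise, fall and rise again to leave the first double zero upwards
    and come back tangentially to the second one. *)
Lemma double_zeros_pos F F1 F2 a b y : C2_on F F1 F2 a b -> a < y < b ->
  F a = 0 -> F1 a = 0 -> F b = 0 -> F1 b = 0 -> 0 < F y ->
  exists t1 t2 t3, [/\ a < t1, t1 < t2, t2 < t3 & t3 < b] /\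
    [/\ 0 < F2 t1, F2 t2 < 0 & 0 < F2 t3].
Proof.
move=> [d1 d2] /andP[ay yb] Fa F1a Fb F1b Fy.
have [|c1 /andP[ac1 c1y] F1c1] := derive_gt0 ay (derive_on_sub (lexx a) (ltW yb) d1).
  by rewrite Fa.
have [|c2 /andP[yc2 c2b] F1c2] := derive_lt0 yb (derive_on_sub (ltW ay) (lexx b) d1).
  by rewrite Fb.
have c1c2 := lt_trans c1y yc2; have c1b := lt_trans c1c2 c2b.
have ac2 := lt_trans ac1 c1c2.
have [|t1 /andP[at1 t1c1] h1] := derive_gt0 ac1 (derive_on_sub (lexx a) (ltW c1b) d2).
  by rewrite F1a.
have [|t2 /andP[c1t2 t2c2] h2] := derive_lt0 c1c2 (derive_on_sub (ltW ac1) (ltW c2b) d2).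
  exact: lt_trans F1c1.
have [|t3 /andP[c2t3 t3b] h3] := derive_gt0 c2b (derive_on_sub (ltW ac2) (lexx b) d2).
  by rewrite F1b.
exists t1, t2, t3; do !split => //.
- exact: lt_trans t1c1 c1t2.
- exact: lt_trans t2c2 c2t3.
Qed.

Lemma double_zeros_neg F F1 F2 a b y : C2_on F F1 F2 a b -> a < y < b ->
  F a = 0 -> F1 a = 0 -> F b = 0 -> F1 b = 0 -> F y < 0 ->
  exists t1 t2 t3, [/\ a < t1, t1 < t2, t2 < t3 & t3 < b] /\
    [/\ F2 t1 < 0, 0 < F2 t2 & F2 t3 < 0].
Proof.
move=> [d1 d2] /andP[ay yb] Fa F1a Fb F1b Fy.
have [|c1 /andP[ac1 c1y] F1c1] := derive_lt0 ay (derive_on_sub (lexx a) (ltW yb) d1).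
  by rewrite Fa.
have [|c2 /andP[yc2 c2b] F1c2] := derive_gt0 yb (derive_on_sub (ltW ay) (lexx b) d1).
  by rewrite Fb.
have c1c2 := lt_trans c1y yc2; have c1b := lt_trans c1c2 c2b.
have ac2 := lt_trans ac1 c1c2.
have [|t1 /andP[at1 t1c1] h1] := derive_lt0 ac1 (derive_on_sub (lexx a) (ltW c1b) d2).
  by rewrite F1a.
have [|t2 /andP[c1t2 t2c2] h2] := derive_gt0 c1c2 (derive_on_sub (ltW ac1) (ltW c2b) d2).
  exact: lt_trans F1c2.
have [|t3 /andP[c2t3 t3b] h3] := derive_lt0 c2b (derive_on_sub (ltW ac2) (lexx b) d2).
  by rewrite F1b.
exists t1, t2, t3; do !split => //.
- exact: lt_trans t1c1 c1t2.
- exact: lt_trans t2c2 c2t3.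
Qed.

End Calculus.

Section Shape.
Context {R : realType}.
Implicit Types (u : R -> R) (x y z : R).

(** Strict convexity on the interval I, tested on triples of points so that zeros and signs
    can be read off directly. *)
Definition convex3 (I : R -> Prop) u := forall x y z, I x -> I z -> x < y -> y < z ->
  (z - x) * u y < (z - y) * u x + (y - x) * u z.
Definition concave3 (I : R -> Prop) u := forall x y z, I x -> I z -> x < y -> y < z ->
  (z - y) * u x + (y - x) * u z < (z - x) * u y.

Lemma convex3_affine I u al be : convex3 I u -> convex3 I (fun x => u x - (al + be * x)).
Proof. by move=> h x y z Ix Iz xy yz; have := h x y z Ix Iz xy yz; lra. Qed.

Lemma concave3_affine I u al be : concave3 I u -> concave3 I (fun x => u x - (al + be * x)).
Proof. by move=> h x y z Ix Iz xy yz; have := h x y z Ix Iz xy yz; lra. Qed.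

Lemma convex3_up I u x y z : convex3 I u -> I x -> I z -> x < y -> y <= z ->
  u x < 0 -> 0 <= u y -> 0 <= u z.
Proof.
move=> h Ix Iz xy; rewrite le_eqVlt => /orP[/eqP ->//|yz] ux uy.
have := h x y z Ix Iz xy yz; nra.
Qed.

Lemma concave3_down I u x y z : concave3 I u -> I x -> I z -> x < y -> y <= z ->
  0 <= u x -> u y < 0 -> u z < 0.
Proof.
move=> h Ix Iz xy; rewrite le_eqVlt => /orP[/eqP <-//|yz] ux uy.
have := h x y z Ix Iz xy yz; nra.
Qed.

Lemma derive_increasing_convex3 (I : R -> Prop) u u1 :
  (forall x z, I x -> I z -> derive_on u u1 x z) ->
  (forall x y z, I x -> I z -> x < y -> y < z -> forall s t, x <= s -> s < t -> t <= z -> u1 s < u1 t) ->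
  convex3 I u.
Proof.
move=> du u1i x y z Ix Iz xy yz; have d := du _ _ Ix Iz.
have [c1 /andP[xc cy] e1] := mean_value xy (derive_on_sub (lexx _) (ltW yz) d).
have [c2 /andP[yc cz] e2] := mean_value yz (derive_on_sub (ltW xy) (lexx _) d).
have := u1i x y z Ix Iz xy yz c1 c2 (ltW xc) (lt_trans cy yc) (ltW cz).
have -> : u z = u y + u1 c2 * (z - y) by lra.
have -> : u x = u y - u1 c1 * (y - x) by lra.
move=> c12; rewrite -subr_gt0.
have -> : (z - y) * (u y - u1 c1 * (y - x)) + (y - x) * (u y + u1 c2 * (z - y)) -
  (z - x) * u y = (u1 c2 - u1 c1) * ((y - x) * (z - y)) by ring.
by rewrite !mulr_gt0// subr_gt0.
Qed.

Variables (x1 x2 : R) (u : R -> R).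
Hypotheses (x12 : x1 < x2) (x1_gt0 : 0 < x1).
Hypotheses (cvx1 : convex3 (fun x => 0 < x <= x1) u)
  (ccv : concave3 (fun x => x1 <= x <= x2) u) (cvx2 : convex3 (fun x => x2 <= x) u).

(** A line meets a graph that is convex, then concave, then convex at most four times. Here
    and in the next two lemmas u is the height of the graph above the line, and the
    conclusions exclude the sign patterns that would need more crossings. *)
Lemma shape_low t1 t2 t3 t4 : 0 < t1 -> t1 < t2 -> t2 < t3 -> t3 < t4 -> t4 <= x2 ->
  u t1 < 0 -> 0 <= u t2 -> u t3 < 0 -> u t4 < 0.
Proof.
move=> t10 t12 t23 t34 t4x u1 u2 u3.
have [t2x|t2x] := leP t2 x1; last first.
  by apply: (concave3_down ccv (x := t2) (y := t3)) => //; try (apply/andP; split); lra.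
have [t3x|t3x] := leP t3 x1.
  have : 0 <= u t3 by apply: (convex3_up cvx1 (x := t1) (y := t2)) => //; try (apply/andP; split); lra.
  by rewrite leNgt u3.
have ux1 : 0 <= u x1 by apply: (convex3_up cvx1 (x := t1) (y := t2)) => //; try (apply/andP; split); lra.
by apply: (concave3_down ccv (x := x1) (y := t3)) => //; try (apply/andP; split); lra.
Qed.

Lemma shape_high a y0 y z : x1 <= a -> a < y0 -> y0 < y -> y <= z ->
  0 <= u a -> u y0 < 0 -> 0 <= u y -> 0 <= u z.
Proof.
move=> xa ay0 y0y yz ua uy0 uy.
have [y0x|y0x] := leP x2 y0.
  by apply: (convex3_up cvx2 (x := y0) (y := y)) => //; try (apply/andP; split); lra.
have [yx|yx] := leP y x2.
  have : u y < 0 by apply: (concave3_down ccv (x := a) (y := y0)) => //; try (apply/andP; split); lra.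
  by rewrite ltNge uy.
have ux2 : u x2 < 0 by apply: (concave3_down ccv (x := a) (y := y0)) => //; try (apply/andP; split); lra.
by apply: (convex3_up cvx2 (x := x2) (y := y)) => //; try (apply/andP; split); lra.
Qed.

Lemma shape_all b a y0 y z : 0 < b -> b < a -> a < y0 -> y0 < y -> y <= z ->
  u b < 0 -> 0 <= u a -> u y0 < 0 -> 0 <= u y -> 0 <= u z.
Proof.
move=> b0 ba ay0 y0y yz ub ua uy0 uy.
have [ax|/ltW xa] := leP a x1; last exact: (shape_high xa ay0 y0y yz).
have [y0x|y0x] := leP y0 x1.
  have : 0 <= u y0 by apply: (convex3_up cvx1 (x := b) (y := a)) => //; try (apply/andP; split); lra.
  by rewrite leNgt uy0.
have ux1 : 0 <= u x1 by apply: (convex3_up cvx1 (x := b) (y := a)) => //; try (apply/andP; split); lra.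
exact: (shape_high (lexx _) y0x y0y yz).
Qed.

End Shape.

(** * The mixture, its tail profile and its inflection points *)

Section DeriveRules.
Context {R : realType}.
Implicit Types (f g : R -> R) (x : R).

Lemma deriv_eq f x a b : is_derive x 1 f a -> a = b -> is_derive x 1 f b.
Proof. by move=> h <-. Qed.

Lemma deriv_cst (a x : R) : is_derive x 1 (fun=> a) 0.
Proof. exact: is_derive_cst. Qed.

Lemma deriv_id (x : R) : is_derive x 1 (fun y => y) 1.
Proof. exact: is_derive_id. Qed.

Lemma deriv_add f g x a b : is_derive x 1 f a -> is_derive x 1 g b ->
  is_derive x 1 (fun y => f y + g y) (a + b).
Proof. by move=> hf hg; exact: is_deriveD. Qed.

Lemma deriv_sub f g x a b : is_derive x 1 f a -> is_derive x 1 g b ->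
  is_derive x 1 (fun y => f y - g y) (a - b).
Proof. by move=> hf hg; exact: is_deriveB. Qed.

Lemma deriv_opp f x a : is_derive x 1 f a -> is_derive x 1 (fun y => - f y) (- a).
Proof. by move=> hf; exact: is_deriveN. Qed.

Lemma deriv_mul f g x a b : is_derive x 1 f a -> is_derive x 1 g b ->
  is_derive x 1 (fun y => f y * g y) (a * g x + f x * b).
Proof.
move=> hf hg; apply: (deriv_eq (is_deriveM hf hg)).
by rewrite addrC /GRing.scale/= [g x * a]mulrC.
Qed.

Lemma deriv_scale f x a (k : R) : is_derive x 1 f a ->
  is_derive x 1 (fun y => k * f y) (k * a).
Proof.
by move=> hf; apply: (deriv_eq (deriv_mul (deriv_cst k x) hf)); rewrite mul0r add0r.
Qed.

Lemma deriv_exp f x a n : is_derive x 1 f a ->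
  is_derive x 1 (fun y => f y ^+ n) (n%:R * f x ^+ n.-1 * a).
Proof.
move=> hf.
have -> : (fun y => f y ^+ n) = f ^+ n by apply/funext => y; rewrite exprfctE.
by apply: (deriv_eq (is_deriveX n hf)); rewrite /GRing.scale/=.
Qed.

Lemma deriv_inv f x a : is_derive x 1 f a -> f x != 0 ->
  is_derive x 1 (fun y => (f y)^-1) (- (a / f x ^+ 2)).
Proof.
move=> hf f0; apply: (deriv_eq (is_deriveV f0 hf)).
by rewrite /GRing.scale/= mulNr mulrC.
Qed.

Lemma deriv_comp f g x a b : is_derive x 1 g b -> is_derive (g x) 1 f a ->
  is_derive x 1 (fun y => f (g y)) (a * b).
Proof.
by move=> hg hf; exact: is_derive1_comp.
Qed.

Lemma deriv_sqrt f x a : is_derive x 1 f a -> 0 < f x ->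
  is_derive x 1 (fun y => Num.sqrt (f y)) (a / (2 * Num.sqrt (f x))).
Proof.
move=> hf f0; apply: (deriv_eq (deriv_comp hf (is_derive1_sqrt f0))).
by rewrite mulrC.
Qed.

Lemma deriv_ln f x a : is_derive x 1 f a -> 0 < f x ->
  is_derive x 1 (fun y => ln (f y)) (a / f x).
Proof.
move=> hf f0; apply: (deriv_eq (deriv_comp hf (is_derive1_ln f0))).
by rewrite mulrC.
Qed.

Lemma deriv_continuous f x a : is_derive x 1 f a -> {for x, continuous f}.
Proof. by case=> d _; exact/differentiable_continuous/derivable1_diffP. Qed.

End DeriveRules.

Section Mixtures.
Context {R : realType}.
Variables (p s : nat).
Implicit Types (a b x : R).

Definition Xi a b x := a * x ^+ p + b * x ^+ s.
Definition Xi1 a b x := a * (p%:R * x ^+ p.-1) + b * (s%:R * x ^+ s.-1).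
Definition Xi2 a b x := a * (p%:R * (p.-1%:R * x ^+ p.-2)) + b * (s%:R * (s.-1%:R * x ^+ s.-2)).
Definition Xi3 a b x := a * (p%:R * (p.-1%:R * (p.-2%:R * x ^+ p.-2.-1))) +
   b * (s%:R * (s.-1%:R * (s.-2%:R * x ^+ s.-2.-1))).
Definition Xi4 a b x := a * (p%:R * (p.-1%:R * (p.-2%:R * (p.-2.-1%:R * x ^+ p.-2.-2)))) +
   b * (s%:R * (s.-1%:R * (s.-2%:R * (s.-2.-1%:R * x ^+ s.-2.-2)))).

Lemma deriv_pow n x : is_derive x 1 (fun y : R => y ^+ n) (n%:R * x ^+ n.-1).
Proof. by apply: (deriv_eq (deriv_exp n (deriv_id x))); rewrite mulr1. Qed.

Lemma deriv_Xi a b x : is_derive x 1 (Xi a b) (Xi1 a b x).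
Proof. by apply: deriv_add; apply: deriv_scale; exact: deriv_pow. Qed.

Lemma deriv_Xi1 a b x : is_derive x 1 (Xi1 a b) (Xi2 a b x).
Proof. by apply: deriv_add; do 2! apply: deriv_scale; exact: deriv_pow. Qed.

Lemma deriv_Xi2 a b x : is_derive x 1 (Xi2 a b) (Xi3 a b x).
Proof. by apply: deriv_add; do 3! apply: deriv_scale; exact: deriv_pow. Qed.

Lemma deriv_Xi3 a b x : is_derive x 1 (Xi3 a b) (Xi4 a b x).
Proof. by apply: deriv_add; do 4! apply: deriv_scale; exact: deriv_pow. Qed.

Hypotheses (p_gt2 : (2 < p)%N) (ps : (p < s)%N).

Let s_gt2 : (2 < s)%N. Proof. exact: ltn_trans ps. Qed.
Let natp_gt0 : 0 < p%:R :> R. Proof. by rewrite ltr0n; case: p p_gt2. Qed.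
Let natp1_gt0 : 0 < p.-1%:R :> R. Proof. by rewrite ltr0n; move: p_gt2; case: p => [|[]]. Qed.
Let natp2_gt0 : 0 < p.-2%:R :> R. Proof. by rewrite ltr0n; move: p_gt2; case: p => [|[|[]]]. Qed.
Let nats_gt0 : 0 < s%:R :> R. Proof. by rewrite ltr0n; case: s s_gt2. Qed.
Let nats1_gt0 : 0 < s.-1%:R :> R. Proof. by rewrite ltr0n; move: s_gt2; case: s => [|[]]. Qed.
Let nats2_gt0 : 0 < s.-2%:R :> R. Proof. by rewrite ltr0n; move: s_gt2; case: s => [|[|[]]]. Qed.

Section positive.
Variables (a b : R).
Hypotheses (a0 : 0 <= a) (b0 : 0 <= b) (ab0 : 0 < a + b).

Lemma mix_gt0 (u v : R) : 0 < u -> 0 < v -> 0 < a * u + b * v.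
Proof.
move=> u0 v0; move: a0; rewrite le_eqVlt => /orP[/eqP aE|a_gt0].
  by move: ab0; rewrite -aE add0r mul0r add0r => b_gt0; rewrite mulr_gt0.
by rewrite ltr_wpDr ?mulr_gt0// mulr_ge0// ltW.
Qed.

Lemma Xi_gt0 x : 0 < x -> 0 < Xi a b x.
Proof. by move=> x0; apply: mix_gt0; rewrite exprn_gt0. Qed.

Lemma Xi1_gt0 x : 0 < x -> 0 < Xi1 a b x.
Proof. by move=> x0; apply: mix_gt0; rewrite mulr_gt0// exprn_gt0. Qed.

Lemma Xi2_gt0 x : 0 < x -> 0 < Xi2 a b x.
Proof. by move=> x0; apply: mix_gt0; do 2! rewrite mulr_gt0//; rewrite exprn_gt0. Qed.

Lemma Xi3_gt0 x : 0 < x -> 0 < Xi3 a b x.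
Proof. by move=> x0; apply: mix_gt0; do 3! rewrite mulr_gt0//; rewrite exprn_gt0. Qed.

Lemma Xi1_ge0 x : 0 <= x -> 0 <= Xi1 a b x.
Proof. by move=> x0; rewrite addr_ge0// mulr_ge0// mulr_ge0// exprn_ge0. Qed.

Lemma Xi_0 : Xi a b 0 = 0.
Proof.
rewrite /Xi !expr0n; move: p_gt2 s_gt2; case: p => // p' _; case: s => // s' _.
by rewrite !mulr0 addr0.
Qed.

Lemma Xi1_0 : Xi1 a b 0 = 0.
Proof.
rewrite /Xi1 !expr0n; move: p_gt2 s_gt2; case: p => [|[]]// p' _; case: s => [|[]]// s' _.
by rewrite !mulr0 addr0.
Qed.

Lemma Xi2_0 : Xi2 a b 0 = 0.
Proof.
rewrite /Xi2 !expr0n; move: p_gt2 s_gt2.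
case: p => [|[|[]]]// p' _; case: s => [|[|[]]]// s' _.
by rewrite !mulr0 addr0.
Qed.

(** The pointwise minimiser of n |-> Xi2 x * n + 1 / n; on a full
    replica-symmetry-breaking interval it is the tail of the Parisi measure. *)
Definition hx x := (Num.sqrt (Xi2 a b x))^-1.
(** The derivative of - hx, that is, the density matching the tail hx. *)
Definition wx x := Xi3 a b x * hx x ^+ 3 / 2.

Lemma hx_gt0 x : 0 < x -> 0 < hx x.
Proof. by move=> /Xi2_gt0 h; rewrite invr_gt0 sqrtr_gt0. Qed.

Lemma wx_gt0 x : 0 < x -> 0 < wx x.
Proof. by move=> x0; rewrite divr_gt0// mulr_gt0 ?Xi3_gt0// exprn_gt0// hx_gt0. Qed.

Lemma hx2 x : 0 < x -> (hx x ^+ 2)^-1 = Xi2 a b x.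
Proof. by move=> x0; rewrite /hx exprVn invrK sqr_sqrtr// ltW// Xi2_gt0. Qed.

Lemma hx_Xi2 x : 0 < x -> Xi2 a b x * hx x ^+ 2 = 1.
Proof.
by move=> x0; rewrite -hx2// mulVf// expf_neq0// gt_eqF// hx_gt0.
Qed.

Lemma deriv_hx x : 0 < x -> is_derive x 1 hx (- wx x).
Proof.
move=> x0; have h2 := Xi2_gt0 x0.
have sq0 : Num.sqrt (Xi2 a b x) != 0 by rewrite gt_eqF// sqrtr_gt0.
apply: (deriv_eq (deriv_inv (deriv_sqrt (deriv_Xi2 a b x) h2) sq0)).
rewrite /wx /hx; congr (- _); field.
exact: sq0.
Qed.

Lemma deriv_wx x : 0 < x -> is_derive x 1 wx
  (hx x ^+ 5 / 4 * (2 * Xi2 a b x * Xi4 a b x - 3 * Xi3 a b x ^+ 2)).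
Proof.
move=> x0; have dh := deriv_hx x0.
have dw : is_derive x 1 wx ((Xi4 a b x * hx x ^+ 3 + Xi3 a b x * (3 * hx x ^+ 2 * (- wx x))) / 2).
  apply: (deriv_eq (deriv_mul (deriv_mul (deriv_Xi3 a b x) (deriv_exp 3 dh)) (deriv_cst 2^-1 x))).
  by rewrite /=; ring.
apply: (deriv_eq dw); rewrite /wx.
have e := hx_Xi2 x0.
transitivity ((Xi4 a b x * hx x ^+ 3 * (Xi2 a b x * hx x ^+ 2) +
   Xi3 a b x * (3 * hx x ^+ 2 * (- (Xi3 a b x * hx x ^+ 3 / 2)))) / 2).
  by rewrite e mulr1.
by field.
Qed.

End positive.
End Mixtures.

Section Inflection.
Context {R : realType}.
Variables (p s : nat).
Hypotheses (p_gt2 : (2 < p)%N) (ps : (p < s)%N).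
Implicit Types (a b x : R).

Let s_gt2 : (2 < s)%N. Proof. exact: ltn_trans ps. Qed.
Let p_gt1 : (1 < p)%N. Proof. exact: ltnW. Qed.
Let p_gt0 : (0 < p)%N. Proof. exact: ltnW. Qed.
Let s_gt1 : (1 < s)%N. Proof. exact: ltnW. Qed.
Let s_gt0 : (0 < s)%N. Proof. exact: ltnW. Qed.

Lemma natr_pred1 n : (0 < n)%N -> n.-1%:R = n%:R - 1 :> R.
Proof. by case: n => // n _; rewrite -natr1 addrK. Qed.

Lemma natr_pred2 n : (1 < n)%N -> n.-2%:R = n%:R - 2 :> R.
Proof. by case: n => [|[|n]]//= _; rewrite -[n.+2]addn2 natrD addrK. Qed.

Lemma natr_pred3 n : (2 < n)%N -> n.-2.-1%:R = n%:R - 3 :> R.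
Proof. by case: n => [|[|[|n]]]//= _; rewrite -[n.+3]addn3 natrD addrK. Qed.

(** 2 Xi2 Xi4 - 3 Xi3^2, whose sign is opposite to that of the second derivative of hx, equals,
    up to the factor x^2, minus this quadratic form in the two monomials of Xi2. *)
Definition inflection_form (P S Y Z : R) : R :=
  P * (P - 2) * Y ^+ 2
  - 2 * ((P - 2) * (P - 3) + (S - 2) * (S - 3) - 3 * (P - 2) * (S - 2)) * (Y * Z)
  + S * (S - 2) * Z ^+ 2.
Local Notation form := (inflection_form p%:R s%:R).

Lemma Xi3_x a b x : Xi3 p s a b x * x =
  (p%:R - 2) * (a * (p%:R * (p%:R - 1) * x ^+ p.-2)) +
  (s%:R - 2) * (b * (s%:R * (s%:R - 1) * x ^+ s.-2)).
Proof.
have e n : (2 < n)%N -> x ^+ n.-2 = x ^+ n.-2.-1 * x by case: n => [|[|[|n]]]// _; rewrite -exprSr.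
rewrite /Xi3 (e p)// (e s)// !natr_pred2 ?natr_pred1//.
by ring.
Qed.

Lemma Xi4_xx a b x : Xi4 p s a b x * x ^+ 2 =
  (p%:R - 2) * (p%:R - 3) * (a * (p%:R * (p%:R - 1) * x ^+ p.-2)) +
  (s%:R - 2) * (s%:R - 3) * (b * (s%:R * (s%:R - 1) * x ^+ s.-2)).
Proof.
have e n : (2 < n)%N -> n.-2.-1%:R * x ^+ n.-2.-2 * x ^+ 2 = (n%:R - 3) * x ^+ n.-2.
  move=> n2; rewrite -natr_pred3//; case: n n2 => [|[|[|[|n]]]]//= _; first by rewrite !mul0r.
  by rewrite -mulrA -exprD addn2.
transitivity (a * (p%:R * (p.-1%:R * (p.-2%:R * (p.-2.-1%:R * x ^+ p.-2.-2 * x ^+ 2)))) +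
   b * (s%:R * (s.-1%:R * (s.-2%:R * (s.-2.-1%:R * x ^+ s.-2.-2 * x ^+ 2))))).
  by rewrite /Xi4; ring.
rewrite (e p)// (e s)// !natr_pred2 ?natr_pred1//.
by ring.
Qed.

Lemma inflectionE a b x :
  (2 * Xi2 p s a b x * Xi4 p s a b x - 3 * Xi3 p s a b x ^+ 2) * x ^+ 2 =
  - form (a * (p%:R * (p%:R - 1) * x ^+ p.-2)) (b * (s%:R * (s%:R - 1) * x ^+ s.-2)).
Proof.
transitivity (2 * Xi2 p s a b x * (Xi4 p s a b x * x ^+ 2) - 3 * (Xi3 p s a b x * x) ^+ 2).
  by ring.
rewrite Xi4_xx Xi3_x /Xi2 !natr_pred1//.
by rewrite /inflection_form; ring.
Qed.

Section positive.
Variables (a b : R).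
Hypotheses (a0 : 0 <= a) (b0 : 0 <= b) (ab0 : 0 < a + b).
Local Notation h := (hx p s a b).
Local Notation w := (wx p s a b).
Definition form_at x :=
  form (a * (p%:R * (p%:R - 1) * x ^+ p.-2)) (b * (s%:R * (s%:R - 1) * x ^+ s.-2)).

Lemma deriv_wx_form x : 0 < x ->
  is_derive x 1 w (- (h x ^+ 5 / (4 * x ^+ 2)) * form_at x).
Proof.
move=> x0; apply: (deriv_eq (deriv_wx p_gt2 ps a0 b0 ab0 x0)).
rewrite mulNr -mulrN /form_at -inflectionE; field.
by rewrite gt_eqF.
Qed.

Let coef_gt0 x : 0 < x -> 0 < h x ^+ 5 / (4 * x ^+ 2).
Proof.
move=> x0; rewrite divr_gt0 ?exprn_gt0 ?(hx_gt0 p_gt2 ps)//.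
by rewrite mulr_gt0// exprn_gt0.
Qed.

Lemma wx_decreasing c d : 0 < c -> c < d ->
  (forall t, c < t < d -> 0 < form_at t) -> w d < w c.
Proof.
move=> c0 cd H; apply: (@derive_decreasing _ w (fun x => - (h x ^+ 5 / (4 * x ^+ 2)) * form_at x) c d c d) => //.
  by move=> x cx _; apply: deriv_wx_form; exact: lt_le_trans cx.
move=> t /[dup] /H ft /andP[ct _]; rewrite mulNr oppr_lt0 mulr_gt0//.
by apply: coef_gt0; exact: lt_trans ct.
Qed.

Lemma wx_increasing c d : 0 < c -> c < d ->
  (forall t, c < t < d -> form_at t < 0) -> w c < w d.
Proof.
move=> c0 cd H; apply: (@derive_increasing _ w (fun x => - (h x ^+ 5 / (4 * x ^+ 2)) * form_at x) c d c d) => //.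
  by move=> x cx _; apply: deriv_wx_form; exact: lt_le_trans cx.
move=> t /[dup] /H ft /andP[ct _]; rewrite mulNr oppr_gt0 nmulr_llt0//.
by apply: coef_gt0; exact: lt_trans ct.
Qed.

Lemma hx_convex (I : R -> Prop) : (forall x, I x -> 0 < x) ->
  (forall x z t, I x -> I z -> x < t < z -> 0 < form_at t) -> convex3 I h.
Proof.
move=> I0 H; apply: (derive_increasing_convex3 (u1 := fun x => - w x)).
  move=> x z Ix _ t xt _; apply: deriv_hx => //; exact: lt_le_trans (I0 _ Ix) xt.
move=> x y z Ix Iz xy yz c d xc cd dz; rewrite ltrN2; apply: wx_decreasing => //.
  exact: lt_le_trans (I0 _ Ix) xc.
move=> t /andP[ct td]; apply: (H x z) => //.
by rewrite (le_lt_trans xc ct) (lt_le_trans td dz).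
Qed.

Lemma hx_concave (I : R -> Prop) : (forall x, I x -> 0 < x) ->
  (forall x z t, I x -> I z -> x < t < z -> form_at t < 0) -> concave3 I h.
Proof.
move=> I0 H.
have : convex3 I (fun x => - h x).
  apply: (derive_increasing_convex3 (u1 := w)).
    move=> x z Ix _ t xt _; rewrite -[w t]opprK; apply: deriv_opp.
    by apply: deriv_hx => //; exact: lt_le_trans (I0 _ Ix) xt.
  move=> x y z Ix Iz xy yz c d xc cd dz; apply: wx_increasing => //.
    exact: lt_le_trans (I0 _ Ix) xc.
  move=> t /andP[ct td]; apply: (H x z) => //.
  by rewrite (le_lt_trans xc ct) (lt_le_trans td dz).
by move=> cv x y z Ix Iz xy yz; have := cv x y z Ix Iz xy yz; lra.
Qed.

End positive.

(** The weight for which the mixture is a rescaling of x^p + x^s seen on [0, x]. *)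
Definition lam x : R := x ^+ p / (x ^+ p + x ^+ s).

Lemma lam_den x : 0 < x -> 0 < x ^+ p + x ^+ s.
Proof. by move=> x0; rewrite addr_gt0// exprn_gt0. Qed.

Lemma lam_compl x : 0 < x -> 1 - lam x = x ^+ s / (x ^+ p + x ^+ s).
Proof. by move=> x0; rewrite /lam; field; rewrite gt_eqF// lam_den. Qed.

Lemma lam_itv x : 0 < x -> 0 < lam x < 1.
Proof.
move=> x0; rewrite divr_gt0 ?exprn_gt0 ?lam_den//=.
by rewrite -subr_gt0 lam_compl// divr_gt0 ?exprn_gt0 ?lam_den.
Qed.

Let pow_split x : x ^+ s = x ^+ p * x ^+ (s - p).
Proof. by rewrite -exprD subnKC// ltnW. Qed.

Lemma lamE x : 0 < x -> lam x = (1 + x ^+ (s - p))^-1.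
Proof.
move=> x0; rewrite /lam pow_split -{2}[x ^+ p]mulr1 -mulrDr.
have h1 : 0 < x ^+ p by rewrite exprn_gt0.
have h2 : 0 < 1 + x ^+ (s - p) by rewrite addr_gt0// exprn_gt0.
by field; rewrite !gt_eqF.
Qed.

Lemma lam_decreasing x y : 0 < x -> x < y -> lam y < lam x.
Proof.
move=> x0 xy; have y0 := lt_trans x0 xy.
rewrite !lamE// ltf_pV2 ?posrE ?addr_gt0 ?exprn_gt0// ltrD2l.
rewrite ltr_pXn2r ?nnegrE ?(ltW x0) ?(ltW y0)//.
by rewrite subn_gt0.
Qed.

Lemma lam_lt x y : 0 < x -> 0 < y -> (lam y < lam x) = (x < y).
Proof.
move=> x0 y0; case: (ltgtP x y) => [xy|yx|->]; last by rewrite ltxx.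
  exact: lam_decreasing.
by apply/negbTE; rewrite -leNgt ltW// lam_decreasing.
Qed.

Lemma lam_le x y : 0 < x -> 0 < y -> (lam y <= lam x) = (x <= y).
Proof. by move=> x0 y0; rewrite leNgt lam_lt// -leNgt. Qed.

Lemma lam_surj l : 0 < l < 1 -> exists2 x, 0 < x & lam x = l.
Proof.
move=> /andP[l0 l1]; pose t := (1 - l) / l.
have t0 : 0 < t by rewrite divr_gt0// subr_gt0.
exists (t `^ (s - p)%:R^-1); first exact: powR_gt0.
rewrite lamE ?powR_gt0// -powR_mulrn ?powR_ge0// -powRrM mulVf; last first.
  by rewrite pnatr_eq0 -lt0n subn_gt0.
rewrite powRr1 ?ltW// /t; field.
have -> : l + (1 - l) = 1 by ring.
by rewrite oner_neq0 gt_eqF.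
Qed.

(** In the coordinate lam, S is the inflection form: its roots are the inflection points of h. *)
Lemma Spoly_form x : 0 < x ->
  Spoly p s (lam x) = form_at 1 1 x * (x ^+ 4 / (x ^+ p + x ^+ s) ^+ 2).
Proof.
move=> x0.
have e n : (2 < n)%N -> x ^+ n = x ^+ n.-2 * x ^+ 2.
  by case: n => [|[|n]]// _; rewrite -exprD addn2.
rewrite /Spoly lam_compl// /lam /form_at /inflection_form (e p)// (e s)//.
field; rewrite -(e p)// -(e s)//.
by rewrite gt_eqF// lam_den.
Qed.

Lemma form_at_Spoly x : 0 < x -> (0 < form_at 1 1 x) = (0 < Spoly p s (lam x)) /\
  (form_at 1 1 x < 0) = (Spoly p s (lam x) < 0).
Proof.
move=> x0; rewrite Spoly_form//.
have h : 0 < x ^+ 4 / (x ^+ p + x ^+ s) ^+ 2.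
  by rewrite divr_gt0 ?exprn_gt0// lam_den.
by rewrite pmulr_lgt0// pmulr_llt0.
Qed.

End Inflection.

(** * The equation of an affine fit *)

Section Phi.
Context {R : realType}.
Implicit Types (z e : R).

(** If the line l fits [0, q] and z = m q / l(q), its two conditions at q force
    phi z = xi(q) / (q xi'(q)). *)
Definition phi z : R := ((1 + z) * ln (1 + z) - z) / z ^+ 2.

(** The same elementary bound gives both the monotonicity of phi and its limit at 0. *)
Lemma ln1D_gt z : 0 < z -> 2 * z / (2 + z) < ln (1 + z).
Proof.
move=> z0; pose f (x : R) := ln (1 + x) - 2 * x / (2 + x).
pose f1 (x : R) := (1 + x)^-1 - 4 / (2 + x) ^+ 2.
have df : derive_on f f1 0 z.
  move=> x x0 _; have h1 : 0 < 1 + x by lra.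
  have h2 : 2 + x != 0 by lra.
  have d1 : is_derive x 1 (fun y : R => 1 + y) 1.
    by apply: (deriv_eq (deriv_add (deriv_cst 1 x) (deriv_id x))); rewrite add0r.
  have d2 : is_derive x 1 (fun y : R => 2 + y) 1.
    by apply: (deriv_eq (deriv_add (deriv_cst 2 x) (deriv_id x))); rewrite add0r.
  apply: (deriv_eq (deriv_sub (deriv_ln d1 h1)
    (deriv_mul (deriv_scale 2 (deriv_id x)) (deriv_inv d2 h2)))).
  by rewrite /f1; field; rewrite h2 gt_eqF.
have f0 : f 0 = 0 by rewrite /f addr0 ln1 mulr0 mul0r subr0.
suff : 0 < f z by rewrite /f subr_gt0.
rewrite -f0; apply: (@derive_increasing _ f f1 0 z 0 z df) => // t /andP[t0 _].
have -> : f1 t = t ^+ 2 / ((1 + t) * (2 + t) ^+ 2).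
  by rewrite /f1; field; rewrite !gt_eqF//; lra.
by rewrite divr_gt0 ?exprn_gt0 ?mulr_gt0 ?exprn_gt0//; lra.
Qed.

Lemma deriv_phi z : 0 < z ->
  is_derive z 1 phi ((2 * z - (2 + z) * ln (1 + z)) / z ^+ 3).
Proof.
move=> z0; have h1 : 0 < 1 + z by lra.
have d1 : is_derive z 1 (fun y : R => 1 + y) 1.
  by apply: (deriv_eq (deriv_add (deriv_cst 1 z) (deriv_id z))); rewrite add0r.
have zn : z ^+ 2 != 0 by rewrite expf_neq0// gt_eqF.
rewrite /phi; apply: (deriv_eq (deriv_mul (deriv_sub (deriv_mul d1 (deriv_ln d1 h1)) (deriv_id z))
  (deriv_inv (deriv_exp 2 (deriv_id z)) zn))).
by field; rewrite !gt_eqF.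
Qed.

Lemma phi_decreasing x y : 0 < x -> x < y -> phi y < phi x.
Proof.
move=> x0 xy; apply: (@derive_decreasing _ phi
  (fun z => (2 * z - (2 + z) * ln (1 + z)) / z ^+ 3) x y x y) => //.
  by move=> z xz _; apply: deriv_phi; exact: lt_le_trans xz.
move=> z /andP[xz _]; have z0 := lt_trans x0 xz.
rewrite ltr_pdivrMr ?exprn_gt0// mul0r subr_lt0.
have := ln1D_gt z0; rewrite ltr_pdivrMr; last lra.
by rewrite [X in _ < X]mulrC.
Qed.

Lemma phi_lt x y : 0 < x -> 0 < y -> (phi y < phi x) = (x < y).
Proof.
move=> x0 y0; case: (ltgtP x y) => [xy|yx|->]; last by rewrite ltxx.
  exact: phi_decreasing.
by apply/negbTE; rewrite -leNgt ltW// phi_decreasing.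
Qed.

Lemma phi_inj x y : 0 < x -> 0 < y -> phi x = phi y -> x = y.
Proof.
move=> x0 y0 e; case: (ltgtP x y) => // h; have := phi_decreasing _ h.
  by rewrite e ltxx => /(_ x0).
by rewrite e ltxx => /(_ y0).
Qed.

Lemma phi_gt z : 0 < z -> (2 + z)^-1 < phi z.
Proof.
move=> z0; have := ln1D_gt z0; rewrite /phi => h.
rewrite ltr_pdivlMr ?exprn_gt0// ltrBrDr.
have -> : (2 + z)^-1 * z ^+ 2 + z = (1 + z) * (2 * z / (2 + z)).
  by field; rewrite gt_eqF//; lra.
by rewrite ltr_pM2l//; lra.
Qed.

(** Bounding the logarithm by a square root shows that phi tends to 0 at infinity. *)
Lemma phi_lt_root r : 1 < r -> phi (r ^+ 2 - 1) < 2 / r.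
Proof.
move=> r1; have r0 : 0 < r by lra.
have -> : 2 / r = (2 * r ^+ 2 * (r ^+ 2 - 1) ^+ 2 / r ^+ 3) / (r ^+ 2 - 1) ^+ 2.
  by field; rewrite !gt_eqF//; nra.
rewrite /phi ltr_pM2r ?invr_gt0 ?exprn_gt0//; last by nra.
have -> : 1 + (r ^+ 2 - 1) = r ^+ 2 by ring.
rewrite expr2 lnM ?posrE//.
have l1 : ln r <= r - 1.
  have -> : ln r = ln (1 + (r - 1)) by congr ln; ring.
  by apply: le_ln1Dx; lra.
have -> : 2 * (r * r) * (r * r - 1) ^+ 2 / r ^+ 3 = 2 * (r ^+ 2 - 1) ^+ 2 / r.
  by field; rewrite gt_eqF.
rewrite ltr_pdivlMr//.
apply: (@le_lt_trans _ _ ((r * r * (2 * (r - 1)) - (r * r - 1)) * r)).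
  by rewrite ler_pM2r// lerD2r ler_pM2l; nra.
have -> : (r * r * (2 * (r - 1)) - (r * r - 1)) * r = (r - 1) ^+ 2 * ((2 * r + 1) * r) by ring.
have -> : 2 * (r ^+ 2 - 1) ^+ 2 = (r - 1) ^+ 2 * (2 * (r + 1) ^+ 2) by ring.
by rewrite ltr_pM2l ?exprn_gt0; nra.
Qed.

Lemma phi_surj e : 0 < e < 2^-1 -> exists2 z, 0 < z & phi z = e.
Proof.
move=> /andP[e0 e1].
pose x := e^-1 - 2; have x0 : 0 < x.
  rewrite subr_gt0 -[ltLHS]invrK ltf_pV2// posrE; lra.
have hx : e < phi x.
  have := phi_gt x0; rewrite /x; have -> : 2 + (e^-1 - 2) = e^-1 by ring.
  by rewrite invrK.
pose r := 2 / e; have r1 : 1 < r by rewrite /r ltr_pdivlMr//; lra.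
pose y := r ^+ 2 - 1.
have y0 : 0 < y by rewrite /y; nra.
have hy : phi y < e.
  have := phi_lt_root r1; rewrite -/y /r; have -> : 2 / (2 / e) = e by field; rewrite gt_eqF.
  by [].
have xy : x < y by rewrite -phi_lt// (lt_trans hy).
have cphi : {within `[x, y], continuous phi}.
  apply: derivable_within_continuous => z; rewrite in_itv/= => /andP[xz _].
  by case: (deriv_phi (lt_le_trans x0 xz)).
have [|z] := IVT (ltW xy) cphi (v := e).
  by rewrite ge_min (ltW hy) orbT le_max (ltW hx).
rewrite in_itv/= => /andP[xz _] <-; exists z => //.
exact: lt_le_trans xz.
Qed.

Definition phi_inv e : R := xget 0 [set z | 0 < z /\ phi z = e].

Lemma phi_invP e : 0 < e < 2^-1 -> 0 < phi_inv e /\ phi (phi_inv e) = e.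
Proof.
move=> /phi_surj[z z0 ze]; rewrite /phi_inv.
by case: xgetP => [x -> []|/(_ z)]//; case.
Qed.

Lemma phi_inv_continuous e : 0 < e < 2^-1 -> {for e, continuous phi_inv}.
Proof.
move=> he; have [z0 ze] := phi_invP he; set z := phi_inv e in z0 ze *.
apply/cvgrPdist_lt => eps eps0; rewrite -/z.
pose d := Num.min eps (z / 2).
have d0 : 0 < d by rewrite lt_min eps0 divr_gt0.
have dz : d <= z / 2 by rewrite ge_min lexx orbT.
have de : d <= eps by rewrite ge_min lexx.
have lo : phi (z + d) < e by rewrite -ze phi_lt//; lra.
have hi : e < phi (z - d) by rewrite -{1}ze phi_lt//; lra.
near=> t.
have t1 : phi (z + d) < t by near: t; exact: lt_nbhsr.
have t2 : t < phi (z - d) by near: t; exact: lt_nbhsl.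
have t01 : 0 < t < 2^-1.
  apply/andP; split.
    by near: t; apply: lt_nbhsr; case/andP: he.
  by near: t; apply: lt_nbhsl; case/andP: he.
have [w0 we] := phi_invP t01.
rewrite (lt_le_trans _ de)// ltr_norml; apply/andP; split.
  have : phi_inv t < z + d by rewrite -phi_lt ?we//; lra.
  by lra.
have : z - d < phi_inv t by rewrite -phi_lt ?we//; lra.
by lra.
Unshelve. all: by end_near. Qed.

End Phi.

(** * Affine pieces and their defects *)

Section Lines.
Context {R : realType}.
Variables (p s : nat).
Hypotheses (p_gt2 : (2 < p)%N) (ps : (p < s)%N).
Implicit Types (q v m x : R).

(** [Pf v m] is the double primitive, with double zero at 0, of 1 / l^2 for the
    line l y = v - m * y. *)
Definition Pf v m y : R := - (ln (1 - m * y / v) / m ^+ 2 + y / (m * v)).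

Lemma deriv_Pf v m y : 0 < v -> 0 < m -> 0 < v - m * y ->
  is_derive y 1 (Pf v m) (y / (v * (v - m * y))).
Proof.
move=> v0 m0 l0.
have h1 : 0 < 1 - m * y / v.
  by have -> : 1 - m * y / v = (v - m * y) / v; [field; rewrite gt_eqF|rewrite divr_gt0].
have d1 : is_derive y 1 (fun t : R => 1 - m * t / v) (- (m / v)).
  apply: (deriv_eq (deriv_sub (deriv_cst 1 y) (deriv_mul (deriv_scale m (deriv_id y)) (deriv_cst v^-1 y)))).
  by ring.
rewrite /Pf; apply: (deriv_eq (deriv_opp (deriv_add (deriv_mul (deriv_ln d1 h1) (deriv_cst (m ^+ 2)^-1 y))
  (deriv_mul (deriv_id y) (deriv_cst (m * v)^-1 y))))).
by field; rewrite !gt_eqF.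
Qed.

Lemma deriv_Pf1 v m y : 0 < v -> 0 < m -> 0 < v - m * y ->
  is_derive y 1 (fun y => y / (v * (v - m * y))) ((v - m * y) ^+ 2)^-1.
Proof.
move=> v0 m0 l0.
have h1 : v * (v - m * y) != 0 by rewrite mulf_neq0 ?gt_eqF.
have d1 : is_derive y 1 (fun t : R => v * (v - m * t)) (- (v * m)).
  apply: (deriv_eq (deriv_scale v (deriv_sub (deriv_cst v y) (deriv_scale m (deriv_id y))))).
  by ring.
apply: (deriv_eq (deriv_mul (deriv_id y) (deriv_inv d1 h1))).
by field; rewrite !gt_eqF.
Qed.

Section coefs.
Variables (a b : R).
Hypotheses (a0 : 0 <= a) (b0 : 0 <= b) (ab0 : 0 < a + b).
Local Notation X0 := (Xi p s a b).
Local Notation X1 := (Xi1 p s a b).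
Local Notation X2 := (Xi2 p s a b).
Local Notation h := (hx p s a b).

(** The defect of the line with value v and slope - m at q: the difference between xi and the
    double primitive of 1 / l^2 that has the value and slope of xi at q. *)
Definition Fl q v m x := X0 x - X0 q - X1 q * (x - q) - Pf v m (x - q).
Definition Fl1 q v m x := X1 x - X1 q - (x - q) / (v * (v - m * (x - q))).
Definition Fl2 q v m x := X2 x - ((v - m * (x - q)) ^+ 2)^-1.

Lemma Fl_q q v m : Fl q v m q = 0.
Proof. by rewrite /Fl /Pf !subrr !mulr0 !mul0r !subr0 ln1 mul0r; ring. Qed.

Lemma Fl1_q q v m : Fl1 q v m q = 0.
Proof. by rewrite /Fl1 !subrr mul0r subr0. Qed.

Lemma Fl_C2 q v m c d : 0 < v -> 0 < m -> 0 < v - m * (d - q) ->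
  C2_on (Fl q v m) (Fl1 q v m) (Fl2 q v m) c d.
Proof.
move=> v0 m0 ld.
have lx x : x <= d -> 0 < v - m * (x - q).
  by move=> xd; apply: (lt_le_trans ld); rewrite lerD2l lerN2 ler_pM2l// lerD2r.
have dx x : is_derive x 1 (fun y : R => y - q) 1.
  by apply: (deriv_eq (deriv_sub (deriv_id x) (deriv_cst q x))); rewrite subr0.
split => x cx xd.
  apply: (deriv_eq (deriv_sub (deriv_sub (deriv_sub (deriv_Xi p s a b x) (deriv_cst (X0 q) x))
    (deriv_scale (X1 q) (dx x))) (deriv_comp (dx x) (deriv_Pf v0 m0 (lx x xd))))).
  by rewrite /Fl1; ring.
apply: (deriv_eq (deriv_sub (deriv_sub (deriv_Xi1 p s a b x) (deriv_cst (X1 q) x))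
  (deriv_comp (dx x) (deriv_Pf1 v0 m0 (lx x xd))))).
by rewrite /Fl2; ring.
Qed.

(** The defect is concave where the line runs below h and convex where it runs above. *)
Lemma Fl2_sign q v m x : 0 < x -> 0 < v - m * (x - q) ->
  (Fl2 q v m x < 0) = (0 < h x - (v - m * (x - q))) /\
  (0 < Fl2 q v m x) = (h x - (v - m * (x - q)) < 0).
Proof.
move=> x0 l0; have hx0 := hx_gt0 p_gt2 ps a0 b0 ab0 x0.
rewrite /Fl2 -(hx2 p_gt2 ps a0 b0 ab0 x0) subr_lt0 subr_gt0 subr_gt0 subr_lt0.
split; rewrite ltf_pV2 ?posrE ?exprn_gt0// ltr_pXn2r ?nnegrE ?ltW//.
Qed.

(** At a double zero the two primitives have the same value and slope, so that the point
    can serve as a new origin of the line. *)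
Lemma Fl_rebase a' v m q x : 0 < v -> 0 < m -> 0 < v - m * (q - a') ->
  0 < v - m * (x - a') ->
  Fl a' v m q = 0 -> Fl1 a' v m q = 0 ->
  Fl q (v - m * (q - a')) m x = Fl a' v m x /\
  Fl1 q (v - m * (q - a')) m x = Fl1 a' v m x.
Proof.
move=> v0 m0 lq lx; rewrite /Fl /Fl1; set vq := v - m * (q - a') in lq *.
have -> : vq - m * (x - q) = v - m * (x - a') by rewrite /vq; ring.
set vx := v - m * (x - a') in lx *.
move=> F0 F1.
have e1 : X1 q = X1 a' + (q - a') / (v * vq) by lra.
split; last first.
  rewrite e1; have -> : x - q = (x - a') - (q - a') by ring.
  have -> : q - a' = (v - vq) / m by rewrite /vq; field; rewrite gt_eqF.
  have -> : x - a' = (v - vx) / m by rewrite /vx; field; rewrite gt_eqF.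
  by field; rewrite !gt_eqF.
have e0 : X0 q = X0 a' + X1 a' * (q - a') + Pf v m (q - a') by lra.
suff : Pf v m (x - a') = Pf v m (q - a') + (q - a') / (v * vq) * (x - q) + Pf vq m (x - q).
  by rewrite e1 e0 => ->; ring.
rewrite /Pf.
have -> : 1 - m * (x - a') / v = vx / v by rewrite /vx; field; rewrite gt_eqF.
have -> : 1 - m * (q - a') / v = vq / v by rewrite /vq; field; rewrite gt_eqF.
have -> : 1 - m * (x - q) / vq = vx / vq by rewrite /vx /vq; field; rewrite gt_eqF.
have -> : vx / v = (vq / v) * (vx / vq) by field; rewrite !gt_eqF.
rewrite lnM ?posrE ?divr_gt0//.
have -> : x - q = (vq - vx) / m by rewrite /vq /vx; field; rewrite gt_eqF.
have -> : q - a' = (v - vq) / m by rewrite /vq; field; rewrite gt_eqF.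
have -> : x - a' = (v - vx) / m by rewrite /vx; field; rewrite gt_eqF.
by field; rewrite !gt_eqF.
Qed.

(** The line v - m x solves the stationarity equations on an affine piece starting at 0: the
    defect has double zeros at both ends. *)
Definition left_fit q v m :=
  [/\ 0 < m, 0 < v - m * q, Fl 0 v m q = 0 & Fl1 0 v m q = 0].

Definition ratio0 q := X0 q / (q * X1 q).
(** For the fitted line l, zfit q is m q / l(q) and dfit q is l(q). *)
Definition zfit q := phi_inv (ratio0 q).
Definition dfit q := Num.sqrt (q / (X1 q * (1 + zfit q))).
Definition vfit q := dfit q * (1 + zfit q).
Definition mfit q := zfit q * dfit q / q.

Lemma ratio0_itv q : 0 < q -> 0 < ratio0 q < 2^-1.
Proof.
move=> q0; have h0 := Xi_gt0 p s a0 b0 ab0 q0.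
have h1 := Xi1_gt0 p_gt2 ps a0 b0 ab0 q0.
rewrite divr_gt0 ?mulr_gt0//= ltr_pdivrMr ?mulr_gt0//.
have e n : (0 < n)%N -> q * q ^+ n.-1 = q ^+ n by case: n => // n _; rewrite -exprS.
have s0 : (0 < s)%N by case: s ps.
have -> : 2^-1 * (q * X1 q) = a * (p%:R / 2 * (q * q ^+ p.-1)) + b * (s%:R / 2 * (q * q ^+ s.-1)).
  by rewrite /Xi1; ring.
rewrite !e//; last by case: p p_gt2.
rewrite /Xi -subr_gt0.
have -> : a * (p%:R / 2 * q ^+ p) + b * (s%:R / 2 * q ^+ s) - (a * q ^+ p + b * q ^+ s) =
  a * ((p%:R / 2 - 1) * q ^+ p) + b * ((s%:R / 2 - 1) * q ^+ s) by ring.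
apply: mix_gt0 => //; rewrite mulr_gt0 ?exprn_gt0// subr_gt0 ltr_pdivlMr// mul1r ltr_nat//.
exact: ltn_trans ps.
Qed.

Lemma zfitP q : 0 < q -> 0 < zfit q /\ phi (zfit q) = ratio0 q.
Proof. by move=> /ratio0_itv /phi_invP. Qed.

Lemma dfit_gt0 q : 0 < q -> 0 < dfit q.
Proof.
move=> q0; have [z0 _] := zfitP q0; rewrite sqrtr_gt0 divr_gt0// mulr_gt0//.
  exact: Xi1_gt0.
by rewrite addr_gt0.
Qed.

Lemma dfit2 q : 0 < q -> dfit q ^+ 2 * (X1 q * (1 + zfit q)) = q.
Proof.
move=> q0; have [z0 _] := zfitP q0; have h1 := Xi1_gt0 p_gt2 ps a0 b0 ab0 q0.
have h : 0 < X1 q * (1 + zfit q) by rewrite mulr_gt0// addr_gt0.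
by rewrite sqr_sqrtr ?divr_ge0 ?ltW// divfK// gt_eqF.
Qed.

Lemma vmfit q : 0 < q -> vfit q - mfit q * q = dfit q.
Proof. by move=> q0; rewrite /vfit /mfit; field; rewrite gt_eqF. Qed.

Lemma left_fit_exists q : 0 < q -> left_fit q (vfit q) (mfit q).
Proof.
move=> q0; have [z0 zE] := zfitP q0; have d0 := dfit_gt0 q0; have d2 := dfit2 q0.
have h1 := Xi1_gt0 p_gt2 ps a0 b0 ab0 q0.
have m0 : 0 < mfit q by rewrite divr_gt0// mulr_gt0.
have z1 : 0 < 1 + zfit q by rewrite addr_gt0.
have v0 : 0 < vfit q by rewrite mulr_gt0.
have d2' : dfit q ^+ 2 = q / (X1 q * (1 + zfit q)).
  by apply: (canRL (mulfK _)) => //; rewrite gt_eqF// mulr_gt0.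
split => //; first by rewrite vmfit.
  rewrite /Fl (Xi_0 p_gt2 ps) (Xi1_0 p_gt2 ps) !subr0 mul0r subr0 /Pf.
  have -> : 1 - mfit q * q / vfit q = (1 + zfit q)^-1.
    by rewrite /mfit /vfit; field; rewrite !gt_eqF.
  rewrite lnV ?posrE//.
  have -> : mfit q ^+ 2 = zfit q ^+ 2 * dfit q ^+ 2 / q ^+ 2 by rewrite /mfit; field; rewrite gt_eqF.
  have -> : mfit q * vfit q = zfit q * dfit q ^+ 2 * (1 + zfit q) / q.
    by rewrite /mfit /vfit; field; rewrite gt_eqF.
  have -> : X0 q = phi (zfit q) * (q * X1 q).
    by rewrite zE /ratio0; field; rewrite !gt_eqF.
  by rewrite d2' /phi; field; rewrite !gt_eqF.
rewrite /Fl1 (Xi1_0 p_gt2 ps) !subr0 vmfit// /vfit.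
have -> : dfit q * (1 + zfit q) * dfit q = dfit q ^+ 2 * (1 + zfit q) by ring.
by rewrite d2'; field; rewrite !gt_eqF.
Qed.

(** The two conditions at q determine first z = m q / l(q), by injectivity of phi, and then l(q). *)
Lemma left_fit_unique q v m : 0 < q -> left_fit q v m -> v = vfit q /\ m = mfit q.
Proof.
move=> q0 [m0 d0 F0 F1]; pose d := v - m * q; pose z := m * q / d.
have z0 : 0 < z by rewrite divr_gt0// mulr_gt0.
have h1 := Xi1_gt0 p_gt2 ps a0 b0 ab0 q0.
have v0 : 0 < v by apply: (lt_trans d0); rewrite gtrBl mulr_gt0.
have vE : v = d * (1 + z) by rewrite /z /d; field; rewrite gt_eqF.
have mE : m = z * d / q by rewrite /z /d; field; rewrite !gt_eqF.
have d2 : d ^+ 2 * (X1 q * (1 + z)) = q.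
  move: F1; rewrite /Fl1 (Xi1_0 p_gt2 ps) !subr0 -/d => /eqP; rewrite subr_eq0 => /eqP ->.
  by rewrite vE; field; rewrite !gt_eqF// addr_gt0.
have z1 : 0 < 1 + z by rewrite addr_gt0.
have zE : z = zfit q.
  have [zf0 zfE] := zfitP q0; apply: phi_inj => //; rewrite zfE.
  move: F0; rewrite /Fl (Xi_0 p_gt2 ps) (Xi1_0 p_gt2 ps) !subr0 mul0r subr0 /Pf.
  have -> : 1 - m * q / v = (1 + z)^-1.
    by rewrite mE vE; field; rewrite !gt_eqF.
  rewrite lnV ?posrE//.
  have -> : m ^+ 2 = z ^+ 2 * d ^+ 2 / q ^+ 2 by rewrite mE; field; rewrite gt_eqF.
  have -> : m * v = z * d ^+ 2 * (1 + z) / q.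
    by rewrite {1}mE {1}vE; field; rewrite gt_eqF.
  have d2' : d ^+ 2 = q / (X1 q * (1 + z)).
    by apply: (canRL (mulfK _)) => //; rewrite gt_eqF// mulr_gt0.
  move=> /eqP; rewrite subr_eq0 => /eqP X0E; rewrite /ratio0 X0E.
  by rewrite d2' /phi; field; rewrite !gt_eqF.
have dE : d = dfit q.
  apply/eqP; rewrite -(@eqrXn2 _ 2)// ?ltW ?dfit_gt0//; apply/eqP.
  have hz : 0 < X1 q * (1 + z) by rewrite mulr_gt0.
  by apply: (mulIf (lt0r_neq0 hz)); rewrite d2 zE dfit2.
by rewrite vE mE zE dE.
Qed.

End coefs.
End Lines.

Section Continuity.
Context {R : realType} {T : topologicalType}.
Variables (p s : nat).
Hypotheses (p_gt2 : (2 < p)%N) (ps : (p < s)%N).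
Implicit Types (f g : T -> R).
Variable t : T.

Lemma continuous_pow f n : {for t, continuous f} -> {for t, continuous (fun t => f t ^+ n)}.
Proof. by move=> cf; apply: (@continuous_comp _ _ _ f (fun x => x ^+ n)) => //; exact: exprn_continuous. Qed.

Lemma continuous_inv f : {for t, continuous f} -> 0 < f t -> {for t, continuous (fun t => (f t)^-1)}.
Proof. by move=> cf f0; apply: continuousV => //; rewrite gt_eqF. Qed.

Lemma continuous_const (c : R) : {for t, continuous (fun _ : T => c)}.
Proof. exact: cst_continuous. Qed.

Variables (a b : T -> R).
Hypotheses (ca : {for t, continuous a}) (cb : {for t, continuous b}).

Let term f (c k : R) n : {for t, continuous f} ->
  {for t, continuous (fun t => c * (k * f t ^+ n))}.
Proof.
move=> cf; apply: continuousM; first exact: continuous_const.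
apply: continuousM; first exact: continuous_const.
exact: continuous_pow.
Qed.

Lemma Xi_continuous f : {for t, continuous f} ->
  {for t, continuous (fun t => Xi p s (a t) (b t) (f t))}.
Proof.
by move=> cf; apply: continuousD; apply: continuousM => //; exact: continuous_pow.
Qed.

Lemma Xi1_continuous f : {for t, continuous f} ->
  {for t, continuous (fun t => Xi1 p s (a t) (b t) (f t))}.
Proof.
move=> cf; apply: continuousD; apply: continuousM => //; apply: continuousM;
  by [exact: continuous_const|exact: continuous_pow].
Qed.

Lemma Xi2_continuous f : {for t, continuous f} ->
  {for t, continuous (fun t => Xi2 p s (a t) (b t) (f t))}.
Proof.
move=> cf; apply: continuousD; apply: continuousM => //; exact: term.
Qed.

Section Defect.
Variables (q v m X : T -> R).
Hypotheses (cq : {for t, continuous q}) (cv : {for t, continuous v})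
  (cm : {for t, continuous m}) (cX : {for t, continuous X}).
Hypotheses (v0 : 0 < v t) (m0 : 0 < m t) (l0 : 0 < v t - m t * (X t - q t)).

Let cXq : {for t, continuous (fun t => X t - q t)}. Proof. exact: continuousB. Qed.

Let cl : {for t, continuous (fun t => v t - m t * (X t - q t))}.
Proof. by apply: continuousB => //; exact: continuousM. Qed.

Lemma Fl_continuous :
  {for t, continuous (fun t => Fl p s (a t) (b t) (q t) (v t) (m t) (X t))}.
Proof.
have arg0 : 0 < 1 - m t * (X t - q t) / v t.
  have -> : 1 - m t * (X t - q t) / v t = (v t - m t * (X t - q t)) / v t.
    by field; rewrite gt_eqF.
  by rewrite divr_gt0.
have carg : {for t, continuous (fun t => 1 - m t * (X t - q t) / v t)}.
  apply: continuousB; first exact: continuous_const.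
  by apply: continuousM; [exact: continuousM|exact: continuous_inv].
have cln : {for t, continuous (fun t => ln (1 - m t * (X t - q t) / v t))}.
  apply: (@continuous_comp _ _ _ (fun t => 1 - m t * (X t - q t) / v t) (@ln R)) => //; exact: (deriv_continuous (is_derive1_ln arg0)).
rewrite /Fl /Pf; apply: continuousB.
  apply: continuousB; first by apply: continuousB; exact: Xi_continuous.
  by apply: continuousM => //; exact: Xi1_continuous.
apply: continuousN; apply: continuousD.
  by apply: continuousM => //; apply: continuous_inv; [exact: continuous_pow|rewrite exprn_gt0].
apply: continuousM => //; apply: continuous_inv; first exact: continuousM.
by rewrite mulr_gt0.
Qed.

Lemma Fl2_continuous :
  {for t, continuous (fun t => Fl2 p s (a t) (b t) (q t) (v t) (m t) (X t))}.
Proof.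
rewrite /Fl2; apply: continuousB; first exact: Xi2_continuous.
by apply: continuous_inv; [exact: continuous_pow|rewrite exprn_gt0].
Qed.

End Defect.

Section Fit.
Variable q : T -> R.
Hypotheses (cq : {for t, continuous q}) (q0 : 0 < q t).
Hypotheses (a0 : 0 <= a t) (b0 : 0 <= b t) (ab0 : 0 < a t + b t).

Let d1 : 0 < Xi1 p s (a t) (b t) (q t). Proof. exact: Xi1_gt0. Qed.
Let z0 : 0 < zfit p s (a t) (b t) (q t).
Proof. by have [] := zfitP p_gt2 ps a0 b0 ab0 q0. Qed.

Lemma zfit_continuous : {for t, continuous (fun t => zfit p s (a t) (b t) (q t))}.
Proof.
have cr : {for t, continuous (fun t => ratio0 p s (a t) (b t) (q t))}.
  apply: continuousM; first exact: Xi_continuous.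
  apply: continuous_inv; last by rewrite mulr_gt0.
  by apply: continuousM => //; exact: Xi1_continuous.
apply: (@continuous_comp _ _ _ (fun t => ratio0 p s (a t) (b t) (q t)) phi_inv) => //.
by apply: phi_inv_continuous; exact: ratio0_itv.
Qed.

Lemma dfit_continuous : {for t, continuous (fun t => dfit p s (a t) (b t) (q t))}.
Proof.
have cz : {for t, continuous (fun t => q t / (Xi1 p s (a t) (b t) (q t) * (1 + zfit p s (a t) (b t) (q t))))}.
  apply: continuousM => //; apply: continuous_inv; last by rewrite mulr_gt0// addr_gt0.
  apply: continuousM; first exact: Xi1_continuous.
  by apply: continuousD; [exact: continuous_const|exact: zfit_continuous].
apply: (@continuous_comp _ _ _ (fun t => q t / (Xi1 p s (a t) (b t) (q t) * (1 + zfit p s (a t) (b t) (q t)))) Num.sqrt) => //; exact: sqrt_continuous.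
Qed.

Lemma vfit_continuous : {for t, continuous (fun t => vfit p s (a t) (b t) (q t))}.
Proof.
apply: continuousM; first exact: dfit_continuous.
by apply: continuousD; [exact: continuous_const|exact: zfit_continuous].
Qed.

Lemma mfit_continuous : {for t, continuous (fun t => mfit p s (a t) (b t) (q t))}.
Proof.
apply: continuousM; last exact: continuous_inv.
by apply: continuousM; [exact: zfit_continuous|exact: dfit_continuous].
Qed.

End Fit.
End Continuity.

(** * Comparison of two affine fits *)

Section MoreCalculus.
Context {R : realType}.
Implicit Types (f K : R -> R) (c d x y : R).

(** The first zero is the supremum of the points up to which f stays nonnegative. *)
Lemma first_exit f c d : c <= d ->
  (forall x, c <= x -> x <= d -> {for x, continuous f}) -> 0 <= f c -> f d < 0 ->
  exists2 b, c <= b < d & f b = 0 /\ (forall x, c <= x -> x <= b -> 0 <= f x).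
Proof.
move=> cd cf fc fd.
pose S := [set x | c <= x <= d /\ forall y, c <= y -> y <= x -> 0 <= f y].
have Sc : S c.
  split; first by rewrite lexx.
  by move=> y cy yc; rewrite (@le_anti _ R y c) ?yc.
have Sle x : S x -> x <= d by move=> [/andP[]].
have hs : has_sup S by split; [exists c|exists d].
pose b := sup S.
have cb : c <= b by apply: ub_le_sup => //; case: hs.
have bd : b <= d by apply: ge_sup => //; exists c.
have low x : c <= x -> x < b -> 0 <= f x.
  move=> cx xb; have [y Sy xy] := sup_gt (ex_intro _ c Sc : S !=set0) xb.
  by case: Sy => _; apply => //; exact: ltW.
have fb : 0 <= f b.
  rewrite leNgt; apply/negP => fb0.
  have [e e0 he] : exists2 e, 0 < e & forall x, `|b - x| < e -> f x < 0.
    have := cf b cb bd; move=> /cvgrPdist_lt /(_ (- f b)).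
    rewrite oppr_gt0 => /(_ fb0) /nbhs_ballP[e /= e0 he]; exists e => // x hx.
    have := he x hx; rewrite /= ltr_norml => /andP[h1 _]; move: h1; lra.
  have cb' : c < b.
    rewrite lt_neqAle cb andbT; apply/eqP => cE; move: fb0; rewrite -cE.
    by rewrite ltNge fc.
  pose x := Num.max c (b - e / 2).
  have xb : x < b by rewrite gt_max cb'/=; lra.
  have : 0 <= f x by apply: low => //; rewrite le_max lexx.
  apply/negP; rewrite -ltNge he// gtr0_norm ?subr_gt0//.
  have : b - e / 2 <= x by rewrite le_max lexx orbT.
  lra.
have lowb x : c <= x -> x <= b -> 0 <= f x.
  by move=> cx; rewrite le_eqVlt => /orP[/eqP ->//|]; exact: low.
have bd' : b < d.
  by rewrite lt_neqAle bd andbT; apply/eqP => bE; move: fb; rewrite bE leNgt fd.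
exists b; first by rewrite cb.
split => //; apply/eqP; rewrite eq_le fb andbT leNgt; apply/negP => fb0.
have [e e0 he] : exists2 e, 0 < e & forall x, `|b - x| < e -> 0 < f x.
  have := cf b cb bd; move=> /cvgrPdist_lt /(_ (f b) fb0).
  move=> /nbhs_ballP[e /= e0 he]; exists e => // x hx.
  have := he x hx; rewrite /= ltr_norml => /andP[_ h1]; move: h1; lra.
pose x := Num.min d (b + e / 2).
have bx : b < x by rewrite lt_min bd'/=; lra.
have xe : x <= b + e / 2 by rewrite ge_min lexx orbT.
have : x <= b; last by rewrite leNgt bx.
apply: ub_le_sup; first by case: hs.
split; first by rewrite (le_trans cb (ltW bx)) ge_min lexx.
move=> y cy yx; have [yb|yb] := leP y b; first exact: lowb.
by apply/ltW/he; rewrite distrC gtr0_norm ?subr_gt0//; lra.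
Qed.

(** In the applications K is the difference of the defects of two lines issued from 0, and
    d0 + d1 x the difference of the lines, which carries the sign of K2. *)
Section affine_sign.
Variables (K K1 K2 : R -> R) (y d0 d1 : R).
Hypotheses (y0 : 0 < y) (KC2 : C2_on K K1 K2 0 y) (K_0 : K 0 = 0) (K1_0 : K1 0 = 0).
Hypotheses (pos : forall x, 0 < x < y -> 0 < d0 + d1 * x -> 0 < K2 x)
  (neg : forall x, 0 < x < y -> d0 + d1 * x < 0 -> K2 x < 0).

Let dK : derive_on K K1 0 y. Proof. by case: KC2. Qed.
Let dK1 : derive_on K1 K2 0 y. Proof. by case: KC2. Qed.

Let affine_interp t : y * (d0 + d1 * t) = (y - t) * d0 + t * (d0 + d1 * y).
Proof. by ring. Qed.

Lemma affine_sign_neg : d0 <= 0 -> d0 + d1 * y <= 0 -> d0 < 0 \/ d0 + d1 * y < 0 ->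
  K y < 0 /\ K1 y < 0.
Proof.
move=> h0 hy hor.
have K2n t : 0 < t < y -> K2 t < 0.
  move=> /andP[t0 ty]; apply: neg; first by rewrite t0.
  rewrite -(pmulr_rlt0 _ y0) affine_interp; move: hy hor.
  by move: (d0 + d1 * y) => e he [hh|hh]; nra.
have K1n t : 0 < t -> t <= y -> K1 t < 0.
  by move=> t0 ty; rewrite -K1_0; exact: (derive_decreasing dK1 K2n).
split; last exact: K1n.
rewrite -K_0; apply: (derive_decreasing dK (a := 0) (b := y)) => // t /andP[t0 ty].
exact/K1n/ltW.
Qed.

Lemma affine_sign_pos : 0 <= d0 -> 0 <= d0 + d1 * y -> 0 < d0 \/ 0 < d0 + d1 * y ->
  forall x, 0 < x -> x <= y -> 0 < K x /\ 0 < K1 x.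
Proof.
move=> h0 hy hor.
have K2p t : 0 < t < y -> 0 < K2 t.
  move=> /andP[t0 ty]; apply: pos; first by rewrite t0.
  rewrite -(pmulr_rgt0 _ y0) affine_interp; move: hy hor.
  by move: (d0 + d1 * y) => e he [hh|hh]; nra.
have K1p t : 0 < t -> t <= y -> 0 < K1 t.
  by move=> t0 ty; rewrite -K1_0; exact: (derive_increasing dK1 K2p).
move=> x x0 xy; split; last exact: K1p.
rewrite -K_0; apply: (derive_increasing dK (a := 0) (b := y)) => // t /andP[t0 ty].
exact/K1p/ltW.
Qed.

(** The affine function d0 + d1 x changes sign from + to - at its zero, where K1 starts to
    fall. *)
Lemma affine_sign_posneg : 0 < d0 -> d0 + d1 * y < 0 ->
  exists2 c, 0 < c < y & [/\ forall x, 0 < x -> x <= c -> 0 < K1 x,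
    forall x x', c <= x -> x < x' -> x' <= y -> K1 x' < K1 x &
    forall x, 0 < x -> x <= c -> 0 < K x].
Proof.
move=> h0 hy; have d1n : d1 < 0.
  by have h : d1 * y < 0; [lra|rewrite pmulr_llt0 in h].
pose c := - d0 / d1; have c0 : 0 < c by rewrite /c mulNr oppr_gt0 pmulr_rlt0// invr_lt0.
have dc : d0 + d1 * c = 0 by rewrite /c; field; rewrite lt_eqF.
have cy : c < y.
  by rewrite -subr_gt0 -(nmulr_rlt0 _ d1n); lra.
have below r : r < c -> 0 < d0 + d1 * r.
  by move=> rc; have h : 0 < d1 * (r - c); [rewrite nmulr_rgt0 ?subr_lt0|lra].
have above r : c < r -> d0 + d1 * r < 0.
  by move=> rc; have h : d1 * (r - c) < 0; [rewrite nmulr_rlt0 ?subr_gt0|lra].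
have K1p t : 0 < t -> t <= c -> 0 < K1 t.
  move=> t0 tc; rewrite -K1_0.
  apply: (derive_increasing (derive_on_sub (lexx 0) (le_trans tc (ltW cy)) dK1) (a := 0) (b := t)) => //.
  by move=> r /andP[r0 rt]; apply: pos; [rewrite r0 (lt_trans (lt_le_trans rt tc))|apply: below; exact: lt_le_trans tc].
exists c; first by rewrite c0.
split => //.
- move=> x x' cx xx' xy; apply: (derive_decreasing (derive_on_sub (ltW c0) (lexx y) dK1)) => //.
  by move=> r /andP[cr ry]; apply: neg; [rewrite (lt_trans c0 cr)|exact: above].
- move=> x x0 xc; rewrite -K_0.
  apply: (derive_increasing (derive_on_sub (lexx 0) (le_trans xc (ltW cy)) dK) (a := 0) (b := x)) => //.
  by move=> r /andP[r0 rc]; apply: K1p => //; exact: le_trans (ltW rc) xc.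
Qed.

(** If the difference of the lines is positive at 0, then K rises first and can only come
    back below 0 with a negative slope. *)
Lemma affine_sign_contact : d0 + d1 * y <= 0 -> K y <= 0 -> 0 <= K1 y ->
  d0 = 0 /\ d0 + d1 * y = 0.
Proof.
move=> hy Ky K1y.
have [h0|h0] := leP d0 0.
  have [h|h] := ltP d0 0.
    by have [_] := affine_sign_neg h0 hy (or_introl h); rewrite ltNge K1y.
  have [h'|h'] := ltP (d0 + d1 * y) 0.
    by have [_] := affine_sign_neg h0 hy (or_intror h'); rewrite ltNge K1y.
  by split; apply/le_anti/andP.
exfalso; move: hy; rewrite le_eqVlt => /orP[/eqP hy|hy].
  have [|+ _] := affine_sign_pos (ltW h0) _ (or_introl h0) y0 (lexx y).
    by rewrite hy.
  by rewrite ltNge Ky.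
have [c /andP[c0 cy] [K1p K1d Kp]] := affine_sign_posneg h0 hy.
have : K c <= K y.
  apply: (derive_nondecreasing (derive_on_sub (ltW c0) (lexx y) dK)) => //; last exact: ltW.
  by move=> t /andP[ct ty]; rewrite (le_trans K1y)// ltW// K1d// ltW.
by have := Kp c c0 (lexx c); lra.
Qed.

(** If d0 is positive, K rises first and falls for good once it starts falling; if d0 and
    d0 + d1 y are both nonpositive, K decreases. Neither fits the values at c and y. *)
Lemma affine_sign_cross c : 0 < c < y -> K c <= 0 -> 0 <= K y ->
  d0 != 0 \/ d0 + d1 * y != 0 -> [/\ d0 < 0, 0 < d0 + d1 * y & 0 < K1 y].
Proof.
move=> /andP[c0 cy] Kc Ky hor.
have [h0|h0] := ltP d0 0; have [hy|hy] := ltP 0 (d0 + d1 * y).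
- split => //; rewrite ltNge; apply/negP => K1y.
  have d1p : 0 < d1.
    by have h : 0 < d1 * y; [lra|rewrite pmulr_lgt0 in h].
  pose r := - d0 / d1; have r0 : 0 < r by rewrite /r divr_gt0// oppr_gt0.
  have dr : d0 + d1 * r = 0 by rewrite /r; field; rewrite gt_eqF.
  have ry : r < y by rewrite -subr_gt0 -(pmulr_rgt0 _ d1p); lra.
  have below x : x < r -> d0 + d1 * x < 0.
    by move=> xr; have h : d1 * (x - r) < 0; [rewrite pmulr_rlt0 ?subr_lt0|lra].
  have above x : r < x -> 0 < d0 + d1 * x.
    by move=> xr; have h : 0 < d1 * (x - r); [rewrite pmulr_rgt0 ?subr_gt0|lra].
  have K1n t : 0 < t -> t < y -> K1 t < 0.
    move=> t0 ty; have [tr|tr] := leP t r.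
      rewrite -K1_0.
      apply: (derive_decreasing (derive_on_sub (lexx 0) (ltW ty) dK1) (a := 0) (b := t)) => //.
      by move=> x /andP[x0 xt]; apply: neg; [rewrite x0 (lt_trans xt)|apply: below; exact: lt_le_trans tr].
    apply: lt_le_trans K1y.
    apply: (derive_increasing (derive_on_sub (ltW r0) (lexx y) dK1) (a := r) (b := y)) => //.
      by move=> x /andP[rx xy]; apply: pos; [rewrite (lt_trans r0 rx)|exact: above].
    exact: ltW.
  have : K y < K 0.
    by apply: (derive_decreasing dK (a := 0) (b := y)) => // x /andP[x0 xy]; exact: K1n.
  by rewrite K_0 ltNge Ky.
- by have [] := affine_sign_neg (ltW h0) hy (or_introl h0); rewrite ltNge Ky.
- by have [] := affine_sign_pos h0 (ltW hy) (or_intror hy) c0 (ltW cy); rewrite ltNge Kc.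
- have hor' : 0 < d0 \/ d0 + d1 * y < 0.
    case: hor => hne; [left|right]; rewrite lt_neqAle ?h0 ?hy andbT//.
    by rewrite eq_sym.
  move: h0; rewrite le_eqVlt => /orP[/eqP h0|h0].
    have h0' : d0 <= 0 by rewrite -h0.
    have hy' : d0 + d1 * y < 0 by case: hor' => //; rewrite -h0 ltxx.
    by have [] := affine_sign_neg h0' hy (or_intror hy'); rewrite ltNge Ky.
  move: hy; rewrite le_eqVlt => /orP[/eqP hy|hy].
    have hy' : 0 <= d0 + d1 * y by rewrite hy.
    by have [] := affine_sign_pos (ltW h0) hy' (or_introl h0) c0 (ltW cy); rewrite ltNge Kc.
  have [r /andP[r0 ry] [K1p K1d Kp]] := affine_sign_posneg h0 hy.
  have rc : r < c by rewrite ltNge; apply/negP => /(Kp _ c0); rewrite ltNge Kc.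
  have K1c : K1 c < 0.
    rewrite ltNge; apply/negP => K1c.
    have : K r <= K c.
      apply: (derive_nondecreasing (derive_on_sub (ltW r0) (ltW cy) dK)) => //; last exact: ltW.
      by move=> t /andP[rt tc]; rewrite (le_trans K1c)// ltW// K1d// ltW.
    by have := Kp r r0 (lexx r); lra.
  have : K y < K c.
    apply: (derive_decreasing (derive_on_sub (ltW c0) (lexx y) dK)) => //.
    by move=> t /andP[ct ty]; apply: lt_trans K1c; rewrite K1d// ltW.
  by lra.
Qed.

End affine_sign.
End MoreCalculus.

(** * Affine fits for x^p + x^s *)

Section Master.
Context {R : realType}.
Variables (p s : nat).
Hypotheses (p_gt2 : (2 < p)%N) (ps : (p < s)%N).
Implicit Types (q v m x y : R).

Let c0 : (0 : R) <= 1. Proof. exact: ler01. Qed.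
Let c01 : (0 : R) < 1 + 1. Proof. by lra. Qed.

Local Notation X0 := (Xi p s (1 : R) 1).
Local Notation X1 := (Xi1 p s (1 : R) 1).
Local Notation X2 := (Xi2 p s (1 : R) 1).
Local Notation h := (hx p s (1 : R) 1).
Local Notation w := (wx p s (1 : R) 1).
Local Notation F := (Fl p s (1 : R) 1).
Local Notation F1 := (Fl1 p s (1 : R) 1).
Local Notation F2 := (Fl2 p s (1 : R) 1).
Local Notation fit := (left_fit p s (1 : R) 1).
Local Notation vf := (vfit p s (1 : R) 1).
Local Notation mf := (mfit p s (1 : R) 1).
Local Notation df := (dfit p s (1 : R) 1).

(** The height of h above the line; its sign is opposite to that of the second
    derivative of the defect. *)
Definition gap q v m x := h x - (v - m * (x - q)).

Lemma F2_neg q v m x : 0 < x -> 0 < v - m * (x - q) -> (F2 q v m x < 0) = (0 < gap q v m x).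
Proof. by move=> x0 l0; case: (Fl2_sign p_gt2 ps c0 c0 c01 x0 l0). Qed.

Lemma F2_pos q v m x : 0 < x -> 0 < v - m * (x - q) -> (0 < F2 q v m x) = (gap q v m x < 0).
Proof. by move=> x0 l0; case: (Fl2_sign p_gt2 ps c0 c0 c01 x0 l0). Qed.

Lemma F2_le0 q v m x : 0 < x -> 0 < v - m * (x - q) -> (F2 q v m x <= 0) = (0 <= gap q v m x).
Proof. by move=> x0 l0; rewrite leNgt F2_pos// -leNgt. Qed.

Lemma F2_ge0 q v m x : 0 < x -> 0 < v - m * (x - q) -> (0 <= F2 q v m x) = (gap q v m x <= 0).
Proof. by move=> x0 l0; rewrite leNgt F2_neg// -leNgt. Qed.

Lemma F2_lt q v m q' v' m' x : 0 < v - m * (x - q) -> 0 < v' - m' * (x - q') ->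
  (F2 q v m x < F2 q' v' m' x) = (v - m * (x - q) < v' - m' * (x - q')).
Proof.
move=> l l'; rewrite /Fl2 ltrD2l ltrN2 ltf_pV2 ?posrE ?exprn_gt0//.
by rewrite ltr_pXn2r ?nnegrE ?(ltW l) ?(ltW l').
Qed.

Lemma line_ge q v m d x : 0 < m -> 0 < v - m * (d - q) -> x <= d -> 0 < v - m * (x - q).
Proof. by move=> m0 ld xd; apply: (lt_le_trans ld); rewrite lerD2l lerN2 ler_pM2l// lerD2r. Qed.

Lemma line0_ge v m d x : 0 < m -> 0 < v - m * d -> x <= d -> 0 < v - m * (x - 0).
Proof. by move=> m0 ld xd; apply: (line_ge (d := d)) => //; rewrite subr0. Qed.

Lemma fit_v q v m : 0 < q -> fit q v m -> 0 < v.
Proof. by move=> q0 [m0 l0 _ _]; apply: (lt_trans l0); rewrite gtrBl mulr_gt0. Qed.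

Lemma F0_C2 v m d : 0 < v -> 0 < m -> 0 < v - m * d ->
  C2_on (F 0 v m) (F1 0 v m) (F2 0 v m) 0 d.
Proof. by move=> v0 m0 l0; apply: Fl_C2 => //; rewrite subr0. Qed.

Lemma fit_C2 q v m : 0 < q -> fit q v m -> C2_on (F 0 v m) (F1 0 v m) (F2 0 v m) 0 q.
Proof. by move=> q0 f; have v0 := fit_v q0 f; case: f => m0 l0 _ _; exact: F0_C2. Qed.

(** Brings two lines issued from 0 into the setting of the comparison of fits. *)
Lemma F0_compare v m v' m' y : 0 < v -> 0 < m -> 0 < v - m * y ->
  0 < v' -> 0 < m' -> 0 < v' - m' * y ->
  [/\ C2_on (fun x => F 0 v m x - F 0 v' m' x) (fun x => F1 0 v m x - F1 0 v' m' x)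
       (fun x => F2 0 v m x - F2 0 v' m' x) 0 y,
    F 0 v m 0 - F 0 v' m' 0 = 0, F1 0 v m 0 - F1 0 v' m' 0 = 0,
    forall x, 0 < x < y -> 0 < v - v' + (m' - m) * x -> 0 < F2 0 v m x - F2 0 v' m' x
  & forall x, 0 < x < y -> v - v' + (m' - m) * x < 0 -> F2 0 v m x - F2 0 v' m' x < 0].
Proof.
move=> v0 m0 l0 v0' m0' l0'; split; first by apply: C2_onB; exact: F0_C2.
- by rewrite !Fl_q subrr.
- by rewrite !Fl1_q subrr.
all: move=> x /andP[_ /ltW xy] H; have := line0_ge m0 l0 xy; have := line0_ge m0' l0' xy.
all: by move=> lx' lx; rewrite ?subr_gt0 ?subr_lt0 F2_lt//; lra.
Qed.

(** Near 0 the second derivative of the defect is close to - 1 / v^2. *)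
Lemma F_near0 v m d : 0 < v -> 0 < m -> 0 < d -> 0 < v - m * d ->
  exists2 e, 0 < e <= d & forall x, 0 < x -> x <= e ->
   [/\ F 0 v m x < 0, F1 0 v m x < 0 & F2 0 v m x < 0].
Proof.
move=> v0 m0 d0 ld.
have cX2 : {for 0, continuous X2} := deriv_continuous (deriv_Xi2 p s 1 1 0).
have hv : 0 < (v ^+ 2)^-1 by rewrite invr_gt0 exprn_gt0.
have [e e0 he] : exists2 e, 0 < e & forall x, `|x| < e -> X2 x < (v ^+ 2)^-1.
  move: cX2 => /cvgrPdist_lt /(_ _ hv) /nbhs_ballP[e /= e0 he]; exists e => // x hx.
  have := he x; rewrite /ball/= sub0r normrN => /(_ hx).
  by rewrite (Xi2_0 p_gt2 ps) sub0r normrN => /ltr_normlW.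
pose d' := Num.min d (e / 2).
have d'0 : 0 < d' by rewrite lt_min d0 divr_gt0.
have d'd : d' <= d by rewrite ge_min lexx.
have d'e : d' < e by rewrite gt_min; apply/orP; right; lra.
have F2n x : 0 < x -> x <= d' -> F2 0 v m x < 0.
  move=> x0 xd; rewrite /Fl2 subr_lt0 subr0.
  apply: (lt_le_trans (he x _)); first by rewrite gtr0_norm// (le_lt_trans xd).
  have lx : 0 < v - m * x by rewrite -[x]subr0; apply: (line0_ge (d := d)) => //; exact: le_trans d'd.
  rewrite lef_pV2 ?posrE ?exprn_gt0// ler_pXn2r ?nnegrE ?ltW//.
  by rewrite gtrBl mulr_gt0.
have [dF dF1] := C2_on_sub (lexx 0) d'd (F0_C2 v0 m0 ld).
have F1n x : 0 < x -> x <= d' -> F1 0 v m x < 0.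
  move=> x0 xd; rewrite -[ltRHS](Fl1_q p s 1 1 0 v m).
  apply: (derive_decreasing (derive_on_sub (lexx 0) xd dF1) (a := 0) (b := x)) => // t /andP[t0 tx].
  by rewrite F2n// (le_trans (ltW tx)).
exists d'; first by rewrite d'0.
move=> x x0 xd; split; [|exact: F1n|exact: F2n].
rewrite -[ltRHS](Fl_q p s 1 1 0 v m).
apply: (derive_decreasing (derive_on_sub (lexx 0) xd dF) (a := 0) (b := x)) => // t /andP[t0 tx].
by rewrite F1n// (le_trans (ltW tx)).
Qed.

(** The defect leaves 0 downwards and F1 returns to 0 at q, so it is convex somewhere, where
    the line runs above h. *)
Lemma gap_dip v m q : 0 < v -> 0 < m -> 0 < q -> 0 < v - m * q -> F1 0 v m q = 0 ->
  exists2 b, 0 < b < q & gap 0 v m b < 0.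
Proof.
move=> v0 m0 q0 lq F1q; have [e /andP[e0 eq] he] := F_near0 v0 m0 q0 lq.
have [_ F1e _] := he e e0 (lexx e).
have [dF dF1] := F0_C2 v0 m0 lq.
have eq' : e < q by rewrite lt_neqAle eq andbT; apply/eqP => E; move: F1e; rewrite E F1q ltxx.
have [|b /andP[eb bq] Hb] := derive_gt0 eq' (derive_on_sub (ltW e0) (lexx q) dF1).
  by rewrite F1q.
have b0 := lt_trans e0 eb.
by exists b; [rewrite b0|rewrite -F2_pos//; apply: (line0_ge (d := q)) => //; exact: ltW].
Qed.

Variables (x1 x2 : R).
Hypotheses (x1_gt0 : 0 < x1) (x12 : x1 < x2).
Hypotheses (form1 : forall x, 0 < x < x1 -> 0 < form_at p s 1 1 x)
  (form2 : forall x, x1 < x < x2 -> form_at p s 1 1 x < 0)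
  (form3 : forall x, x2 < x -> 0 < form_at p s 1 1 x).

Let x2_gt0 : 0 < x2. Proof. exact: lt_trans x12. Qed.

Lemma gap_cvx1 q v m : convex3 (fun x => 0 < x <= x1) (gap q v m).
Proof.
have -> : gap q v m = (fun x => h x - ((v + m * q) + (- m) * x)).
  by apply/funext => x; rewrite /gap; ring.
apply: convex3_affine; apply: hx_convex => //.
  by move=> x /andP[].
move=> x z t /andP[x0 _] /andP[_ zx] /andP[xt tz]; apply: form1.
by rewrite (lt_trans x0 xt) (lt_le_trans tz).
Qed.

Lemma gap_ccv q v m : concave3 (fun x => x1 <= x <= x2) (gap q v m).
Proof.
have -> : gap q v m = (fun x => h x - ((v + m * q) + (- m) * x)).
  by apply/funext => x; rewrite /gap; ring.
apply: concave3_affine; apply: hx_concave => //.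
  by move=> x /andP[xx _]; exact: lt_le_trans xx.
move=> x z t /andP[x0 _] /andP[_ zx] /andP[xt tz]; apply: form2.
by rewrite (le_lt_trans x0 xt) (lt_le_trans tz).
Qed.

Lemma gap_cvx2 q v m : convex3 (fun x => x2 <= x) (gap q v m).
Proof.
have -> : gap q v m = (fun x => h x - ((v + m * q) + (- m) * x)).
  by apply/funext => x; rewrite /gap; ring.
apply: convex3_affine; apply: hx_convex => //.
  by move=> x xx; exact: lt_le_trans xx.
by move=> x z t xx _ /andP[xt _]; apply: form3; exact: le_lt_trans xt.
Qed.

Definition gap_low q v m := shape_low (gap_cvx1 q v m) (gap_ccv q v m).
Definition gap_high q v m := shape_high (gap_ccv q v m) (gap_cvx2 q v m).
Definition gap_all q v m := shape_all (gap_cvx1 q v m) (gap_ccv q v m) (gap_cvx2 q v m).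

(** A positive value would give the sign pattern - + - of the gap inside (0, q), and the gap
    would then be negative at q, because h is convex and then concave up to x2. *)
Lemma fit_le0 q v m x : 0 < q <= x2 -> fit q v m -> 0 <= gap 0 v m q ->
  0 <= x -> x <= q -> F 0 v m x <= 0.
Proof.
move=> /andP[q0 qx] f gq x0 xq; rewrite leNgt; apply/negP => Fx.
have C2 := fit_C2 q0 f; have v0 := fit_v q0 f; case: f => m0 l0 Fq F1q.
have [F00 F10] := (Fl_q p s 1 1 0 v m, Fl1_q p s 1 1 0 v m).
have x0' : 0 < x by rewrite lt_neqAle x0 andbT; apply/eqP => E; move: Fx; rewrite -E F00 ltxx.
have xq' : x < q by rewrite lt_neqAle xq andbT; apply/eqP => E; move: Fx; rewrite E Fq ltxx.
have [|t1 [t2 [t3 [[t10 t12 t23 t3q] [H1 H2 H3]]]]] := double_zeros_pos C2 _ F00 F10 Fq F1q Fx.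
  by rewrite x0'.
have t20 := lt_trans t10 t12; have t30 := lt_trans t20 t23.
have lt t : t < q -> 0 < v - m * (t - 0) by move=> tq; apply: (line0_ge (d := q)) => //; exact: ltW.
move: H1; rewrite F2_pos// ?lt ?(lt_trans t12) ?(lt_trans t23)// => H1.
move: H2; rewrite F2_neg// ?lt ?(lt_trans t23)// => H2.
move: H3; rewrite F2_pos// ?lt// => H3.
by have := gap_low t10 t12 t23 t3q qx H1 (ltW H2) H3; rewrite ltNge gq.
Qed.

(** The defect is negative near 0 and has double zeros at 0 and q, so its second derivative
    takes the signs - + - in this order. *)
Lemma fit_pattern q v m : 0 < q -> fit q v m ->
  exists t1 t2 t3, [/\ 0 < t1, t1 < t2, t2 < t3 & t3 < q] /\
    [/\ 0 < gap 0 v m t1, gap 0 v m t2 < 0 & 0 < gap 0 v m t3].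
Proof.
move=> q0 f; have C2 := fit_C2 q0 f; have v0 := fit_v q0 f; case: f => m0 l0 Fq F1q.
have [F00 F10] := (Fl_q p s 1 1 0 v m, Fl1_q p s 1 1 0 v m).
have [e /andP[e0 eq] he] := F_near0 v0 m0 q0 l0.
have [Fe _ _] := he e e0 (lexx e).
have eq' : e < q by rewrite lt_neqAle eq andbT; apply/eqP => E; move: Fe; rewrite E Fq ltxx.
have [|t1 [t2 [t3 [[t10 t12 t23 t3q] [H1 H2 H3]]]]] := double_zeros_neg C2 _ F00 F10 Fq F1q Fe.
  by rewrite e0.
have t20 := lt_trans t10 t12; have t30 := lt_trans t20 t23.
have lt t : t < q -> 0 < v - m * (t - 0) by move=> tq; apply: (line0_ge (d := q)) => //; exact: ltW.
exists t1, t2, t3; split => //; split.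
- by move: H1; rewrite F2_neg// ?lt ?(lt_trans t12) ?(lt_trans t23).
- by move: H2; rewrite F2_pos// ?lt ?(lt_trans t23).
- by move: H3; rewrite F2_neg// ?lt.
Qed.

Let id_cont x : {for x, continuous (fun y : R => y)}.
Proof. exact: (deriv_continuous (deriv_id x)). Qed.

Let one_cont x : {for x, continuous (fun _ : R => 1 : R)}.
Proof. exact: continuous_const. Qed.

Lemma df_continuous q : 0 < q -> {for q, continuous df}.
Proof. by move=> q0; exact: (dfit_continuous p_gt2 ps (one_cont (x := q)) (one_cont (x := q)) (id_cont (x := q)) q0 c0 c0 c01). Qed.

Lemma mf_continuous q : 0 < q -> {for q, continuous mf}.
Proof. by move=> q0; exact: (mfit_continuous p_gt2 ps (one_cont (x := q)) (one_cont (x := q)) (id_cont (x := q)) q0 c0 c0 c01). Qed.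

Lemma hx_continuous q : 0 < q -> {for q, continuous h}.
Proof. by move=> q0; exact: (deriv_continuous (deriv_hx p_gt2 ps c0 c0 c01 q0)). Qed.

(** The gap at q of the fit on [0, q]: as long as it is nonnegative the fit is a certificate
    on [0, q]. *)
Definition egap q : R := h q - df q.

Lemma egap_continuous q : 0 < q -> {for q, continuous egap}.
Proof.
by move=> q0; apply: continuousB; [exact: hx_continuous|exact: df_continuous].
Qed.

Lemma fitP q : 0 < q -> fit q (vf q) (mf q).
Proof. by move=> q0; exact: left_fit_exists. Qed.

Lemma gap_fit q v m : 0 < q -> fit q v m -> gap 0 v m q = egap q.
Proof.
move=> q0 /(left_fit_unique p_gt2 ps c0 c0 c01 q0)[-> ->].
by rewrite /gap subr0 vmfit.
Qed.

Lemma gap_cvx1_gt0 q v m x y z : 0 < x -> x < y -> y < z -> z <= x1 ->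
  gap q v m x < 0 -> 0 <= gap q v m y -> 0 < gap q v m z.
Proof.
move=> x0 xy yz zx gx gy.
have := gap_cvx1 q v m (x := x) (y := y) (z := z).
move=> /(_ _ _ xy yz) H; have {H} : (z - x) * gap q v m y < (z - y) * gap q v m x + (y - x) * gap q v m z.
  apply: H; first by rewrite x0 (le_trans _ zx)// ltW// (lt_trans xy).
  by rewrite zx (lt_trans x0)// (lt_trans xy).
nra.
Qed.

(** Where h is convex, a gap that changes from - to + stays positive. *)
Lemma egap_gt0 q : 0 < q -> q <= x1 -> 0 < egap q.
Proof.
move=> q0 qx; have f := fitP q0; rewrite -(gap_fit q0 f).
have [t1 [t2 [t3 [[t10 t12 t23 t3q] [_ H2 H3]]]]] := fit_pattern q0 f.
by apply: (gap_cvx1_gt0 (x := t2) (y := t3)) => //; [exact: lt_trans t12|exact: ltW].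
Qed.

Hypothesis egap_x2 : egap x2 < 0.

(** The gap at the end of the fit is positive at x1 and negative at x2. *)
Lemma critical_exists : exists2 xb, x1 < xb < x2 &
  egap xb = 0 /\ forall q, 0 < q -> q <= xb -> 0 <= egap q.
Proof.
have [||xb /andP[xb1 xb2] [e0 H]] := @first_exit R egap x1 x2 (ltW x12) _ _ egap_x2.
- by move=> x xx _; apply: egap_continuous; exact: lt_le_trans xx.
- by rewrite ltW// egap_gt0.
exists xb.
  rewrite xb2 andbT lt_neqAle xb1 andbT; apply/eqP => E.
  by have := egap_gt0 x1_gt0 (lexx _); rewrite E e0 ltxx.
split => // q q0 qx; have [qx1|/ltW qx1] := leP q x1; last exact: H.
by rewrite ltW// egap_gt0.
Qed.

Variable xb : R.
Hypotheses (xb12 : x1 < xb < x2) (egap_xb : egap xb = 0)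
  (egap_ge0 : forall q, 0 < q -> q <= xb -> 0 <= egap q).

Let xb_gt0 : 0 < xb. Proof. by case/andP: xb12 => h1 _; exact: lt_trans h1. Qed.
Let x1b : x1 < xb. Proof. by case/andP: xb12. Qed.
Let xb2 : xb < x2. Proof. by case/andP: xb12. Qed.
Local Notation vb := (vf xb).
Local Notation mb := (mf xb).

Let fb := fitP xb_gt0.
Let mb0 : 0 < mb. Proof. by case: fb. Qed.
Let lb0 : 0 < vb - mb * xb. Proof. by case: fb. Qed.
Let vb0 : 0 < vb. Proof. exact: fit_v fb. Qed.

Lemma gap_b_xb : gap 0 vb mb xb = 0.
Proof. by rewrite (gap_fit xb_gt0 fb). Qed.

Lemma gap_b_before : exists2 t, x1 <= t < xb & 0 < gap 0 vb mb t.
Proof.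
have [t1 [t2 [t3 [[t10 t12 t23 t3q] [_ H2 H3]]]]] := fit_pattern xb_gt0 fb.
have [t3x|t3x] := leP x1 t3; first by exists t3; rewrite ?t3x.
exists x1; first by rewrite lexx.
by apply: (gap_cvx1_gt0 (x := t2) (y := t3)) => //; [exact: lt_trans t12|exact: ltW].
Qed.

(** The gap is concave on [x1, x2], positive before xb and zero at xb. *)
Lemma gap_b_after x : xb < x -> x <= x2 -> gap 0 vb mb x < 0.
Proof.
move=> bx xx2; have [t /andP[xt tb] Ht] := gap_b_before.
have := gap_ccv 0 vb mb (x := t) (y := xb) (z := x) _ _ tb bx.
rewrite gap_b_xb mulr0 => H.
have {H} : (x - xb) * gap 0 vb mb t + (xb - t) * gap 0 vb mb x < 0.
  by apply: H; rewrite ?xt ?xx2 ?(ltW (lt_trans tb xb2)) ?(ltW (lt_trans x1b bx)).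
nra.
Qed.

Lemma deriv_gap q v m x : 0 < x -> is_derive x 1 (gap q v m) (m - w x).
Proof.
move=> x0; rewrite /gap; apply: (deriv_eq (deriv_sub (deriv_hx p_gt2 ps c0 c0 c01 x0)
  (deriv_sub (deriv_cst v x) (deriv_scale m (deriv_sub (deriv_id x) (deriv_cst q x)))))).
by ring.
Qed.

Lemma w_increasing x y : x1 <= x -> x < y -> y <= x2 -> w x < w y.
Proof.
move=> xx xy yx; apply: wx_increasing => //; first exact: lt_le_trans xx.
by move=> t /andP[xt ty]; apply: form2; rewrite (le_lt_trans xx) ?(lt_le_trans ty).
Qed.

(** The gap falls from a positive value to 0 at xb, so its derivative mb - w is negative
    just before xb, and w increases there. *)
Lemma mb_lt_w : mb < w xb.
Proof.
have [t /andP[xt tb] Ht] := gap_b_before; have t0 := lt_le_trans x1_gt0 xt.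
have [||c /andP[tc cb] Hc] := @derive_lt0 R (gap 0 vb mb) (fun x => mb - w x) t xb tb.
- by move=> x tx _; apply: deriv_gap; exact: lt_le_trans tx.
- by rewrite gap_b_xb.
have wc : mb < w c by lra.
by apply: lt_trans wc _; apply: w_increasing => //; rewrite ltW// (le_lt_trans xt).
Qed.

(** Otherwise the fit on [0, y] is a certificate on [0, y], and comparing it with the fit on
    [0, xb], which overshoots h beyond xb, makes the two lines equal. *)
Lemma egap_after y : xb < y -> y <= x2 -> egap y < 0.
Proof.
move=> by_ yx; rewrite ltNge; apply/negP => ey.
have y0 := lt_trans xb_gt0 by_.
have f := fitP y0; set v := vf y in f; set m := mf y in f.
have C2 := fit_C2 y0 f; have v0 := fit_v y0 f.
have gy : 0 <= gap 0 v m y by rewrite (gap_fit y0 f).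
have Fle x : 0 <= x -> x <= y -> F 0 v m x <= 0.
  by apply: fit_le0 => //; rewrite y0.
have [m0 l0 Fy F1y] := f.
have lt t : t <= y -> 0 < v - m * (t - 0) by move=> ty; apply: (line0_ge (d := y)).
have lxb : 0 < v - m * xb by have := lt xb (ltW by_); rewrite subr0.
have [C2K K0 K10 pos neg] := F0_compare v0 m0 lxb vb0 mb0 lb0.
have Fb0 : F 0 vb mb xb = 0 by case: fb.
have F1b0 : F1 0 vb mb xb = 0 by case: fb.
have Kb : F 0 v m xb - F 0 vb mb xb <= 0.
  by rewrite Fb0 subr0 Fle// ltW.
have gb := gap_b_xb; rewrite /gap subr0 in gb.
have [gvb|gvb] := leP 0 (gap 0 v m xb).
  have F1b : 0 <= F1 0 v m xb.
    rewrite -[leLHS]F1y; have [_ dF1] := C2.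
    apply: (derive_nonincreasing (derive_on_sub (ltW xb_gt0) (lexx y) dF1)) => //; last exact: ltW.
    move=> t /andP[bt ty]; rewrite F2_le0//; [|exact: lt_trans bt|by apply: lt; exact: ltW].
    have := gap_ccv 0 v m (x := xb) (y := t) (z := y) _ _ bt ty => H.
    have {H} : (y - t) * gap 0 v m xb + (t - xb) * gap 0 v m y < (y - xb) * gap 0 v m t.
      by apply: H; rewrite ?(ltW x1b) ?(ltW xb2) ?yx ?(ltW (lt_trans x1b by_)).
    nra.
  have [] := affine_sign_contact xb_gt0 C2K K0 K10 pos neg.
  - by move: gvb gb; rewrite /gap subr0; lra.
  - exact: Kb.
  - by rewrite F1b0 subr0.
  move=> e1 e2; have ev : v = vb by lra.
  have em : m = mb.
    have : (mb - m) * xb = 0 by lra.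
    by move=> /eqP; rewrite mulf_eq0 (gt_eqF xb_gt0) orbF subr_eq0 => /eqP.
  by have := gap_b_after by_ yx; rewrite -ev -em ltNge gy.
have dpos : 0 < v - vb + (mb - m) * xb.
  by move: gvb gb; rewrite /gap subr0; lra.
have [dd|dd] := leP 0 (v - vb).
  have [+ _] := affine_sign_pos xb_gt0 C2K K0 K10 pos dd (ltW dpos) (or_intror dpos) xb_gt0 (lexx xb).
  by rewrite ltNge Kb.
have sl : 0 < mb - m.
  have h1 : 0 < (mb - m) * xb by lra.
  by rewrite pmulr_lgt0 in h1.
have := gap_b_after by_ yx; move: gy; rewrite /gap subr0 => g1 g2.
have : 0 < (mb - m) * (y - xb) by rewrite mulr_gt0// subr_gt0.
lra.
Qed.

(** * Lines adapted to a right end *)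

(** rr q v X is the value at X, and - mr q v X the slope, of the line through (q, v) whose
    first-order defect vanishes at X. *)
Definition rr q v X := (X - q) / (v * (X1 X - X1 q)).
Definition mr q v X := (v - rr q v X) / (X - q).

Lemma X1_lt x y : 0 <= x -> x < y -> X1 x < X1 y.
Proof.
move=> x0 xy; have [|c /andP[xc cy] e] := @mean_value R X1 X2 x y xy.
  by move=> t _ _; exact: deriv_Xi1.
have : 0 < X2 c by apply: Xi2_gt0 => //; exact: le_lt_trans xc.
by move=> hc; rewrite -subr_gt0 e mulr_gt0// subr_gt0.
Qed.

Lemma X2_lt x y : 0 < x -> x < y -> X2 x < X2 y.
Proof.
move=> x0 xy; have [|c /andP[xc cy] e] := @mean_value R X2 (Xi3 p s 1 1) x y xy.
  by move=> t _ _; exact: deriv_Xi2.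
have : 0 < Xi3 p s 1 1 c by apply: Xi3_gt0 => //; exact: lt_trans xc.
by move=> hc; rewrite -subr_gt0 e mulr_gt0// subr_gt0.
Qed.

Lemma rr_gt0 q v X : 0 <= q -> q < X -> 0 < v -> 0 < rr q v X.
Proof. by move=> q0 qX v0; rewrite divr_gt0 ?mulr_gt0 ?subr_gt0 ?X1_lt. Qed.

Lemma mr_line q v X : q < X -> v - mr q v X * (X - q) = rr q v X.
Proof. by move=> qX; rewrite /mr divfK ?gt_eqF ?subr_gt0//; ring. Qed.

Lemma mr_F1 q v X : 0 <= q -> q < X -> 0 < v -> F1 q v (mr q v X) X = 0.
Proof.
move=> q0 qX v0; rewrite /Fl1 mr_line// /rr; field.
by rewrite !gt_eqF// subr_gt0// X1_lt.
Qed.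

Lemma mr_h_gt0 q X : 0 < q -> q < X -> 0 < mr q (h q) X.
Proof.
move=> q0 qX; have hq := hx_gt0 p_gt2 ps c0 c0 c01 q0.
rewrite divr_gt0// subr_gt0// /rr ltr_pdivrMr; last first.
  by rewrite mulr_gt0// subr_gt0 X1_lt// ltW.
have [|c /andP[qc cX] e] := @mean_value R X1 X2 q X qX.
  by move=> t _ _; exact: deriv_Xi1.
have := hx_Xi2 p_gt2 ps c0 c0 c01 q0 => e2.
have -> : h q * (h q * (X1 X - X1 q)) = (h q ^+ 2 * X2 c) * (X - q) by rewrite e; ring.
rewrite ltr_pMl ?subr_gt0//.
by rewrite -[ltLHS]e2 mulrC ltr_pM2l ?exprn_gt0// X2_lt.
Qed.

Lemma F_right_C2 q v m c d : 0 < v -> 0 < m -> 0 < v - m * (d - q) ->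
  C2_on (F q v m) (F1 q v m) (F2 q v m) c d.
Proof. exact: Fl_C2. Qed.

Lemma F_slope q v m m' X : q < X -> 0 < v -> 0 < m -> m < m' -> 0 < v - m' * (X - q) ->
  F q v m' X < F q v m X.
Proof.
move=> qX v0 m0 mm lX'; have m0' := lt_trans m0 mm.
have lX : 0 < v - m * (X - q).
  by apply: (lt_le_trans lX'); rewrite lerD2l lerN2 ler_pM2r ?subr_gt0// ltW.
have [dK dK1] := C2_onB (@F_right_C2 q v m' q X v0 m0' lX') (@F_right_C2 q v m q X v0 m0 lX).
have K2 t : q < t < X -> F2 q v m' t - F2 q v m t < 0.
  move=> /andP[qt tX]; rewrite subr_lt0 F2_lt.
  - by rewrite ltrD2l ltrN2 ltr_pM2r// subr_gt0.
  - exact: line_ge m0' lX' (ltW tX).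
  - exact: line_ge m0 lX (ltW tX).
have K1 t : q < t < X -> F1 q v m' t - F1 q v m t < 0.
  move=> /andP[qt tX]; have e : 0 = F1 q v m' q - F1 q v m q by rewrite !Fl1_q subrr.
  by rewrite [ltRHS]e; apply: (derive_decreasing dK1 K2) => //; exact: ltW.
have : F q v m' X - F q v m X < F q v m' q - F q v m q.
  exact: (derive_decreasing dK K1).
by rewrite !Fl_q; lra.
Qed.

Lemma F1_slope q v m m' X : q < X -> 0 < v -> m <= m' -> 0 < v - m' * (X - q) ->
  F1 q v m' X <= F1 q v m X.
Proof.
move=> qX v0 mm lX'; have Xq : 0 < X - q by rewrite subr_gt0.
have le_l : v - m' * (X - q) <= v - m * (X - q) by rewrite lerD2l lerN2 ler_pM2r.
have lX := lt_le_trans lX' le_l.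
rewrite /Fl1 lerD2l lerN2 ler_pM2l// lef_pV2 ?posrE ?mulr_gt0//.
by rewrite ler_pM2l.
Qed.

(** A line whose defect vanishes on an interval would coincide with h there, but h is
    strictly convex or strictly concave on each of its three branches. *)
Lemma not_flat q v m a d : 0 < a -> a < d -> 0 < v -> 0 < m -> 0 < v - m * (d - q) ->
  (forall x, a <= x -> x <= d -> F q v m x = 0) -> False.
Proof.
move=> a0 ad v0 m0 ld flat.
have l x : x <= d -> 0 < v - m * (x - q) by exact: line_ge.
have flat2 x : a < x -> x < d -> gap q v m x = 0.
  move=> ax xd; have x0 := lt_trans a0 ax.
  suff : F2 q v m x = 0.
    move=> e; apply/le_anti; rewrite -F2_ge0 ?l ?(ltW xd)// -F2_le0 ?l ?(ltW xd)//.
    by rewrite e lexx.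
  have [dF dF1] := @F_right_C2 q v m a d v0 m0 ld.
  have F1z t : a < t -> t < d -> F1 q v m t = 0.
    move=> at_ td; have [_ <-] := dF t (ltW at_) (ltW td).
    have -> : 'D_1 (F q v m) t = 'D_1 (cst 0) t.
      apply: near_eq_derive.
      near=> y; apply: flat; apply: ltW; near: y; [exact: lt_nbhsr|exact: lt_nbhsl].
    exact: derive_cst.
  have [_ <-] := dF1 x (ltW ax) (ltW xd).
  have -> : 'D_1 (F1 q v m) x = 'D_1 (cst 0) x.
    apply: near_eq_derive.
    near=> y; apply: F1z; near: y; [exact: lt_nbhsr|exact: lt_nbhsl].
  exact: derive_cst.
have three (I : R -> Prop) c e : (convex3 I (gap q v m) \/ concave3 I (gap q v m)) ->
    a <= c -> c < e -> e <= d -> (forall x, c < x -> x < e -> I x) -> False.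
  move=> cvx ac ce ed HI.
  pose t1 := c + (e - c) / 4; pose t2 := c + (e - c) / 2; pose t3 := c + 3 * (e - c) / 4.
  have [h1 h2 h3 h4] : [/\ c < t1, t1 < t2, t2 < t3 & t3 < e].
    by rewrite /t1 /t2 /t3; split; lra.
  have z t : c < t -> t < e -> gap q v m t = 0.
    by move=> ct te; apply: flat2; [exact: le_lt_trans ct|exact: lt_le_trans ed].
  have g1 : gap q v m t1 = 0 by apply: z; lra.
  have g2 : gap q v m t2 = 0 by apply: z; lra.
  have g3 : gap q v m t3 = 0 by apply: z; lra.
  have i1 : I t1 by apply: HI; lra.
  have i3 : I t3 by apply: HI; lra.
  case: cvx => /(_ _ _ _ i1 i3 h2 h3); rewrite g1 g2 g3 !mulr0 addr0 ltxx//.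
have [dx1|x1d] := leP d x1.
  apply: (three _ a d (or_introl (gap_cvx1 q v m))) => // x ax xd.
  by rewrite (lt_trans a0)//= (le_trans (ltW xd)).
have [ax2|x2a] := leP x2 a.
  apply: (three _ a d (or_introl (gap_cvx2 q v m))) => // x ax xd.
  by rewrite (le_trans ax2)// ltW.
pose a' := Num.max a x1; pose d' := Num.min d x2.
have a'd' : a' < d' by rewrite gt_max !lt_min ad x2a x1d x12.
have aa' : a <= a' by rewrite le_max lexx.
have x1a' : x1 <= a' by rewrite le_max lexx orbT.
have d'd : d' <= d by rewrite ge_min lexx.
have d'x2 : d' <= x2 by rewrite ge_min lexx orbT.
apply: (three _ a' d' (or_intror (gap_ccv q v m))) => // x ax xd.
by rewrite (le_trans x1a' (ltW ax)) (le_trans (ltW xd)).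
Unshelve. all: by end_near. Qed.

(** If the defect leaves its double zero at q upwards, F1 rises and falls again before X;
    if it never rises, then it vanishes identically on [q, X]. *)
Lemma bump q' v m q X : 0 < q -> q < X -> 0 < v -> 0 < m -> 0 < v - m * (X - q') ->
  F q' v m q = 0 -> F1 q' v m q = 0 -> 0 <= F q' v m X -> F1 q' v m X <= 0 ->
  exists y0 y, [/\ q < y0, y0 < y & y < X] /\ gap q' v m y0 < 0 /\ 0 < gap q' v m y.
Proof.
move=> q0 qX v0 m0 lX Fq F1q FX F1X.
have [dF dF1] := @F_right_C2 q' v m q X v0 m0 lX.
have l x : x <= X -> 0 < v - m * (x - q') by exact: line_ge.
have [[t /andP[qt tX] F1t]|H] := pselect (exists2 t, q < t < X & 0 < F1 q' v m t).
  have [|y0 /andP[qy0 y0t] H0] := derive_gt0 qt (derive_on_sub (lexx q) (ltW tX) dF1).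
    by rewrite F1q.
  have [|y /andP[ty yX] H1] := derive_lt0 tX (derive_on_sub (ltW qt) (lexx X) dF1).
    exact: le_lt_trans F1t.
  have y0X := lt_trans y0t tX; have y0_gt0 := lt_trans q0 qy0.
  exists y0, y; split; first by split => //; exact: lt_trans ty.
  split; first by rewrite -F2_pos// l// ltW.
  rewrite -F2_neg//; first by rewrite (lt_trans _ ty)// (lt_trans y0_gt0).
  by rewrite l// ltW.
exfalso; apply: (@not_flat q' v m q X) => // x qx xX.
have mono a c : q <= a -> a <= c -> c <= X -> F q' v m c <= F q' v m a.
  apply: (derive_nonincreasing dF) => t tqX; rewrite leNgt; apply/negP => Ft.
  by apply: H; exists t.
have h1 := mono q x (lexx q) qx xX; have h2 := mono x X qx xX (lexx X).
by apply/le_anti; rewrite -{1}Fq h1 (le_trans FX h2).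
Qed.

(** Between two double zeros of a nonpositive defect the line runs above h somewhere. *)
Lemma dip q' v m q X : 0 < q -> q < X -> 0 < v -> 0 < m -> 0 < v - m * (X - q') ->
  (forall x, q <= x -> x <= X -> F q' v m x <= 0) ->
  F q' v m q = 0 -> F1 q' v m q = 0 -> F q' v m X = 0 -> F1 q' v m X = 0 ->
  exists2 t, q < t < X & gap q' v m t < 0.
Proof.
move=> q0 qX v0 m0 lX Fle Fq F1q FX F1X.
have [||y0 [y [[qy0 y0y yX] [H0 _]]]] := bump q0 qX v0 m0 lX Fq F1q; rewrite ?FX ?F1X//.
by exists y0 => //; rewrite qy0 (lt_trans y0y).
Qed.

Lemma gap_qq q v m : gap q v m q = h q - v.
Proof. by rewrite /gap subrr mulr0 subr0. Qed.

(** A positive value would give the pattern - + - of the gap inside (q, X); after a point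
    q >= x1 where h is above the line, h cannot fall below it a second time. *)
Lemma right_le0 q v m X x : x1 <= q -> q < X -> 0 < v -> 0 < m -> 0 < v - m * (X - q) ->
  0 <= gap q v m q -> F q v m X = 0 -> F1 q v m X = 0 ->
  q <= x -> x <= X -> F q v m x <= 0.
Proof.
move=> xq qX v0 m0 lX gq FX F1X qx xX; rewrite leNgt; apply/negP => Fx.
have q0 := lt_le_trans x1_gt0 xq.
have l t : t < X -> 0 < v - m * (t - q) by move=> tX; apply: (line_ge (d := X)) => //; exact: ltW.
have qx' : q < x by rewrite lt_neqAle qx andbT; apply/eqP => E; move: Fx; rewrite -E Fl_q ltxx.
have xX' : x < X by rewrite lt_neqAle xX andbT; apply/eqP => E; move: Fx; rewrite E FX ltxx.
have [|t1 [t2 [t3 [[t10 t12 t23 t3q] [H1 H2 H3]]]]] :=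
  double_zeros_pos (@F_right_C2 q v m q X v0 m0 lX) _ (Fl_q p s 1 1 q v m) (Fl1_q p s 1 1 q v m) FX F1X Fx.
  by rewrite qx'.
have t1_gt0 := lt_trans q0 t10; have t2_gt0 := lt_trans t1_gt0 t12; have t3_gt0 := lt_trans t2_gt0 t23.
have t2X := lt_trans t23 t3q; have t1X := lt_trans t12 t2X.
move: H1; rewrite F2_pos// ?l// => H1.
move: H2; rewrite F2_neg// ?l// => H2.
move: H3; rewrite F2_pos// ?l// => H3.
by have := gap_high xq t10 t12 (ltW t23) gq H1 (ltW H2); rewrite leNgt H3.
Qed.

(** The strict form of the sign pattern excluded for concave and then convex graphs. *)
Lemma gap_high_gt a q v m y0 y z : x1 <= a -> a < y0 -> y0 < y -> y < z ->
  0 <= gap q v m a -> gap q v m y0 < 0 -> 0 <= gap q v m y -> 0 < gap q v m z.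
Proof.
move=> xa ay0 y0y yz ga gy0 gy.
have key t : x2 <= t -> t < y -> gap q v m t < 0 -> 0 < gap q v m z.
  move=> xt ty gt; have := gap_cvx2 q v m (x := t) (y := y) (z := z) xt _ ty yz.
  move=> H; have {H} : (z - t) * gap q v m y < (z - y) * gap q v m t + (y - t) * gap q v m z.
    by apply: H; rewrite (le_trans xt)// ltW// (lt_trans ty).
  nra.
have [y0x|y0x] := leP x2 y0; first exact: (key y0).
have gx2 : gap q v m x2 < 0.
  apply: (concave3_down (gap_ccv q v m) (x := a) (y := y0)) => //; try exact: ltW.
    by rewrite xa/= ltW// (lt_trans ay0).
  by rewrite lexx andbT ltW.
apply: (key x2) => //; rewrite ltNge; apply/negP => yx.
have : gap q v m y < 0.
  apply: (concave3_down (gap_ccv q v m) (x := a) (y := y0)) => //; try exact: ltW.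
    by rewrite xa/= (le_trans _ yx)// ltW// (lt_trans ay0).
  by rewrite yx andbT (le_trans xa)// ltW// (lt_trans ay0).
by rewrite ltNge gy.
Qed.

Lemma mr_continuous (qf vf' Xf : R -> R) t :
  {for t, continuous qf} -> {for t, continuous vf'} -> {for t, continuous Xf} ->
  0 < vf' t -> 0 <= qf t -> qf t < Xf t ->
  {for t, continuous (fun t => mr (qf t) (vf' t) (Xf t))}.
Proof.
move=> cq cv cX v0 q0 qX.
have cXq : {for t, continuous (fun t => Xf t - qf t)} by exact: continuousB.
have c1X : {for t, continuous (fun t => X1 (Xf t))}.
  by apply: (continuous_comp cX); exact: (deriv_continuous (deriv_Xi1 p s 1 1 _)).
have c1q : {for t, continuous (fun t => X1 (qf t))}.
  by apply: (continuous_comp cq); exact: (deriv_continuous (deriv_Xi1 p s 1 1 _)).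
rewrite /mr /rr; apply: continuousM.
  apply: continuousB => //; apply: continuousM => //; apply: continuousV.
    by rewrite gt_eqF// mulr_gt0// subr_gt0 X1_lt.
  by apply: continuousM => //; exact: continuousB.
by apply: continuousV => //; rewrite gt_eqF// subr_gt0.
Qed.

(** * Lines issued from the graph of h *)

(** The defect at X of the line from (q, h q) whose first-order defect vanishes at X; it is 0
    exactly when that line fits [q, X]. *)
Definition Tf q X := F q (h q) (mr q (h q) X) X.

Section Tline.
Variables (q X : R).
Hypotheses (q0 : 0 < q) (qX : q < X).
Local Notation v := (h q).
Local Notation m := (mr q (h q) X).

Let v0 : 0 < v. Proof. exact: hx_gt0. Qed.
Let m0 : 0 < m. Proof. exact: mr_h_gt0. Qed.

Lemma T_line_gt0 : 0 < v - m * (X - q).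
Proof. by rewrite mr_line// rr_gt0// ltW. Qed.

Lemma T_F1 : F1 q v m X = 0.
Proof. by rewrite mr_F1// ltW. Qed.

Lemma T_gap_q : gap q v m q = 0.
Proof. by rewrite gap_qq subrr. Qed.

Lemma T_C2 : C2_on (F q v m) (F1 q v m) (F2 q v m) q X.
Proof. by apply: F_right_C2 => //; exact: T_line_gt0. Qed.

Lemma T_root : exists2 c, q < c < X & gap q v m c = 0.
Proof.
have [_ dF1] := T_C2; have [c /andP[qc cX] e] := mean_value qX dF1.
exists c; first by rewrite qc.
have F2c : F2 q v m c = 0.
  move/eqP: e; rewrite T_F1 Fl1_q subrr eq_sym mulf_eq0 => /orP[/eqP//|].
  by rewrite subr_eq0 gt_eqF.
have l : 0 < v - m * (c - q) by apply: (line_ge m0 T_line_gt0); exact: ltW.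
have c_gt0 := lt_trans q0 qc.
by apply/le_anti; rewrite -F2_ge0// -F2_le0// F2c lexx.
Qed.

End Tline.

(** On the convex branch the line crosses h once, from above, so F1 stays positive on (x2, X). *)
Lemma T_gt0 X : x2 < X -> 0 < Tf x2 X.
Proof.
move=> xX; have [c /andP[xc cX] gc] := T_root x2_gt0 xX.
have [dF dF1] := T_C2 x2_gt0 xX.
have m0 := mr_h_gt0 x2_gt0 xX; have lX := T_line_gt0 x2_gt0 xX.
set v := h x2 in gc dF dF1 m0 lX *; set m := mr x2 v X in gc dF dF1 m0 lX *.
have g2 : gap x2 v m x2 = 0 by exact: T_gap_q.
have l t : t < X -> 0 < v - m * (t - x2) by move=> tX; apply: (line_ge m0 lX); exact: ltW.
have gneg t : x2 < t -> t < c -> gap x2 v m t < 0.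
  move=> xt tc; have := gap_cvx2 x2 v m (x := x2) (y := t) (z := c) (lexx _) (ltW xc) xt tc.
  rewrite g2 gc !mulr0 addr0 pmulr_rlt0// subr_gt0//.
have gpos t : c < t -> 0 < gap x2 v m t.
  move=> ct; have := gap_cvx2 x2 v m (x := x2) (y := c) (z := t) (lexx _) (ltW (lt_trans xc ct)) xc ct.
  by rewrite g2 gc !mulr0 add0r pmulr_rgt0// subr_gt0.
have F1p t : x2 < t -> t < X -> 0 < F1 x2 v m t.
  move=> xt tX; have [tc|ct] := leP t c.
    rewrite -[ltLHS](Fl1_q p s 1 1 x2 v m).
    apply: (derive_increasing (derive_on_sub (lexx _) (ltW tX) dF1)) => // r /andP[xr rt].
    have r0 := lt_trans x2_gt0 xr; have rX := lt_trans rt tX.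
    by rewrite F2_pos ?l// gneg// (lt_le_trans rt).
  rewrite -(T_F1 x2_gt0 xX).
  apply: (derive_decreasing (derive_on_sub (ltW xt) (lexx _) dF1)) => // r /andP[tr rX].
  have r0 := lt_trans x2_gt0 (lt_trans xt tr).
  by rewrite F2_neg ?l// gpos// (lt_trans ct).
rewrite /Tf -[ltLHS](Fl_q p s 1 1 x2 v m).
by apply: (derive_increasing dF) => // t /andP[xt tX]; exact: F1p.
Qed.

(** On the concave branch the line crosses h once, from below, so F1 stays negative on (q, x2). *)
Lemma T_lt0 q : x1 <= q -> q < x2 -> Tf q x2 < 0.
Proof.
move=> xq qX; have q0 := lt_le_trans x1_gt0 xq.
have [c /andP[xc cX] gc] := T_root q0 qX.
have [dF dF1] := T_C2 q0 qX.
have m0 := mr_h_gt0 q0 qX; have lX := T_line_gt0 q0 qX.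
set v := h q in gc dF dF1 m0 lX *; set m := mr q v x2 in gc dF dF1 m0 lX *.
have g2 : gap q v m q = 0 by exact: T_gap_q.
have l t : t < x2 -> 0 < v - m * (t - q) by move=> tX; apply: (line_ge m0 lX); exact: ltW.
have gpos t : q < t -> t < c -> 0 < gap q v m t.
  move=> xt tc; have := gap_ccv q v m (x := q) (y := t) (z := c).
  rewrite g2 gc !mulr0 addr0 pmulr_rgt0 ?subr_gt0// => H; apply: H => //.
    by rewrite xq ltW.
  by rewrite (ltW cX) (le_trans xq)// ltW.
have gneg t : c < t -> t <= x2 -> gap q v m t < 0.
  move=> ct tx; have := gap_ccv q v m (x := q) (y := c) (z := t).
  rewrite g2 gc !mulr0 add0r pmulr_rlt0 ?subr_gt0// => H; apply: H => //.
    by rewrite xq ltW.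
  by rewrite tx (le_trans xq)// ltW// (lt_trans xc).
have F1n t : q < t -> t < x2 -> F1 q v m t < 0.
  move=> xt tX; have [tc|ct] := leP t c.
    rewrite -[ltRHS](Fl1_q p s 1 1 q v m).
    apply: (derive_decreasing (derive_on_sub (lexx _) (ltW tX) dF1)) => // r /andP[xr rt].
    have r0 := lt_trans q0 xr; have rX := lt_trans rt tX.
    by rewrite F2_neg ?l// gpos// (lt_le_trans rt).
  rewrite -(T_F1 q0 qX).
  apply: (derive_increasing (derive_on_sub (ltW xt) (lexx _) dF1)) => // r /andP[tr rX].
  have r0 := lt_trans q0 (lt_trans xt tr).
  by rewrite F2_pos ?l// gneg// ?(lt_trans ct)// ltW.
rewrite /Tf -[ltRHS](Fl_q p s 1 1 q v m).
by apply: (derive_decreasing dF) => // t /andP[xt tX]; exact: F1n.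
Qed.

(** Suppose that the defect at X is nonnegative for the line adapted to X. It cannot be
    steeper than the line fitting [q, X'], whose defect is nonpositive. Being flatter, it
    makes the gap positive beyond X for both lines, and then F1 of the fitting line could
    not vanish at X'. *)
Lemma T_monotone q X X' : x1 <= q -> q < x2 -> x2 <= X -> X < X' -> Tf q X' = 0 -> Tf q X < 0.
Proof.
move=> xq qx xX XX' T'; have q0 := lt_le_trans x1_gt0 xq.
have qX := lt_le_trans qx xX; have qX' := lt_trans qX XX'.
have X_gt0 := lt_trans q0 qX.
rewrite ltNge; apply/negP => TX.
have m0 := mr_h_gt0 q0 qX; have lX := T_line_gt0 q0 qX; have F1X := T_F1 q0 qX.
have m0' := mr_h_gt0 q0 qX'; have lX' := T_line_gt0 q0 qX'; have F1X' := T_F1 q0 qX'.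
have v0 := hx_gt0 p_gt2 ps c0 c0 c01 q0.
rewrite /Tf in T' TX; set v := h q in TX T' v0 m0 lX F1X m0' lX' F1X' *.
set m := mr q v X in TX m0 lX F1X *; set m' := mr q v X' in T' m0' lX' F1X' *.
have gq k : gap q v k q = 0 by rewrite gap_qq subrr.
have lX'' : 0 < v - m' * (X - q) by apply: (line_ge m0' lX'); exact: ltW.
have le0 : F q v m' X <= 0.
  by apply: (right_le0 (X := X')) => //; rewrite ?gq// ltW.
have [mm|mm] := ltP m' m.
  by have := lt_le_trans (F_slope qX v0 m0' mm lX) le0; rewrite ltNge TX.
have F1le : F1 q v m' X <= 0 by rewrite -F1X; exact: F1_slope.
have [|y0 [y [[qy0 y0y yX] [H0 H1]]]] := bump q0 qX v0 m0 lX (Fl_q _ _ _ _ _ _ _) (Fl1_q _ _ _ _ _ _ _) TX.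
- by rewrite F1X.
have gz z : X < z -> 0 < gap q v m' z.
  move=> Xz; have g : 0 < gap q v m z.
    by apply: (gap_high_gt xq qy0 y0y (lt_trans yX Xz)) => //; [rewrite gq|exact: ltW].
  apply: (lt_le_trans g); rewrite /gap.
  have : m * (z - q) <= m' * (z - q) by rewrite ler_pM2r// subr_gt0 (lt_trans qX).
  by lra.
have [_ dF1'] := @F_right_C2 q v m' X X' v0 m0' lX'.
have : F1 q v m' X' < F1 q v m' X.
  apply: (derive_decreasing dF1') => // t /andP[Xt tX'].
  have t0 := lt_trans X_gt0 Xt.
  have lt : 0 < v - m' * (t - q) by apply: (line_ge m0' lX'); exact: ltW.
  by rewrite F2_neg// gz.
by rewrite F1X' ltNge F1le.
Qed.

(** Tf is negative at xb and positive at x2. *)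
Lemma T_zero_exists X : x2 < X -> Tf xb X < 0 ->
  exists2 q, xb < q < x2 & Tf q X = 0.
Proof.
move=> xX Tb.
have cT q : xb <= q -> q <= x2 -> {for q, continuous (Tf ^~ X)}.
  move=> bq qx; have q0 := lt_le_trans xb_gt0 bq; have qX := le_lt_trans qx xX.
  have ch := hx_continuous q0; have cid : {for q, continuous (fun x : R => x)} := deriv_continuous (deriv_id q).
  have v0 := hx_gt0 p_gt2 ps c0 c0 c01 q0.
  have cX : {for q, continuous (fun _ : R => X)} by exact: cst_continuous.
  apply: (@Fl_continuous R R p s _ (fun=> 1) (fun=> 1) _ _ (fun x => x) h (fun x => mr x (h x) X) (fun=> X)) => //.
  - by apply: (@mr_continuous (fun x => x) h (fun=> X)) => //; exact: ltW.
  - exact: mr_h_gt0.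
  - exact: T_line_gt0.
have [||q] := @IVT R (Tf ^~ X) xb x2 0 (ltW xb2).
- apply: continuous_in_subspaceT => q /[!inE]/=; rewrite in_itv/= => /andP[bq qx].
  exact: cT.
- by rewrite ge_min (ltW Tb) le_max (ltW (T_gt0 xX)) orbT.
rewrite in_itv/= => /andP[bq qx] Tq; exists q => //.
rewrite !lt_neqAle bq qx !andbT; apply/andP; split; apply/eqP => E.
  by move: Tb; rewrite E Tq ltxx.
by have := T_gt0 xX; rewrite -E Tq ltxx.
Qed.

(** A slope smaller than w q would put the line above h on all of (q, x2), and the defect
    would become positive. *)
Lemma T_zero_slope q X : x1 <= q -> q < x2 -> x2 < X -> Tf q X = 0 ->
  w q <= mr q (h q) X.
Proof.
move=> xq qx xX TX; have q0 := lt_le_trans x1_gt0 xq; have qX := lt_trans qx xX.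
have m0 := mr_h_gt0 q0 qX; have lX := T_line_gt0 q0 qX; have F1X := T_F1 q0 qX.
have v0 := hx_gt0 p_gt2 ps c0 c0 c01 q0.
have [dF dF1] := T_C2 q0 qX.
rewrite /Tf in TX; set v := h q in TX v0 m0 lX F1X dF dF1 *.
set m := mr q v X in TX m0 lX F1X dF dF1 *.
have gq : gap q v m q = 0 by rewrite gap_qq subrr.
rewrite leNgt; apply/negP => mw.
have gneg t : q < t -> t < x2 -> gap q v m t < 0.
  move=> qt tx; rewrite -gq; apply: (@derive_decreasing R (gap q v m) (fun x => m - w x) q x2) => //; last exact: ltW.
    by move=> x qx' _; apply: deriv_gap; exact: lt_le_trans qx'.
  move=> r /andP[qr rx]; rewrite subr_lt0 (lt_trans mw)//.
  by apply: w_increasing => //; exact: ltW.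
have F2p t : q < t < x2 -> 0 < F2 q v m t.
  move=> /andP[qt tx]; have t0 := lt_trans q0 qt.
  have lt : 0 < v - m * (t - q) by apply: (line_ge m0 lX); exact: ltW (lt_trans tx xX).
  by rewrite F2_pos// gneg.
have F1p t : q < t < x2 -> 0 < F1 q v m t.
  move=> /andP[qt tx]; rewrite -[ltLHS](Fl1_q p s 1 1 q v m).
  by apply: (derive_increasing (derive_on_sub (lexx _) (ltW xX) dF1) F2p) => //; exact: ltW.
have : F q v m q < F q v m x2.
  exact: (derive_increasing (derive_on_sub (lexx _) (ltW xX) dF) F1p).
rewrite Fl_q ltNge => /negP; apply.
by apply: (right_le0 (X := X)) => //; rewrite ?gq// ltW.
Qed.

(** By T_monotone a zero of Tf xb forces negative values before it, so that Tf xb changes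
    sign only once. *)
Lemma T_threshold X' : x2 < X' -> 0 < Tf xb X' ->
  exists2 b, x2 < b < X' & (forall X, x2 <= X -> X < b -> Tf xb X < 0) /\
    (forall X, b <= X -> X <= X' -> 0 <= Tf xb X).
Proof.
move=> xX TX'.
have cT X : x2 <= X -> {for X, continuous (Tf xb)}.
  move=> xX''; have bX := lt_le_trans xb2 xX''.
  have cid : {for X, continuous (fun x : R => x)} := deriv_continuous (deriv_id X).
  have v0 := hx_gt0 p_gt2 ps c0 c0 c01 xb_gt0.
  have cb : {for X, continuous (fun _ : R => xb)} by exact: cst_continuous.
  have ch : {for X, continuous (fun _ : R => h xb)} by exact: cst_continuous.
  apply: (@Fl_continuous R R p s _ (fun=> 1) (fun=> 1) _ _ (fun=> xb) (fun=> h xb) (fun x => mr xb (h xb) x) (fun x => x)) => //.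
  - by apply: (@mr_continuous (fun=> xb) (fun=> h xb) (fun x => x)); rewrite ?(ltW xb_gt0).
  - exact: (mr_h_gt0 xb_gt0 bX).
  - exact: (T_line_gt0 xb_gt0 bX).
have Tx2 := T_lt0 (ltW x1b) xb2.
have [|||b /andP[xb' bX'] [Tb _]] := @first_exit R (fun X => - Tf xb X) x2 X' (ltW xX).
- by move=> X xX'' _; apply: continuousN; exact: cT.
- by rewrite oppr_ge0 ltW.
- by rewrite oppr_lt0.
have {}Tb : Tf xb b = 0 by apply/eqP; rewrite -oppr_eq0 Tb.
have x2b : x2 < b.
  by rewrite lt_neqAle xb' andbT; apply/eqP => E; move: Tx2; rewrite E Tb ltxx.
exists b; first by rewrite x2b.
split.
  by move=> X xX'' Xb; exact: (T_monotone (ltW x1b) xb2 xX'' Xb Tb).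
move=> X bX XX'; rewrite leNgt; apply/negP => TX.
have [|||b' /andP[Xb' b'X'] [Tb' _]] := @first_exit R (fun X => - Tf xb X) X X' XX'.
- by move=> Y XY _; apply: continuousN; apply: cT; apply: le_trans XY; apply: le_trans bX.
- by rewrite oppr_ge0 ltW.
- by rewrite oppr_lt0.
have {}Tb' : Tf xb b' = 0 by apply/eqP; rewrite -oppr_eq0 Tb'.
have bb' : b < b'.
  rewrite lt_neqAle (le_trans bX)// andbT; apply/eqP => E.
  have EX : X = b by apply/le_anti; rewrite bX andbT E.
  by move: TX; rewrite EX Tb ltxx.
by have := T_monotone (ltW x1b) xb2 xb' bb' Tb'; rewrite Tb ltxx.
Qed.

(** * The touching fit *)

Section Touching.
Variables (Xt qc : R).
Hypotheses (x2_Xt : x2 < Xt) (qc_gt0 : 0 < qc) (qc_Xt : qc < Xt).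
Local Notation vl := (vf Xt).
Local Notation ml := (mf Xt).
Hypotheses (F_touch : F 0 vl ml qc = 0)
  (F_Xt_le0 : forall x, 0 <= x -> x <= Xt -> F 0 vl ml x <= 0).

Let Xt_gt0 : 0 < Xt. Proof. exact: (lt_trans x2_gt0 x2_Xt). Qed.
Let ft := fitP Xt_gt0.
Let ml0 : 0 < ml. Proof. by case: ft. Qed.
Let ll0 : 0 < vl - ml * Xt. Proof. by case: ft. Qed.
Let vl0 : 0 < vl. Proof. exact: fit_v ft. Qed.
Let F1Xt : F1 0 vl ml Xt = 0. Proof. by case: ft. Qed.
Let FXt : F 0 vl ml Xt = 0. Proof. by case: ft. Qed.
Let dFl : derive_on (F 0 vl ml) (F1 0 vl ml) 0 Xt. Proof. by case: (fit_C2 Xt_gt0 ft). Qed.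
Let dFl1 : derive_on (F1 0 vl ml) (F2 0 vl ml) 0 Xt. Proof. by case: (fit_C2 Xt_gt0 ft). Qed.
Let l_gt0 x : x <= Xt -> 0 < vl - ml * (x - 0). Proof. exact: line0_ge. Qed.

(** An interior zero of the nonpositive defect is a maximum. *)
Lemma touch_F1 x : 0 < x -> x < Xt -> F 0 vl ml x = 0 -> F1 0 vl ml x = 0.
Proof.
move=> x0 xX Fx.
have dx : is_derive x 1 (F 0 vl ml) (F1 0 vl ml x) by apply: dFl; exact: ltW.
have : is_derive x 1 (F 0 vl ml) 0.
  apply: (@derive1_at_max R (F 0 vl ml) 0 Xt x (ltW Xt_gt0)).
  - move=> t /[!in_itv]/= /andP[/ltW t0 /ltW tX]; have [] := dFl t0 tX; done.
  - by rewrite in_itv/= x0.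
  - by move=> t /[!in_itv]/= /andP[/ltW t0 /ltW tX]; rewrite Fx F_Xt_le0.
by move=> [_ e]; case: dx => _ <-.
Qed.

(** Second-order condition at an interior maximum of the defect. *)
Lemma touch_gap x : 0 < x -> x < Xt -> F 0 vl ml x = 0 -> 0 <= gap 0 vl ml x.
Proof.
move=> x0 xX Fx; rewrite leNgt; apply/negP => gx.
have F1x := touch_F1 x0 xX Fx.
have cg : {for x, continuous (gap 0 vl ml)} := deriv_continuous (deriv_gap 0 vl ml x0).
have hg : 0 < - gap 0 vl ml x by rewrite oppr_gt0.
have [e e0 he] : exists2 e, 0 < e & forall y, `|x - y| < e -> gap 0 vl ml y < 0.
  move: cg => /cvgrPdist_lt /(_ _ hg) /nbhs_ballP[e /= e0 he]; exists e => // y hy.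
  by have := he y hy; rewrite /= ltr_norml => /andP[+ _]; lra.
pose z := Num.min Xt (x + e / 2).
have xz : x < z by rewrite lt_min xX/=; lra.
have zX : z <= Xt by rewrite ge_min lexx.
have ze : z <= x + e / 2 by rewrite ge_min lexx orbT.
have F2p t : x < t < z -> 0 < F2 0 vl ml t.
  move=> /andP[xt tz]; rewrite F2_pos; [|exact: lt_trans xt|by apply: l_gt0; lra].
  by apply: he; rewrite distrC gtr0_norm ?subr_gt0//; lra.
have F1p t : x < t < z -> 0 < F1 0 vl ml t.
  move=> /andP[xt tz]; rewrite -[ltLHS]F1x.
  by apply: (derive_increasing (derive_on_sub (ltW x0) zX dFl1) F2p) => //; exact: ltW.
have : F 0 vl ml x < F 0 vl ml z.
  exact: (derive_increasing (derive_on_sub (ltW x0) zX dFl) F1p).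
by rewrite Fx ltNge F_Xt_le0// ltW// (lt_trans x0).
Qed.

Let F1c : F1 0 vl ml qc = 0. Proof. exact: touch_F1. Qed.
Let gc : 0 <= gap 0 vl ml qc. Proof. exact: touch_gap. Qed.

Lemma touch_fit q : 0 < q -> q < Xt -> F 0 vl ml q = 0 -> vl = vf q /\ ml = mf q.
Proof.
move=> q0 qX Fq; apply: (left_fit_unique p_gt2 ps c0 c0 c01 q0).
split => //; last exact: touch_F1.
by have := l_gt0 (ltW qX); rewrite subr0.
Qed.

Lemma touch_dip q q' : 0 < q -> q < q' -> q' <= Xt -> F 0 vl ml q = 0 -> F 0 vl ml q' = 0 ->
  exists2 t, q < t < q' & gap 0 vl ml t < 0.
Proof.
move=> q0 qq qX Fq Fq'; apply: dip => //.
- exact: l_gt0.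
- by move=> x qx xq; apply: F_Xt_le0; [exact: ltW (lt_le_trans q0 qx)|exact: le_trans qX].
- by apply: touch_F1 => //; exact: lt_le_trans qX.
move: qX; rewrite le_eqVlt => /orP[/eqP ->//|qX]; apply: touch_F1 => //.
exact: lt_trans qq.
Qed.

Lemma touch_before : exists2 b, 0 < b < qc & gap 0 vl ml b < 0.
Proof.
by apply: gap_dip => //; have := l_gt0 (ltW qc_Xt); rewrite subr0.
Qed.

(** At a contact point qc the touching line is the fit on [0, qc]. For qc in (xb, x2] that fit
    overshoots h, and at xb it overshoots just after, which makes the defect positive.
    For qc > x2, h would be above the line on [x2, qc), and comparison with the fit on
    [0, x2] is contradictory. *)
Lemma touch_lt_xb : qc < xb.
Proof.
rewrite ltNge; apply/negP => bq.
have [ev em] := touch_fit qc_gt0 qc_Xt F_touch.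
move: bq; rewrite le_eqVlt => /orP[/eqP bq|bq].
  have F2p t : xb < t < x2 -> 0 < F2 0 vl ml t.
    move=> /andP[bt tx]; rewrite F2_pos; [|exact: lt_trans bt|by apply: l_gt0; exact: ltW (lt_trans tx _)].
    by rewrite ev em -bq gap_b_after// ltW.
  have F1p t : xb < t < x2 -> 0 < F1 0 vl ml t.
    move=> /andP[bt tx]; rewrite -[ltLHS]F1c -bq.
    by apply: (derive_increasing (derive_on_sub (ltW xb_gt0) (ltW x2_Xt) dFl1) F2p) => //; exact: ltW.
  have : F 0 vl ml xb < F 0 vl ml x2.
    exact: (derive_increasing (derive_on_sub (ltW xb_gt0) (ltW x2_Xt) dFl) F1p).
  by rewrite {1}bq F_touch ltNge F_Xt_le0// ltW.
have [qx|xq] := leP qc x2.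
  have := egap_after bq qx; rewrite -(gap_fit qc_gt0 (fitP qc_gt0)) -ev -em.
  by rewrite ltNge gc.
have [t /andP[qt tX] gt] := touch_dip qc_gt0 qc_Xt (lexx _) F_touch FXt.
have gpos x : x2 <= x -> x < qc -> 0 < gap 0 vl ml x.
  move=> xx xqc; have := gap_cvx2 0 vl ml (x := x) (y := qc) (z := t) xx (ltW (lt_trans xq qt)) xqc qt => H.
  have h1 : 0 <= (t - x) * gap 0 vl ml qc by rewrite mulr_ge0// subr_ge0 ltW// (lt_trans xqc).
  have h2 : (qc - x) * gap 0 vl ml t < 0 by rewrite pmulr_rlt0// subr_gt0.
  have : 0 < (t - qc) * gap 0 vl ml x by lra.
  by rewrite pmulr_rgt0// subr_gt0.
have F1x2 : 0 < F1 0 vl ml x2.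
  rewrite -[ltLHS]F1c.
  apply: (derive_decreasing (derive_on_sub (ltW x2_gt0) (ltW qc_Xt) dFl1)) => // r /andP[xr rq].
  have r0 := lt_trans x2_gt0 xr.
  by rewrite F2_neg//; [apply: gpos => //; exact: ltW|apply: l_gt0; exact: ltW (lt_trans rq qc_Xt)].
have f2 := fitP x2_gt0.
have [m20 l20 F2x F12x] := f2; have v20 := fit_v x2_gt0 f2.
have lx2 : 0 < vl - ml * x2 by have := l_gt0 (ltW x2_Xt); rewrite subr0.
have [C2K K0 K10 pos neg] := F0_compare vl0 ml0 lx2 v20 m20 l20.
have g2 := gpos x2 (lexx _) xq; rewrite /gap subr0 in g2.
have e2 := egap_x2; rewrite -(gap_fit x2_gt0 f2) /gap subr0 in e2.
have [|||] := affine_sign_contact x2_gt0 C2K K0 K10 pos neg.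
- by lra.
- by rewrite F2x subr0 F_Xt_le0// ltW.
- by rewrite F12x subr0 ltW.
by lra.
Qed.

(** The fit on [0, q] has nonpositive defect at qc and a zero defect at q, while the touching
    line has a zero defect at qc and a nonpositive one at q: the lines cross exactly once. *)
Lemma touch_cross q : qc < q -> q <= xb ->
  [/\ vl - ml * q < df q, mf q < ml & F1 0 vl ml q < 0].
Proof.
move=> cq qb; have q0 := lt_trans qc_gt0 cq; have qx2 := le_lt_trans qb xb2.
have qX := lt_trans qx2 x2_Xt.
have fq := fitP q0; have [m0 l0 Fq F1q] := fq; have v0 := fit_v q0 fq.
have lq : 0 < vl - ml * q by have := l_gt0 (ltW qX); rewrite subr0.
have [C2K K0 K10 pos neg] := F0_compare v0 m0 l0 vl0 ml0 lq.
have eq_ : 0 <= gap 0 (vf q) (mf q) q by rewrite (gap_fit q0 fq) egap_ge0.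
have [||||] := affine_sign_cross q0 C2K K0 K10 pos neg (c := qc).
- by rewrite qc_gt0.
- rewrite F_touch subr0; apply: (fit_le0 _ fq) => //; [by rewrite q0 ltW|exact: ltW..].
- by rewrite Fq sub0r oppr_ge0 F_Xt_le0// ltW.
- have [e1|] := eqVneq (vf q - vl) 0; last by left.
  have [e2|] := eqVneq (vf q - vl + (ml - mf q) * q) 0; last by right.
  have ev : vf q = vl by lra.
  have em : mf q = ml.
    have : (ml - mf q) * q = 0 by lra.
    by move=> /eqP; rewrite mulf_eq0 (gt_eqF q0) orbF subr_eq0 => /eqP.
  rewrite ev em in eq_ Fq.
  have [b /andP[b0 bq] gb] := touch_before.
  have [t /andP[ct tq] gt] := touch_dip qc_gt0 cq (ltW qX) F_touch Fq.
  by have := gap_low b0 bq ct tq (ltW qx2) gb gc gt; rewrite ltNge eq_.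
rewrite F1q sub0r oppr_gt0 => d1 d2 F1lq; split => //.
  by have := vmfit p s 1 1 q0; lra.
have h1 : 0 < (ml - mf q) * q by lra.
by rewrite -subr_gt0 -(pmulr_lgt0 _ q0).
Qed.

Lemma touch_line_gt0 q x : qc < q -> q <= xb -> q <= x -> x <= Xt ->
  vl - ml * x < vf q - mf q * x.
Proof.
move=> cq qb qx xX; have q0 := lt_trans qc_gt0 cq.
have [h1 h2 _] := touch_cross cq qb; have e := vmfit p s 1 1 q0.
have : mf q * (x - q) <= ml * (x - q) by rewrite ler_wpM2r ?subr_ge0// ltW.
lra.
Qed.

(** If the gap of the fit on [0, q] turns from negative to positive inside [q, X], it stays
    nonnegative, so F1 does not increase after X. But the fit runs above the touching
    line, so F1 exceeds that of the touching line, which vanishes at Xt. *)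
Lemma touch_turn q X y0 y : qc < q -> q <= xb -> q < y0 -> y0 < y -> y < X -> X < Xt ->
  gap 0 (vf q) (mf q) y0 < 0 -> 0 <= gap 0 (vf q) (mf q) y -> 0 < F1 0 (vf q) (mf q) X.
Proof.
move=> cq qb qy0 y0y yX XX g0 g1; rewrite ltNge; apply/negP => F1X.
have q0 := lt_trans qc_gt0 cq; have qX := lt_trans qy0 (lt_trans y0y yX).
have fq := fitP q0; have [m0 l0 Fq F1q] := fq; have v0 := fit_v q0 fq.
have X_gt0 := lt_trans q0 qX; have qXt := lt_trans qX XX.
have eq_ : 0 <= gap 0 (vf q) (mf q) q by rewrite (gap_fit q0 fq) egap_ge0.
have [b /andP[b0 bq] gb] := gap_dip v0 m0 q0 l0 F1q.
have lX : 0 < vf q - mf q * Xt by apply: (lt_trans ll0); exact: touch_line_gt0 (ltW qXt) (lexx _).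
have [_ _ F1lq] := touch_cross cq qb.
have [[dK dK1] _ _ pos _] := F0_compare v0 m0 lX vl0 ml0 ll0.
have [_ dL1] := F0_C2 v0 m0 lX.
have : F1 0 (vf q) (mf q) q - F1 0 vl ml q <= F1 0 (vf q) (mf q) Xt - F1 0 vl ml Xt.
  apply: (derive_nondecreasing (derive_on_sub (ltW q0) (lexx Xt) dK1)) => //; last exact: ltW.
  move=> t /andP[qt tX]; apply/ltW/pos; first by rewrite (lt_trans q0).
  by have := touch_line_gt0 cq qb (ltW qt) (ltW tX); lra.
have : F1 0 (vf q) (mf q) Xt <= F1 0 (vf q) (mf q) X.
  apply: (derive_nonincreasing (derive_on_sub (ltW X_gt0) (lexx Xt) dL1)) => //; last exact: ltW.
  move=> t /andP[Xt' tX]; have t0 := lt_trans X_gt0 Xt'.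
  rewrite F2_le0//; last by apply: (line0_ge (d := Xt)) => //; exact: ltW.
  by apply: (gap_all b0 bq qy0 y0y (ltW (lt_trans yX Xt')) gb eq_ g0 g1).
rewrite F1q F1Xt; lra.
Qed.

(** At xb the line runs above the touching one and their first-order defects coincide at Xt,
    so the difference of the defects increases on [xb, Xt] from a nonnegative value. *)
Lemma touch_T_gt0 : 0 < Tf xb Xt.
Proof.
have bX := lt_trans xb2 x2_Xt; have cb := touch_lt_xb.
have [h1 h2 F1l] := touch_cross cb (lexx _).
have hb : h xb = df xb by have := egap_xb; rewrite /egap; lra.
have lR := T_line_gt0 xb_gt0 bX; have F1R := T_F1 xb_gt0 bX.
have m0 := mr_h_gt0 xb_gt0 bX; have v0 := hx_gt0 p_gt2 ps c0 c0 c01 xb_gt0.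
rewrite /Tf; set v := h xb in lR F1R m0 v0 hb *; set m := mr xb v Xt in lR F1R m0 *.
have [dR dR1] := @F_right_C2 xb v m xb Xt v0 m0 lR.
have dK := derive_onB dR (derive_on_sub (ltW xb_gt0) (lexx Xt) dFl).
have dK1 := derive_onB dR1 (derive_on_sub (ltW xb_gt0) (lexx Xt) dFl1).
have lRx x : x < Xt -> 0 < v - m * (x - xb) by move=> xX; apply: (line_ge m0 lR); exact: ltW.
have K2p x : x < Xt -> vl - ml * x < v - m * (x - xb) -> 0 < F2 xb v m x - F2 0 vl ml x.
  by move=> xX H; rewrite subr_gt0 F2_lt ?subr0 ?lRx//; have := l_gt0 (ltW xX); rewrite subr0.
have K2n x : x < Xt -> v - m * (x - xb) < vl - ml * x -> F2 xb v m x - F2 0 vl ml x < 0.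
  by move=> xX H; rewrite subr_lt0 F2_lt ?subr0 ?lRx//; have := l_gt0 (ltW xX); rewrite subr0.
have K1p t : xb < t < Xt -> 0 < F1 xb v m t - F1 0 vl ml t.
  move=> /andP[bt tX].
  have [dt|dt] := leP (vl - ml * t) (v - m * (t - xb)).
    have : F1 xb v m xb - F1 0 vl ml xb < F1 xb v m t - F1 0 vl ml t.
      apply: (derive_increasing (derive_on_sub (lexx _) (ltW tX) dK1)) => // r /andP[br rt].
      apply: K2p; first exact: lt_trans tX.
      have : 0 < (t - r) * (df xb - (vl - ml * xb)) by rewrite mulr_gt0 ?subr_gt0.
      have : 0 <= (r - xb) * ((v - m * (t - xb)) - (vl - ml * t)).
        by rewrite mulr_ge0 ?subr_ge0// ltW.
      rewrite -hb => e1 e2.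
      have : 0 < (t - xb) * ((v - m * (r - xb)) - (vl - ml * r)) by lra.
      by rewrite pmulr_rgt0 ?subr_gt0.
    by rewrite Fl1_q; lra.
  have : F1 xb v m Xt - F1 0 vl ml Xt < F1 xb v m t - F1 0 vl ml t.
    apply: (derive_decreasing (derive_on_sub (ltW bt) (lexx _) dK1)) => // r /andP[tr rX].
    apply: K2n => //.
    have : 0 < (r - t) * (df xb - (vl - ml * xb)) by rewrite mulr_gt0 ?subr_gt0.
    have : 0 < (r - xb) * ((vl - ml * t) - (v - m * (t - xb))).
      by rewrite mulr_gt0 ?subr_gt0// (lt_trans bt).
    rewrite -hb => e1 e2.
    have : 0 < (t - xb) * ((vl - ml * r) - (v - m * (r - xb))) by lra.
    by rewrite pmulr_rgt0 ?subr_gt0.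
  by rewrite F1R F1Xt; lra.
have : F xb v m xb - F 0 vl ml xb < F xb v m Xt - F 0 vl ml Xt.
  exact: (derive_increasing dK K1p).
have : F 0 vl ml xb <= 0 by rewrite F_Xt_le0// ltW.
by rewrite Fl_q FXt; lra.
Qed.

(** Where the fit on [0, t] is the steeper line, its first-order defect at X is nonpositive.
    Taking the maximum of the slopes leaves a function of t to which the intermediate
    value theorem applies on [qc, xb]. *)
Definition steeper t X := Num.max (mf t) (mr t (df t) X).

Lemma fit_base t : 0 < t -> vf t - mf t * (t - 0) = df t.
Proof. by move=> t0; rewrite subr0 vmfit. Qed.

Lemma fit_rebase t x : 0 < t -> 0 < vf t - mf t * x ->
  F t (df t) (mf t) x = F 0 (vf t) (mf t) x /\ F1 t (df t) (mf t) x = F1 0 (vf t) (mf t) x.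
Proof.
move=> t0 lx; have f := fitP t0; have v0 := fit_v t0 f; have [m0 l0 Ft F1t] := f.
rewrite -[t in _ - _ * t]subr0 in l0; rewrite -[x in _ - _ * x]subr0 in lx.
have := Fl_rebase v0 m0 l0 lx Ft F1t.
by rewrite fit_base.
Qed.

Lemma gap_rebase t x : 0 < t -> gap t (df t) (mf t) x = gap 0 (vf t) (mf t) x.
Proof. by move=> t0; rewrite /gap -(vmfit p s 1 1 t0); ring. Qed.

Lemma fit_line_gt0 t X : qc <= t -> t <= xb -> t <= X -> X <= Xt -> 0 < vf t - mf t * X.
Proof.
rewrite le_eqVlt => /orP[/eqP <-|ct] tb tX XX.
  by have [<- <-] := touch_fit qc_gt0 qc_Xt F_touch; have := l_gt0 XX; rewrite subr0.
apply: lt_trans (touch_line_gt0 ct tb tX XX).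
by have := l_gt0 XX; rewrite subr0.
Qed.

Lemma steeper_line_gt0 t X : qc <= t -> t <= xb -> t < X -> X <= Xt ->
  0 < df t - steeper t X * (X - t).
Proof.
move=> ct tb tX XX; have t0 := lt_le_trans qc_gt0 ct.
have d0 := dfit_gt0 p_gt2 ps c0 c0 c01 t0.
rewrite /steeper; have [_|/ltW mm] := leP (mr t (df t) X) (mf t); last first.
  by rewrite mr_line// rr_gt0// ltW.
have := fit_line_gt0 ct tb (ltW tX) XX; have := vmfit p s 1 1 t0.
lra.
Qed.

Lemma steeper_gt0 t X : 0 < t -> 0 < steeper t X.
Proof. by move=> t0; rewrite lt_max; case: (fitP t0) => ->. Qed.

(** A second contact point would produce the sign pattern - + - + - of the gap. *)
Lemma touch_strict X : qc < X -> X < Xt -> F 0 vl ml X < 0.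
Proof.
move=> cX XX; have X_gt0 := lt_trans qc_gt0 cX.
rewrite lt_neqAle F_Xt_le0 ?(ltW XX) ?(ltW X_gt0)// andbT; apply/eqP => FX.
have [b /andP[b0 bq] gb] := touch_before.
have [t /andP[ct tX] gt] := touch_dip qc_gt0 cX (ltW XX) F_touch FX.
have [t' /andP[Xt' tX'] gt'] := touch_dip X_gt0 XX (lexx _) FX FXt.
have := gap_all b0 bq ct tX (ltW Xt') gb gc gt (touch_gap X_gt0 XX FX).
by rewrite leNgt gt'.
Qed.

(** At qc the line is at least as steep as the touching line and has negative defect; at xb the
    adapted line is the steeper one and its defect is Tf xb X. At a root the fit cannot be
    the steeper line, by the contradiction of touch_turn. *)
Lemma steeper_root X : x2 < X -> X < Xt -> 0 <= Tf xb X ->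
  exists2 q, qc < q <= xb & mf q < mr q (df q) X /\ F q (df q) (mr q (df q) X) X = 0.
Proof.
move=> xX XX TX; have bX := lt_trans xb2 xX; have cb := touch_lt_xb.
have hb : h xb = df xb by have := egap_xb; rewrite /egap; lra.
have F1L t : qc < t -> t <= xb -> mr t (df t) X <= mf t -> F1 t (df t) (mf t) X <= 0.
  move=> ct tb mm; have t0 := lt_trans qc_gt0 ct; have tX := le_lt_trans tb bX.
  have d0 := dfit_gt0 p_gt2 ps c0 c0 c01 t0.
  have lL := fit_line_gt0 (ltW ct) tb (ltW tX) (ltW XX).
  rewrite -(mr_F1 (ltW t0) tX d0); apply: F1_slope => //.
  by have := vmfit p s 1 1 t0; lra.
have mr_b : mf xb < mr xb (df xb) X.
  rewrite ltNge; apply/negP => mm; have := F1L _ cb (lexx _) mm.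
  have lL := fit_line_gt0 (ltW cb) (lexx _) (ltW bX) (ltW XX).
  have [_ ->] := fit_rebase xb_gt0 lL => F1X.
  have [_ dF1] := F0_C2 vb0 mb0 lL.
  have x2X : 0 < F1 0 vb mb x2.
    have [_ _ _ F1b] := fb; rewrite -[ltLHS]F1b.
    apply: (derive_increasing (derive_on_sub (ltW xb_gt0) (ltW xX) dF1)) => // r /andP[br rx].
    rewrite F2_pos; [|exact: lt_trans br|].
      by rewrite gap_b_after// ltW.
    by apply: (line0_ge (d := X)) => //; exact: ltW (lt_trans rx xX).
  have [|y /andP[xy yX] Fy] := derive_lt0 xX (derive_on_sub (ltW x2_gt0) (lexx X) dF1).
    exact: le_lt_trans x2X.
  have gy : 0 < gap 0 vb mb y.
    by rewrite -F2_neg//; [exact: lt_trans xy|apply: (line0_ge (d := X)) => //; exact: ltW].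
  have := touch_turn cb (lexx _) xb2 xy yX XX (gap_b_after xb2 (lexx _)) (ltW gy).
  by rewrite ltNge F1X.
pose G t := F t (df t) (steeper t X) X.
have Gqc : G qc < 0.
  have lL := fit_line_gt0 (lexx _) (ltW cb) (ltW (lt_trans cb bX)) (ltW XX).
  have [ev em] := touch_fit qc_gt0 qc_Xt F_touch.
  have FX := touch_strict (lt_trans cb bX) XX.
  have [e _] := fit_rebase qc_gt0 lL.
  rewrite /G; have [mm|mm] := leP (mr qc (df qc) X) (mf qc).
    by rewrite /steeper max_l// e -ev -em.
  have cX := lt_trans cb bX.
  apply: (lt_trans (y := F qc (df qc) (mf qc) X)); last by rewrite e -ev -em.
  apply: F_slope => //; first exact: (dfit_gt0 p_gt2 ps c0 c0 c01).
  - by case: (fitP qc_gt0).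
  - by rewrite /steeper max_r// ltW.
  - by apply: steeper_line_gt0 => //; exact: ltW.
have Gb : 0 <= G xb by rewrite /G /steeper (max_r (ltW mr_b)) -hb.
have cG t : qc <= t -> t <= xb -> {for t, continuous G}.
  move=> ct tb; have t0 := lt_le_trans qc_gt0 ct; have tX := le_lt_trans tb bX.
  have d0 := dfit_gt0 p_gt2 ps c0 c0 c01 t0.
  have cid : {for t, continuous (fun x : R => x)} := deriv_continuous (deriv_id t).
  have cX : {for t, continuous (fun _ : R => X)} by exact: cst_continuous.
  have cd := df_continuous t0.
  apply: (@Fl_continuous R R p s _ (fun=> 1) (fun=> 1) _ _ (fun x => x) df (fun x => steeper x X) (fun=> X)) => //.
  - apply: continuous_max; first exact: mf_continuous.
    by apply: (@mr_continuous (fun x => x) df (fun=> X)) => //; exact: ltW.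
  - exact: steeper_gt0.
  - by apply: steeper_line_gt0 => //; exact: ltW.
have [||q] := @IVT R G qc xb 0 (ltW cb).
- apply: continuous_in_subspaceT => q /[!inE]/=; rewrite in_itv/= => /andP[cq qb].
  exact: cG.
- by rewrite ge_min (ltW Gqc) le_max Gb orbT.
rewrite in_itv/= => /andP[cq qb] Gq.
have {}cq : qc < q.
  by rewrite lt_neqAle cq andbT; apply/eqP => E; move: Gqc; rewrite E Gq ltxx.
have q0 := lt_trans qc_gt0 cq; have qX := le_lt_trans qb bX.
exists q; first by rewrite cq.
have [mm|mm] := leP (mr q (df q) X) (mf q); last first.
  by split => //; rewrite -Gq /G /steeper max_r// ltW.
exfalso; have lL := fit_line_gt0 (ltW cq) qb (ltW qX) (ltW XX).
have [e1 e2] := fit_rebase q0 lL; have F1X := F1L q cq qb mm; rewrite e2 in F1X.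
have [m0 l0 Fq F1q] := fitP q0; have v0 := fit_v q0 (fitP q0).
have FX : F 0 (vf q) (mf q) X = 0 by rewrite -e1 -Gq /G /steeper max_l.
have [|||y0 [y [[qy0 y0y yX] [H0 H1]]]] := bump q0 qX v0 m0 (_ : 0 < vf q - mf q * (X - 0)) Fq F1q.
- by rewrite subr0.
- by rewrite FX.
- exact: F1X.
by have := touch_turn cq qb qy0 y0y yX XX H0 (ltW H1); rewrite ltNge F1X.
Qed.

(** The second piece has nonpositive defect: it is steeper than the fit on [0, q] through the
    same point, so it inherits the point before q where the line runs above h, and a
    positive defect would need one sign change too many. *)
Lemma two_step X : x2 < X -> X < Xt -> 0 <= Tf xb X ->
  exists q m, [/\ 0 < q <= xb, mf q < m, 0 < df q - m * (X - q),
      F q (df q) m X = 0 & F1 q (df q) m X = 0] /\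
    forall x, q <= x -> x <= X -> F q (df q) m x <= 0.
Proof.
move=> xX XX TX; have bX := lt_trans xb2 xX.
have [q /andP[cq qb] [mm FX]] := steeper_root xX XX TX.
have q0 := lt_trans qc_gt0 cq; have qX := le_lt_trans qb bX.
have d0 := dfit_gt0 p_gt2 ps c0 c0 c01 q0.
set m := mr q (df q) X in mm FX.
have lX : 0 < df q - m * (X - q) by rewrite mr_line// rr_gt0// ltW.
have F1X : F1 q (df q) m X = 0 by rewrite mr_F1// ltW.
have [m0 l0 Fq F1q] := fitP q0; have v0 := fit_v q0 (fitP q0).
have m0' := lt_trans m0 mm.
exists q, m; split; first by split => //; rewrite q0.
move=> x qx xX'; rewrite leNgt; apply/negP => Fx.
have l t : t < X -> 0 < df q - m * (t - q) by move=> tX; apply: (line_ge m0' lX); exact: ltW.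
have qx' : q < x by rewrite lt_neqAle qx andbT; apply/eqP => E; move: Fx; rewrite -E Fl_q ltxx.
have xX'' : x < X by rewrite lt_neqAle xX' andbT; apply/eqP => E; move: Fx; rewrite E FX ltxx.
have [|t1 [t2 [t3 [[t10 t12 t23 t3q] [H1 H2 H3]]]]] :=
  double_zeros_pos (@F_right_C2 q (df q) m q X d0 m0' lX) _ (Fl_q p s 1 1 q _ m) (Fl1_q p s 1 1 q _ m) FX F1X Fx.
  by rewrite qx'.
have t1_gt0 := lt_trans q0 t10; have t2_gt0 := lt_trans t1_gt0 t12; have t3_gt0 := lt_trans t2_gt0 t23.
have t2X := lt_trans t23 t3q; have t1X := lt_trans t12 t2X.
move: H1; rewrite F2_pos// ?l// => H1.
move: H2; rewrite F2_neg// ?l// => H2.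
move: H3; rewrite F2_pos// ?l// => H3.
have gq : 0 <= gap q (df q) m q by rewrite gap_qq; exact: egap_ge0.
have [b /andP[b0 bq] gb] := gap_dip v0 m0 q0 l0 F1q.
have gb' : gap q (df q) m b < 0.
  rewrite -(gap_rebase b q0) in gb; apply: le_lt_trans gb; rewrite /gap.
  have : mf q * (q - b) <= m * (q - b) by rewrite ler_pM2r ?subr_gt0// ltW.
  by lra.
by have := gap_all b0 bq t10 t12 (ltW t23) gb' gq H1 (ltW H2); rewrite leNgt H3.
Qed.

End Touching.
End Master.

(** * The polynomials S and Q and the quantity Psi *)

Section RootSigns.
Context {R : realType}.
Implicit Types (u v t l x : R).

Lemma quadratic_factor u v t l1 l2 x : l1 < l2 ->
  u * l1 ^+ 2 + v * l1 + t = 0 -> u * l2 ^+ 2 + v * l2 + t = 0 ->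
  u * x ^+ 2 + v * x + t = u * ((x - l1) * (x - l2)).
Proof.
move=> l12 e1 e2.
have e : u * (l1 + l2) + v = 0.
  have : (l2 - l1) * (u * (l1 + l2) + v) = 0.
    have -> : (l2 - l1) * (u * (l1 + l2) + v) =
      (u * l2 ^+ 2 + v * l2 + t) - (u * l1 ^+ 2 + v * l1 + t) by ring.
    by rewrite e1 e2 subrr.
  by move=> /eqP; rewrite mulf_eq0 gt_eqF ?subr_gt0//= => /eqP.
have -> : v = - (u * (l1 + l2)) by lra.
have -> : t = u * (l1 * l2).
  have -> : t = - (u * l1 ^+ 2 + v * l1) by lra.
  have -> : v = - (u * (l1 + l2)) by lra.
  by ring.
by ring.
Qed.

Variables (p s : nat).
Hypotheses (p_gt2 : (2 < p)%N) (ps : (p <= s)%N).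
Local Notation P := (p%:R : R).
Local Notation S := (s%:R : R).

Let P3 : 3 <= P. Proof. by rewrite (ler_nat R 3 p). Qed.
Let PS : P <= S. Proof. by rewrite ler_nat. Qed.

(** For s = p, Delta equals - (4 p^2 - 12 p + 7). *)
Lemma Delta_lt : 0 < Delta R p s -> (p < s)%N.
Proof.
rewrite ltn_neqAle ps andbT => D; apply/eqP => E; move: D.
rewrite /Delta -E => D; have := P3; nra.
Qed.

(** This coefficient equals Delta + (3 p - 5) s - 5 p + 7. *)
Lemma inflection_coef_gt0 : 0 < Delta R p s ->
  0 < (P - 2) * (P - 3) + (S - 2) * (S - 3) - 3 * (P - 2) * (S - 2).
Proof. by rewrite /Delta; have := P3; have := PS; nra. Qed.

Hypothesis D_gt0 : 0 < Delta R p s.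

(** At a root the positive quantity a0 (1 - l)^2 + a2 l^2 equals c l (1 - l), which places the
    root in (0, 1). *)
Lemma Spoly_signs l1 l2 : ordered_real_roots (Spoly p s) l1 l2 ->
  [/\ 0 < l1, l2 < 1, forall l, l < l1 \/ l2 < l -> 0 < Spoly p s l
    & forall l, l1 < l < l2 -> Spoly p s l < 0].
Proof.
move=> [l12 roots]; have c0 := inflection_coef_gt0 D_gt0.
have p3 := P3; have p_s := PS.
pose a0 := S ^+ 3 * (S - 1) ^+ 2 * (S - 2).
pose a2 := P ^+ 3 * (P - 1) ^+ 2 * (P - 2).
pose c := 2 * P * (P - 1) * S * (S - 1) *
  ((P - 2) * (P - 3) + (S - 2) * (S - 3) - 3 * (P - 2) * (S - 2)).
have a0p : 0 < a0 by rewrite !mulr_gt0// ?exprn_gt0//; lra.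
have a2p : 0 < a2 by rewrite !mulr_gt0// ?exprn_gt0//; lra.
have cp : 0 < c by rewrite !mulr_gt0//; lra.
have SE l : Spoly p s l = a0 * (1 - l) ^+ 2 + a2 * l ^+ 2 - c * l * (1 - l).
  by rewrite /Spoly /a0 /a2 /c.
have in01 l : Spoly p s l = 0 -> 0 < l < 1.
  rewrite SE => e; have pos : 0 < c * (l * (1 - l)).
    have h1 : 0 <= a0 * (1 - l) ^+ 2 by rewrite mulr_ge0 ?sqr_ge0// ltW.
    have h2 : 0 <= a2 * l ^+ 2 by rewrite mulr_ge0 ?sqr_ge0// ltW.
    have [l0|l0] := eqVneq l 0; first by move: e; rewrite l0; lra.
    have h3 : 0 < a2 * l ^+ 2 by rewrite mulr_gt0// exprn_even_gt0.
    lra.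
  by move: pos; rewrite pmulr_rgt0// => pos; apply/andP; split; nra.
have /in01/andP[l1p _] : Spoly p s l1 = 0 by apply/roots; left.
have /in01/andP[_ l2p] : Spoly p s l2 = 0 by apply/roots; right.
have SE2 l : Spoly p s l = (a0 + a2 + c) * l ^+ 2 + (- (2 * a0 + c)) * l + a0.
  by rewrite SE; ring.
have fac l : Spoly p s l = (a0 + a2 + c) * ((l - l1) * (l - l2)).
  rewrite SE2; apply: quadratic_factor => //; rewrite -SE2; apply/roots; [by left|by right].
have u0 : 0 < a0 + a2 + c by lra.
split=> // l; rewrite fac => H.
  by rewrite pmulr_rgt0//; case: H => H; nra.
by rewrite pmulr_rlt0//; case/andP: H => *; nra.
Qed.

(** The coefficients have signs + - +, so Q is positive on l <= 0. *)
Lemma Qpoly_signs l1 l2 : (p < s)%N -> ordered_real_roots (Qpoly p s) l1 l2 ->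
  0 < l1 /\ forall l, l < l1 -> 0 < Qpoly p s l.
Proof.
move=> lt_ps [l12 roots]; have p3 := P3.
have p_s : P + 1 <= S by rewrite natr1 ler_nat.
pose a := (S - P) ^+ 2 * (S ^+ 2 - 3 * S + 2 + P ^+ 2 + 3 * P * S - 3 * P).
pose b := S * (S - P) * (2 * S ^+ 2 - 6 * S + 4 - P ^+ 2 + 3 * P * S - 3 * P).
pose c := S ^+ 2 * (S - 1) * (S - 2).
have ap : 0 < a by rewrite mulr_gt0 ?exprn_gt0//; [lra|nra].
have bp : 0 < b by rewrite !mulr_gt0//; [lra|lra|nra].
have cp : 0 < c by rewrite !mulr_gt0// ?exprn_gt0//; lra.
have QE l : Qpoly p s l = a * l ^+ 2 + (- b) * l + c by rewrite /Qpoly mulNr.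
have Q1 : Qpoly p s l1 = 0 by apply/roots; left.
have Q2 : Qpoly p s l2 = 0 by apply/roots; right.
split.
  rewrite ltNge; apply/negP => l10; move: Q1; rewrite QE.
  have : 0 <= a * l1 ^+ 2 by rewrite mulr_ge0 ?sqr_ge0// ltW.
  have : 0 <= b * (- l1) by rewrite mulr_ge0 ?oppr_ge0// ltW.
  lra.
move=> l ll; rewrite QE (@quadratic_factor _ _ _ l1 l2) -?QE//.
rewrite pmulr_rgt0//; nra.
Qed.

End RootSigns.

Section Link.
Context {R : realType}.
Variables (p s : nat).
Hypotheses (p_gt2 : (2 < p)%N) (ps : (p < s)%N).
Implicit Types (l q v m x : R).

(** The roots of S in (0, 1) are the weights of the two inflection points of h, in reverse
    order since lam decreases. *)
Lemma inflections l1 l2 : 0 < Delta R p s -> ordered_real_roots (Spoly p s) l1 l2 ->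
  exists x1 x2 : R, [/\ 0 < x1, x1 < x2, lam p s x2 = l1 & lam p s x1 = l2] /\
    [/\ forall x, 0 < x < x1 -> 0 < form_at p s (1 : R) 1 x,
      forall x, x1 < x < x2 -> form_at p s (1 : R) 1 x < 0
    & forall x, x2 < x -> 0 < form_at p s (1 : R) 1 x].
Proof.
move=> D hS; have [l1_gt0 l2_lt1 Spos Sneg] := Spoly_signs p_gt2 (ltnW ps) D hS.
case: hS => l12 _.
have [|x2 x20 e2] := @lam_surj R p s ps l1; first by rewrite l1_gt0 (lt_trans l12).
have [|x1 x10 e1] := @lam_surj R p s ps l2; first by rewrite l2_lt1 (lt_trans l1_gt0).
have x12 : x1 < x2 by rewrite -(lam_lt ps x10 x20) e1 e2.
exists x1, x2; split => //; split => x.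
- move=> /andP[x0 xx]; have [-> _] := form_at_Spoly p_gt2 ps x0.
  by apply: Spos; right; rewrite -e1 lam_lt.
- move=> /andP[xx xx']; have x0 := lt_trans x10 xx.
  have [_ ->] := form_at_Spoly p_gt2 ps x0.
  by apply: Sneg; rewrite -e1 -e2 !lam_lt// xx xx'.
- move=> xx; have x0 := lt_trans x20 xx; have [-> _] := form_at_Spoly p_gt2 ps x0.
  by apply: Spos; left; rewrite -e2 lam_lt.
Qed.

Lemma derive1_mixture l : (mixture p s l)^`()%classic = Xi1 p s l (1 - l).
Proof.
by apply/funext => x; rewrite derive1E; have [_ <-] := deriv_Xi p s l (1 - l) x.
Qed.

Lemma derive2_mixture l : (mixture p s l)^`(2)%classic = Xi2 p s l (1 - l).
Proof.
apply/funext => x; rewrite derive1nS derive1n1 derive1_mixture derive1E.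
by have [_ <-] := deriv_Xi1 p s l (1 - l) x.
Qed.

Lemma Xi_at1 l : Xi p s l (1 - l) 1 = 1.
Proof. by rewrite /Xi !expr1n; ring. Qed.

Lemma Xi1_lt_Xi2 a b : 0 <= a -> 0 <= b -> 0 < a + b ->
  Xi1 p s a b 1 < Xi2 p s a b (1 : R).
Proof.
move=> a0 b0 ab0; rewrite -subr_gt0 /Xi1 /Xi2 !expr1n.
have -> : a * (p%:R * (p.-1%:R * 1)) + b * (s%:R * (s.-1%:R * 1)) -
  (a * (p%:R * 1) + b * (s%:R * 1)) = a * (p%:R * (p.-1%:R - 1)) + b * (s%:R * (s.-1%:R - 1)) :> R.
  by ring.
have pos n : (2 < n)%N -> 0 < n%:R * (n.-1%:R - 1) :> R.
  by case: n => [|[|[|n]]]// _; rewrite mulr_gt0// subr_gt0 ltr1n.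
by apply: mix_gt0 => //; apply: pos => //; exact: ltn_trans ps.
Qed.

(** With 1 + y the ratio xi''(1)/xi'(1) and z the parameter of the fit on [0, 1], Psi is
    y^2/(1+y) (phi z - phi y), while the fit overshoots h at 1 exactly when z < y. *)
Lemma Psi_gt0_gap l : 0 <= l <= 1 -> 0 < Psi p s l ->
  hx p s l (1 - l) 1 < dfit p s l (1 - l) 1.
Proof.
move=> /andP[l0 l1]; have l0' : 0 <= 1 - l by rewrite subr_ge0.
have l01 : 0 < l + (1 - l) by rewrite addrC subrK.
rewrite /Psi derive1_mixture derive2_mixture.
have d12 := Xi1_lt_Xi2 l0 l0' l01.
have d10 := Xi1_gt0 p_gt2 ps l0 l0' l01 (ltr01 : 0 < (1 : R)).
have [z0 zE] := zfitP p_gt2 ps l0 l0' l01 (ltr01 : 0 < (1 : R)).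
have d2 := dfit2 p_gt2 ps l0 l0' l01 (ltr01 : 0 < (1 : R)).
have dd := dfit_gt0 p_gt2 ps l0 l0' l01 (ltr01 : 0 < (1 : R)).
have hh := hx_gt0 p_gt2 ps l0 l0' l01 (ltr01 : 0 < (1 : R)).
have h2 := hx_Xi2 p_gt2 ps l0 l0' l01 (ltr01 : 0 < (1 : R)).
have : phi (zfit p s l (1 - l) 1) = (Xi1 p s l (1 - l) 1)^-1.
  by rewrite zE /ratio0 Xi_at1 !mul1r.
set e1 := Xi1 p s l (1 - l) 1 in d12 d10 d2 *.
set e2 := Xi2 p s l (1 - l) 1 in d12 h2 *.
set z := zfit p s l (1 - l) 1 in z0 zE d2 *.
move=> zE' Pp; pose y := e2 / e1 - 1.
have y0 : 0 < y by rewrite subr_gt0 ltr_pdivlMr// mul1r.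
have e2E : e2 = e1 * (1 + y) by rewrite /y; field; rewrite gt_eqF.
have y1 : 0 < 1 + y by lra.
have : - ((e1 - 1) / e2) - ln (e2 / e1) + 1 - 2 / e1 + e2 / e1 ^+ 2 =
    y ^+ 2 / (1 + y) * (phi z - phi y).
  rewrite zE' /phi; have -> : e2 / e1 = 1 + y by rewrite /y; ring.
  rewrite e2E; field; rewrite !gt_eqF//.
move=> PE; rewrite {}PE pmulr_rgt0 ?divr_gt0 ?exprn_gt0// subr_gt0 phi_lt// in Pp.
rewrite -(ltr_pXn2r (n := 2)) ?nnegrE ?(ltW hh) ?(ltW dd)//.
have e20 : 0 < e2 by exact: lt_trans d12.
have z1 : 0 < 1 + z by lra.
have -> : hx p s l (1 - l) 1 ^+ 2 = e2^-1.
  have ne : e2 != 0 by rewrite gt_eqF.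
  by apply: (mulfI ne); rewrite h2 divff.
have -> : dfit p s l (1 - l) 1 ^+ 2 = (e1 * (1 + z))^-1.
  have ne : e1 * (1 + z) != 0 by rewrite gt_eqF// mulr_gt0.
  by apply: (mulIf ne); rewrite d2 mulVf.
rewrite ltf_pV2 ?posrE ?mulr_gt0// e2E ltr_pM2l//; lra.
Qed.

(** The mixture with weight lam X is x^p + x^s on [0, X], rescaled to [0, 1]. *)
Section Scaling.
Variable X : R.
Hypothesis X_gt0 : 0 < X.
Local Notation l := (lam p s X).
Local Notation c := (Xi p s (1 : R) 1 X).
(** The factor by which tails are multiplied when [0, X] is rescaled to [0, 1]. *)
Definition zoom : R := Num.sqrt c / X.
Local Notation k := zoom.

Let c0 : 0 < c. Proof. by apply: Xi_gt0 => //; lra. Qed.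

Lemma zoom_gt0 : 0 < k.
Proof. by rewrite divr_gt0// sqrtr_gt0. Qed.

Lemma zoom2 : k ^+ 2 = c / X ^+ 2.
Proof. by rewrite expr_div_n sqr_sqrtr// ltW. Qed.

Let lamEl : l = X ^+ p / c. Proof. by rewrite /lam /Xi !mul1r. Qed.
Let lamEr : 1 - l = X ^+ s / c. Proof. by rewrite lam_compl// /Xi !mul1r. Qed.

Lemma Xi_zoom x : Xi p s l (1 - l) x = Xi p s 1 1 (X * x) / c.
Proof. by rewrite {1}/Xi lamEr lamEl [in RHS]/Xi !exprMn; ring. Qed.

Lemma Xi1_zoom x : Xi1 p s l (1 - l) x = X * Xi1 p s 1 1 (X * x) / c.
Proof.
have e n : (2 < n)%N -> X ^+ n * x ^+ n.-1 = X * (X * x) ^+ n.-1.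
  by case: n => // n _; rewrite exprS exprMn mulrA.
have := e p p_gt2; have := e s (ltn_trans p_gt2 ps) => es ep.
rewrite {1}/Xi1 lamEr lamEl [in RHS]/Xi1.
transitivity ((p%:R * (X ^+ p * x ^+ p.-1) + s%:R * (X ^+ s * x ^+ s.-1)) / c); first by ring.
by rewrite es ep; ring.
Qed.

Lemma Xi2_zoom x : Xi2 p s l (1 - l) x = X ^+ 2 * Xi2 p s 1 1 (X * x) / c.
Proof.
have e n : (2 < n)%N -> X ^+ n * x ^+ n.-2 = X ^+ 2 * (X * x) ^+ n.-2.
  by case: n => [|[|n]]// _; rewrite -[n.+2]add2n exprD exprMn mulrA.
have := e p p_gt2; have := e s (ltn_trans p_gt2 ps) => es ep.
rewrite {1}/Xi2 lamEr lamEl [in RHS]/Xi2.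
transitivity ((p%:R * p.-1%:R * (X ^+ p * x ^+ p.-2) + s%:R * s.-1%:R * (X ^+ s * x ^+ s.-2)) / c); first by ring.
by rewrite es ep; ring.
Qed.

Lemma Xi3_zoom x : Xi3 p s l (1 - l) x = X ^+ 3 * Xi3 p s 1 1 (X * x) / c.
Proof.
have e n : (2 < n)%N -> X ^+ n * x ^+ n.-2.-1 = X ^+ 3 * (X * x) ^+ n.-2.-1.
  by case: n => [|[|[|n]]]// _; rewrite -[n.+3]add3n exprD exprMn mulrA.
have := e p p_gt2; have := e s (ltn_trans p_gt2 ps) => es ep.
rewrite {1}/Xi3 lamEr lamEl [in RHS]/Xi3.
transitivity ((p%:R * p.-1%:R * p.-2%:R * (X ^+ p * x ^+ p.-2.-1) +
  s%:R * s.-1%:R * s.-2%:R * (X ^+ s * x ^+ s.-2.-1)) / c); first by ring.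
by rewrite es ep; ring.
Qed.

Lemma hx_zoom x : 0 < x -> hx p s l (1 - l) x = k * hx p s 1 1 (X * x).
Proof.
move=> x0; have Xx : 0 < X * x by rewrite mulr_gt0.
have h2 : 0 < Xi2 p s 1 1 (X * x) by apply: Xi2_gt0 => //; lra.
rewrite /hx Xi2_zoom /zoom.
have -> : X ^+ 2 * Xi2 p s 1 1 (X * x) / c = X ^+ 2 * (Xi2 p s 1 1 (X * x) / c) by ring.
rewrite sqrtrM ?sqr_ge0// sqrtr_sqr gtr0_norm// sqrtrM ?(ltW h2)// sqrtrV ?(ltW c0)//.
field; rewrite !gt_eqF// sqrtr_gt0//.
Qed.

Lemma wx_zoom x : 0 < x -> wx p s l (1 - l) x = k * X * wx p s 1 1 (X * x).
Proof.
move=> x0; rewrite /wx hx_zoom// Xi3_zoom exprMn [k ^+ 3]exprS zoom2.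
by field; rewrite !gt_eqF.
Qed.

Lemma Pf_zoom v m y : 0 < v -> 0 < m -> Pf (k * v) (k * X * m) y = Pf v m (X * y) / c.
Proof.
move=> v0 m0; rewrite /Pf; have k0 := zoom_gt0.
have -> : 1 - k * X * m * y / (k * v) = 1 - m * (X * y) / v by field; rewrite !gt_eqF.
have -> : (k * X * m) ^+ 2 = c * m ^+ 2.
  by rewrite exprMn exprMn zoom2; field; rewrite gt_eqF.
have -> : y / (k * X * m * (k * v)) = (X * y) / (m * v) / c.
  have -> : k * X * m * (k * v) = k ^+ 2 * X * m * v by ring.
  by rewrite zoom2; field; rewrite !gt_eqF.
by field; rewrite !gt_eqF.
Qed.

Lemma Fl_zoom q v m x : 0 < v -> 0 < m ->
  Fl p s l (1 - l) q (k * v) (k * X * m) x = Fl p s 1 1 (X * q) v m (X * x) / c.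
Proof.
move=> v0 m0; rewrite /Fl Pf_zoom// !Xi_zoom Xi1_zoom -mulrBr; ring.
Qed.

Lemma Fl1_zoom q v m x : 0 < v -> 0 < v - m * (X * x - X * q) ->
  Fl1 p s l (1 - l) q (k * v) (k * X * m) x = X * Fl1 p s 1 1 (X * q) v m (X * x) / c.
Proof.
move=> v0 l0; rewrite /Fl1 !Xi1_zoom; have k0 := zoom_gt0.
have -> : k * v * (k * v - k * X * m * (x - q)) = k ^+ 2 * (v * (v - m * (X * x - X * q))).
  by ring.
by rewrite zoom2; field; rewrite !gt_eqF.
Qed.

Lemma line_zoom q v m x : k * v - k * X * m * (x - q) = k * (v - m * (X * x - X * q)).
Proof. by ring. Qed.

Lemma left_fit_zoom q v m : 0 < q -> left_fit p s 1 1 (X * q) v m ->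
  left_fit p s l (1 - l) q (k * v) (k * X * m).
Proof.
move=> q0 f; have Xq : 0 < X * q by rewrite mulr_gt0.
have v0 : 0 < v by apply: (fit_v Xq f).
have k0 := zoom_gt0; case: f => m0 l0 F0 F1; split.
- by rewrite mulr_gt0// mulr_gt0.
- have := line_zoom 0 v m q; rewrite !subr0 mulr0 subr0 => ->.
  by rewrite mulr_gt0.
- by rewrite Fl_zoom// mulr0 F0 mul0r.
- by rewrite Fl1_zoom// mulr0 ?subr0// F1 mulr0 mul0r.
Qed.

Lemma fit_zoom q : 0 < q -> vfit p s l (1 - l) q = k * vfit p s 1 1 (X * q) /\
  mfit p s l (1 - l) q = k * X * mfit p s 1 1 (X * q).
Proof.
move=> q0; have Xq : 0 < X * q by rewrite mulr_gt0.
have /andP[l0 l1] := @lam_itv R p s X X_gt0.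
have l0' : 0 <= 1 - l by rewrite subr_ge0 ltW.
have l01 : 0 < l + (1 - l) by rewrite addrC subrK.
have f := left_fit_zoom q0 (fitP p_gt2 ps Xq).
by have [-> ->] := left_fit_unique p_gt2 ps (ltW l0) l0' l01 q0 f.
Qed.

Lemma dfit_zoom q : 0 < q -> dfit p s l (1 - l) q = k * dfit p s 1 1 (X * q).
Proof.
move=> q0; have Xq : 0 < X * q by rewrite mulr_gt0.
rewrite -(vmfit p s l (1 - l) q0) -(vmfit p s 1 1 Xq).
by have [-> ->] := fit_zoom q0; ring.
Qed.

Lemma Psi_egap : 0 < Psi p s l -> egap p s X < 0.
Proof.
have /andP[l0 l1] := @lam_itv R p s X X_gt0.
move=> /Psi_gt0_gap; rewrite (ltW l0) (ltW l1) => /(_ isT).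
rewrite hx_zoom ?dfit_zoom// mulr1 ltr_pM2l ?zoom_gt0// /egap; lra.
Qed.

End Scaling.
End Link.

(** * The region of one-step symmetry breaking *)

Section EndSigns.
Context {R : realType}.
Implicit Types (F G : R -> R).

Lemma continuous_gt0_left G b : {for b, continuous G} -> 0 < G b ->
  exists2 e, 0 < e & forall x, `|b - x| < e -> 0 < G x.
Proof.
move=> cG Gb; move: cG => /cvgrPdist_lt /(_ _ Gb) /nbhs_ballP[e /= e0 he]; exists e => // y hy.
by have := he y hy; rewrite /= ltr_norml => /andP[_ +]; lra.
Qed.

Lemma double_zero_right F F1 F2 c b x : C2_on F F1 F2 c b -> F b = 0 -> F1 b = 0 ->
  c <= x -> x < b -> ((forall t, c < t < b -> 0 < F2 t) -> 0 < F x) /\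
    ((forall t, c < t < b -> F2 t < 0) -> F x < 0).
Proof.
move=> [dF dF1] Fb F1b cx xb; split => F2s; rewrite -Fb.
  apply: (derive_decreasing dF) => // t /andP[ct tb]; rewrite -F1b.
  by apply: (derive_increasing dF1 F2s) => //; exact: ltW.
apply: (derive_increasing dF) => // t /andP[ct tb]; rewrite -F1b.
by apply: (derive_decreasing dF1 F2s) => //; exact: ltW.
Qed.

Lemma double_zero_left F F1 F2 a d x : C2_on F F1 F2 a d -> F a = 0 -> F1 a = 0 ->
  a < x -> x <= d -> (forall t, a < t < d -> F2 t < 0) -> F x < 0.
Proof.
move=> [dF dF1] Fa F1a ax xd F2s; rewrite -Fa.
apply: (derive_decreasing dF) => // t /andP[at_ td]; rewrite -F1a.
by apply: (derive_decreasing dF1 F2s) => //; exact: ltW.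
Qed.

End EndSigns.

Section OneStep.
Context {R : realType}.
Variables (p s : nat).
Hypotheses (p_gt2 : (2 < p)%N) (ps : (p < s)%N).
Implicit Types (l x : R).

Local Notation V l := (vfit p s l (1 - l) 1).
Local Notation M l := (mfit p s l (1 - l) 1).
Local Notation h l := (hx p s l (1 - l)).
Local Notation F l := (Fl p s l (1 - l) 0 (V l) (M l)).
Local Notation F1 l := (Fl1 p s l (1 - l) 0 (V l) (M l)).
Local Notation F2 l := (Fl2 p s l (1 - l) 0 (V l) (M l)).
Local Notation gap1 l := (fun x => h l x - (V l - M l * x)).

(** The affine fit on [0, 1] then gives the Parisi measure, by kRSB_1. *)
Definition one_step l := forall x, 0 <= x -> x <= 1 -> F l x <= 0.

Section Weight.
Variable l : R.
Hypothesis l01 : 0 <= l <= 1.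

Let a0 : 0 <= l. Proof. by case/andP: l01. Qed.
Let b0 : 0 <= 1 - l. Proof. by rewrite subr_ge0; case/andP: l01. Qed.
Let ab0 : 0 < l + (1 - l). Proof. by rewrite addrC subrK. Qed.
Let one_gt0 : 0 < (1 : R) := ltr01.

Lemma fit1 : left_fit p s l (1 - l) 1 (V l) (M l).
Proof. exact: left_fit_exists. Qed.

Lemma M_gt0 : 0 < M l. Proof. by case: fit1. Qed.

Lemma line1_gt0 x : x <= 1 -> 0 < V l - M l * (x - 0).
Proof.
move=> x1; case: fit1 => m0 l0 _ _; apply: (lt_le_trans l0).
by rewrite lerD2l lerN2 ler_pM2l// subr0.
Qed.

Lemma V_gt0 : 0 < V l.
Proof. by have := line1_gt0 ler01; rewrite subrr mulr0 subr0. Qed.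

Lemma F_ends : [/\ F l 0 = 0, F1 l 0 = 0, F l 1 = 0 & F1 l 1 = 0].
Proof. by case: fit1 => _ _ e1 e2; rewrite Fl_q Fl1_q. Qed.

Lemma C2_F : C2_on (F l) (F1 l) (F2 l) 0 1.
Proof. by apply: Fl_C2; [exact: V_gt0|exact: M_gt0|exact: line1_gt0]. Qed.

Lemma F2_neg1 x : 0 < x -> x <= 1 -> (F2 l x < 0) = (0 < gap1 l x).
Proof.
move=> x0 x1; have [-> _] := Fl2_sign p_gt2 ps a0 b0 ab0 x0 (line1_gt0 x1).
by rewrite subr0.
Qed.

Lemma F2_pos1 x : 0 < x -> x <= 1 -> (0 < F2 l x) = (gap1 l x < 0).
Proof.
move=> x0 x1; have [_ ->] := Fl2_sign p_gt2 ps a0 b0 ab0 x0 (line1_gt0 x1).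
by rewrite subr0.
Qed.

Lemma F2_eq1 x : 0 < x -> x <= 1 -> F2 l x = 0 -> gap1 l x = 0.
Proof.
move=> x0 x1 e; apply/le_anti; rewrite leNgt -F2_neg1// e ltxx/=.
by rewrite leNgt -F2_pos1// e ltxx.
Qed.

Lemma gap1_1 : gap1 l 1 = h l 1 - dfit p s l (1 - l) 1.
Proof. by congr (_ - _); exact: vmfit. Qed.

(** A defect convex on the left of its double zero at 1 is positive there. *)
Lemma F2_left_not_one_step e : 0 < e ->
  (forall x, 1 - e < x -> x < 1 -> 0 < F2 l x) -> ~ one_step l.
Proof.
move=> e0 H ok; pose c := Num.max 0 (1 - e).
have c1 : c < 1 by rewrite gt_max one_gt0/=; lra.
have c0 : 0 <= c by rewrite le_max lexx.
have [_ _ Fe F1e] := F_ends.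
have [+ _] := double_zero_right (C2_on_sub c0 (lexx 1) C2_F) Fe F1e (lexx c) c1.
have : F l c <= 0 by apply: ok => //; exact: ltW.
rewrite leNgt => /negP + H'; apply; apply: H' => t /andP[ct t1]; apply: H => //.
by apply: le_lt_trans ct; rewrite le_max lexx orbT.
Qed.

Lemma one_step_F2 : one_step l -> F2 l 1 <= 0.
Proof.
move=> ok; rewrite leNgt; apply/negP => F2p.
have cF : {for 1, continuous (F2 l)}.
  apply: (@Fl2_continuous R R p s 1 (fun=> l) (fun=> 1 - l) _ _ (fun=> 0) (fun=> V l) (fun=> M l) id);
    try exact: cst_continuous.
  - exact: (deriv_continuous (deriv_id 1)).
  - exact: line1_gt0.
have [e e0 he] := continuous_gt0_left cF F2p.
apply: (F2_left_not_one_step e0) ok => x ex x1; apply: he.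
by rewrite gtr0_norm ?subr_gt0//; lra.
Qed.

Lemma Psi_not_one_step : 0 < Psi p s l -> ~ one_step l.
Proof.
move=> /(Psi_gt0_gap p_gt2 ps l01) hd /one_step_F2; rewrite leNgt => /negP; apply.
by rewrite F2_pos1// gap1_1 subr_lt0.
Qed.

(** When the second derivative of the defect vanishes at 1, Q is - xi'(1) times the third. *)
Lemma Qpoly_derivatives : Qpoly p s l =
  2 * Xi2 p s l (1 - l) 1 * (Xi2 p s l (1 - l) 1 - Xi1 p s l (1 - l) 1) -
  Xi3 p s l (1 - l) 1 * Xi1 p s l (1 - l) 1.
Proof.
have s2 := ltn_trans p_gt2 ps.
rewrite /Qpoly /Xi1 /Xi2 /Xi3 !expr1n !natr_pred2 ?natr_pred1 ?(ltnW p_gt2) ?(ltnW s2) ?(ltnW (ltnW p_gt2)) ?(ltnW (ltnW s2))//.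
by ring.
Qed.

(** If h meets the fitted line at 1, then Q > 0 says that it arrives from below, so the defect
    is convex just before 1. *)
Lemma Qpoly_not_one_step : F2 l 1 = 0 -> 0 < Qpoly p s l -> ~ one_step l.
Proof.
move=> /(F2_eq1 one_gt0 (lexx 1)) g1; rewrite Qpoly_derivatives => Qp.
have hE : h l 1 = dfit p s l (1 - l) 1 by move: g1; rewrite gap1_1; lra.
have h2 := hx_Xi2 p_gt2 ps a0 b0 ab0 one_gt0.
have d2 := dfit2 p_gt2 ps a0 b0 ab0 one_gt0.
have d0 := dfit_gt0 p_gt2 ps a0 b0 ab0 one_gt0.
have e1p := Xi1_gt0 p_gt2 ps a0 b0 ab0 one_gt0.
have e2p := Xi2_gt0 p_gt2 ps a0 b0 ab0 one_gt0.
rewrite hE in h2; have mE := vmfit p s l (1 - l) (ltr01 : 0 < (1 : R)).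
have vE : Xi1 p s l (1 - l) 1 * dfit p s l (1 - l) 1 * V l = 1 by rewrite -[RHS]d2 /vfit; ring.
have mw : wx p s l (1 - l) 1 < M l.
  have -> : M l = V l - dfit p s l (1 - l) 1 by rewrite -mE mulr1; ring.
  rewrite /wx hE; set d := dfit p s l (1 - l) 1 in h2 d0 vE *.
  set e1 := Xi1 p s l (1 - l) 1 in Qp vE e1p *; set e2 := Xi2 p s l (1 - l) 1 in Qp h2 e2p *.
  set e3 := Xi3 p s l (1 - l) 1 in Qp *.
  rewrite -subr_gt0 -(pmulr_rgt0 _ (_ : 0 < 2 * e1 * d * e2 ^+ 2)); last first.
    by rewrite !mulr_gt0// exprn_gt0.
  have -> : 2 * e1 * d * e2 ^+ 2 * (V l - d - e3 * d ^+ 3 / 2) =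
     2 * e2 ^+ 2 * (e1 * d * V l) - 2 * e1 * e2 * (e2 * d ^+ 2) - e1 * e3 * (e2 * d ^+ 2) ^+ 2.
    by field.
  by rewrite vE h2; lra.
have cw : {for 1, continuous (fun x => M l - wx p s l (1 - l) x)}.
  apply: continuousB; first exact: cst_continuous.
  exact: (deriv_continuous (deriv_wx p_gt2 ps a0 b0 ab0 one_gt0)).
have [|e e0 he] := continuous_gt0_left cw; first by rewrite subr_gt0.
pose e' := Num.min e 1; have e'0 : 0 < e' by rewrite lt_min e0/=.
have e'e : e' <= e by rewrite ge_min lexx.
have e'1 : e' <= 1 by rewrite ge_min lexx orbT.
apply: (F2_left_not_one_step e'0) => x ex x1.
have x0 : 0 < x by lra.
rewrite F2_pos1 ?(ltW x1)// -[ltRHS]g1.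
apply: (@derive_increasing _ (gap1 l) (fun t => M l - wx p s l (1 - l) t) x 1) => //.
- move=> t xt _; have t0 := lt_le_trans x0 xt.
  apply: (deriv_eq (deriv_sub (deriv_hx p_gt2 ps a0 b0 ab0 t0)
    (deriv_sub (deriv_cst (V l) t) (deriv_scale (M l) (deriv_id t))))).
  by ring.
- move=> t /andP[xt t1]; apply: he; rewrite gtr0_norm ?subr_gt0//; lra.
Qed.

(** When h is convex on the whole half-line it meets a line at most twice. *)
Lemma convex_strict : (forall x, 0 < x -> 0 < form_at p s l (1 - l) x) ->
  (forall x, 0 < x -> x < 1 -> F l x < 0) /\ F2 l 1 < 0.
Proof.
move=> Hf; have cvx : convex3 (fun x => 0 < x) (gap1 l).
  have -> : gap1 l = (fun x => h l x - (V l + (- M l) * x)).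
    by apply/funext => x; rewrite mulNr.
  apply: convex3_affine; apply: hx_convex => // x z t x0 _ /andP[xt _].
  by apply: Hf; exact: lt_trans xt.
have [F0 F10 Fe F1e] := F_ends; have [dF dF1] := C2_F.
have rolle1 a b : 0 <= a -> a < b -> b <= 1 -> F l a = F l b -> exists2 c, a < c < b & F1 l c = 0.
  move=> a0' ab b1 e; have [c cab] := mean_value ab (derive_on_sub a0' b1 dF).
  have ba : 0 < b - a by rewrite subr_gt0.
  rewrite e subrr => /esym/eqP; rewrite mulf_eq0 (gt_eqF ba) orbF => /eqP e'.
  by exists c.
have rolle2 a b : 0 <= a -> a < b -> b <= 1 -> F1 l a = F1 l b ->
    exists2 c, a < c < b & gap1 l c = 0.
  move=> a0' ab b1 e; have [c /andP[ac cb]] := mean_value ab (derive_on_sub a0' b1 dF1).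
  have ba : 0 < b - a by rewrite subr_gt0.
  rewrite e subrr => /esym/eqP; rewrite mulf_eq0 (gt_eqF ba) orbF => /eqP e'.
  exists c; first by rewrite ac.
  by apply: F2_eq1 => //; [exact: le_lt_trans ac|exact: ltW (lt_le_trans cb b1)].
split.
  move=> x x0 x1; rewrite ltNge; apply/negP; rewrite le_eqVlt => /orP[/eqP Fx|Fx].
    have [c1 /andP[c10 c1x] e1] : exists2 c, 0 < c < x & F1 l c = 0.
      by apply: rolle1 => //; [exact: ltW|rewrite F0].
    have [c2 /andP[c2x c21] e2] : exists2 c, x < c < 1 & F1 l c = 0.
      by apply: rolle1 => //; [exact: ltW|rewrite Fe].
    have [|d1 /andP[d10 d1c] g1] := rolle2 0 c1 (lexx 0) c10 (ltW (lt_trans c1x x1)).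
      by rewrite F10 e1.
    have [|d2 /andP[cd2 d2c] g2] := rolle2 c1 c2 (ltW c10) (lt_trans c1x c2x) (ltW c21).
      by rewrite e1 e2.
    have [|d3 /andP[cd3 d31] g3] := rolle2 c2 1 (ltW (lt_trans x0 c2x)) c21 (lexx 1).
      by rewrite e2 F1e.
    have d12 := lt_trans d1c cd2; have d23 := lt_trans d2c cd3.
    have := cvx d1 d2 d3 d10 (lt_trans d10 (lt_trans d12 d23)) d12 d23.
    by rewrite g1 g2 g3 !mulr0 addr0 ltxx.
  have [|t1 [t2 [t3 [[t10 t12 t23 t31] [H1 H2 H3]]]]] := double_zeros_pos C2_F _ F0 F10 Fe F1e Fx.
    by rewrite x0.
  have t20 := lt_trans t10 t12; have t30 := lt_trans t20 t23.
  have t21 := lt_trans t23 t31; have t11 := lt_trans t12 t21.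
  rewrite F2_pos1 ?(ltW t11)// in H1; rewrite F2_neg1 ?(ltW t21)// in H2.
  rewrite F2_pos1 ?(ltW t31)// in H3.
  have /= := cvx t1 t2 t3 t10 t30 t12 t23; move: H1 H2 H3 => /= H1 H2 H3.
  have : 0 < (t3 - t1) * gap1 l t2 by rewrite mulr_gt0// subr_gt0 (lt_trans t12).
  have : (t3 - t2) * gap1 l t1 < 0 by rewrite pmulr_rlt0// subr_gt0.
  have : (t2 - t1) * gap1 l t3 < 0 by rewrite pmulr_rlt0// subr_gt0.
  by move=> /=; lra.
have [c /andP[c0 c1] e1] : exists2 c, 0 < c < 1 & F1 l c = 0 by apply: rolle1 => //; rewrite F0.
have [|d1 /andP[d10 d1c] g1] := rolle2 0 c (lexx 0) c0 (ltW c1); first by rewrite F10.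
have [|d2 /andP[cd2 d21] g2] := rolle2 c 1 (ltW c0) c1 (lexx 1); first by rewrite F1e.
have d12 := lt_trans d1c cd2.
have := cvx d1 d2 1 d10 one_gt0 d12 d21; rewrite g1 g2 !mulr0 add0r pmulr_rgt0 ?subr_gt0//.
by rewrite F2_neg1//=; lra.
Qed.

End Weight.

Lemma pure_strict l : l = 0 \/ l = 1 -> (forall x, 0 < x -> x < 1 -> F l x < 0) /\ F2 l 1 < 0.
Proof.
have P0 n : (2 < n)%N -> 0 < n%:R :> R by move=> n2; rewrite ltr0n (ltn_trans _ n2).
have P1 n : (2 < n)%N -> 0 < n%:R - 1 :> R by move=> n2; rewrite subr_gt0 ltr1n (ltn_trans _ n2).
have P2 n : (2 < n)%N -> 0 < n%:R - 2 :> R by move=> n2; rewrite subr_gt0 ltr_nat.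
have s_gt2 := ltn_trans p_gt2 ps.
move=> Hl; apply: convex_strict; first by case: Hl => ->; rewrite lexx ler01.
move=> x x0; case: Hl => ->; rewrite /form_at /inflection_form ?subr0 ?subrr !mul0r ?mulr0 !mul1r ?expr0n/= ?mulr0 ?addr0 ?subr0 ?add0r.
  by rewrite mulr_gt0// ?exprn_gt0// !mulr_gt0// ?P0 ?P1 ?P2// exprn_gt0.
by rewrite mulr_gt0// ?exprn_gt0// !mulr_gt0// ?P0 ?P1 ?P2// exprn_gt0.
Qed.

Lemma one_step_pure l : l = 0 \/ l = 1 -> one_step l.
Proof.
move=> Hl x; rewrite le_eqVlt => /orP[/eqP <- _|x0]; first by rewrite Fl_q.
have l01 : 0 <= l <= 1 by case: Hl => ->; rewrite lexx ler01.
rewrite le_eqVlt => /orP[/eqP ->|x1]; first by have [_ _ -> _] := F_ends l01.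
by apply/ltW; case: (pure_strict Hl) => + _; apply.
Qed.

Lemma F_joint_continuous l x : 0 <= l <= 1 -> x <= 1 ->
  {for (x, l), continuous (fun z : R * R => F z.2 z.1)} /\
  {for (x, l), continuous (fun z : R * R => F2 z.2 z.1)}.
Proof.
move=> l01 x1; have [a0 b0] := andP l01; have b0' : 0 <= 1 - l by rewrite subr_ge0.
have ab0 : 0 < l + (1 - l) by rewrite addrC subrK.
have cl : {for (x, l), continuous (fun z : R * R => z.2)} by exact: cvg_snd.
have cx : {for (x, l), continuous (fun z : R * R => z.1)} by exact: cvg_fst.
have cl' : {for (x, l), continuous (fun z : R * R => 1 - z.2)}.
  by apply: continuousB => //; exact: continuous_const.
have c1 : {for (x, l), continuous (fun _ : R * R => 1 : R)} by exact: continuous_const.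
have c0 : {for (x, l), continuous (fun _ : R * R => 0 : R)} by exact: continuous_const.
have cV := vfit_continuous p_gt2 ps cl cl' c1 (ltr01 : 0 < (1 : R)) a0 b0' ab0.
have cM := mfit_continuous p_gt2 ps cl cl' c1 (ltr01 : 0 < (1 : R)) a0 b0' ab0.
split.
  exact: (Fl_continuous (p := p) (s := s) cl cl' c0 cV cM cx (V_gt0 l01) (M_gt0 l01) (line1_gt0 l01 x1)).
exact: (Fl2_continuous (p := p) (s := s) cl cl' c0 cV cM cx (line1_gt0 l01 x1)).
Qed.

Lemma one_step_closed l : 0 < l <= 1 -> (forall l', 0 <= l' -> l' < l -> one_step l') -> one_step l.
Proof.
move=> /andP[l0 l1] H x x0 x1; rewrite leNgt; apply/negP => Fx.
have l01 : 0 <= l <= 1 by rewrite (ltW l0).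
have [cF _] := F_joint_continuous l01 x1.
have cF' : {for l, continuous (fun l => F l x)}.
  apply: (@continuous_comp _ _ _ (fun l : R => (x, l)) (fun z : R * R => F z.2 z.1)) => //.
  exact: (@cvg_pair R R R (nbhs l) (nbhs x) (nbhs l) _ _ _ (fun=> x) id (cvg_cst x) cvg_id).
have [e e0 he] := continuous_gt0_left cF' Fx.
pose l' := Num.max 0 (l - e / 2).
have l'0 : 0 <= l' by rewrite le_max lexx.
have l'l : l' < l by rewrite gt_max l0/=; lra.
have l'e : l - e / 2 <= l' by rewrite le_max lexx orbT.
have := H l' l'0 l'l x x0 x1; rewrite leNgt he// gtr0_norm ?subr_gt0//; lra.
Qed.

(** Compactness of [0, 1]: away from 0 and 1 the defect is negative, and near these double
    zeros its second derivative is negative, in both cases uniformly for nearby weights. *)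
Lemma one_step_open l : 0 <= l <= 1 -> (forall x, 0 < x -> x < 1 -> F l x < 0) -> F2 l 1 < 0 ->
  \forall l' \near l, 0 <= l' <= 1 -> one_step l'.
Proof.
move=> l01 Fneg F2neg.
have near_neg (G : R -> R -> R) x : {for (x, l), continuous (fun z : R * R => G z.2 z.1)} ->
    G l x < 0 -> exists2 e, 0 < e & forall y l', `|x - y| < e -> `|l - l'| < e -> G l' y < 0.
  move=> cG Gx; have : 0 < - G l x by rewrite oppr_gt0.
  move: cG => /cvgrPdist_lt /[apply] /nbhs_ballP[e /= e0 he]; exists e => // y l' xy ll.
  by have := he (y, l') (conj xy ll); rewrite /= ltr_norml => /andP[+ _]; lra.
have cpt : compact `[0, 1 : R] by exact: segment_compact.
have /near_covering_withinP near_cov := (compact_near_coveringP `[0, 1 : R]).1 cpt.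
pose P (l' x : R) := 0 <= l' <= 1 -> F l' x <= 0.
have : \forall l' \near nbhs l, `[0, 1 : R]%classic `<=` P l'.
  apply: (near_cov R (nbhs l) P _).
  move=> x /=; rewrite in_itv/= => /andP[x0 x1].
  have [cF cF2] := F_joint_continuous l01 x1.
  suff [e e0 he] : exists2 e, 0 < e & forall y l', `|x - y| < e -> `|l - l'| < e ->
      0 <= y <= 1 -> 0 <= l' <= 1 -> F l' y <= 0.
    exists (ball x e, ball l e); first by split; exact: nbhsx_ballx.
    move=> [y l'] [/= xy ll]; rewrite in_itv/= => y01 l'01.
    exact: he.
  move: x0; rewrite le_eqVlt => /orP[/eqP x0|x0].
    rewrite -x0 in cF2 *.
    have [|e e0 he] := near_neg (fun l x => F2 l x) _ cF2.
      rewrite /Fl2 (Xi2_0 p_gt2 ps) sub0r oppr_lt0 invr_gt0 exprn_gt0//.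
      by apply: line1_gt0.
    exists (Num.min e 1); first by rewrite lt_min e0/=.
    move=> y l'; rewrite sub0r normrN !lt_min => /andP[ye _] /andP[le _] /andP[y0 y1] l'01.
    move: y0; rewrite le_eqVlt => /orP[/eqP <-|y0]; first by rewrite Fl_q.
    have [F0 F10 _ _] := F_ends l'01.
    apply/ltW/(double_zero_left (C2_on_sub (lexx 0) y1 (C2_F l'01)) F0 F10 y0 (lexx y)).
    move=> t /andP[t0 ty]; apply: he => //; rewrite sub0r normrN gtr0_norm//.
    by rewrite (lt_trans ty)// -(gtr0_norm y0).
  move: x1; rewrite le_eqVlt => /orP[/eqP x1|x1].
    rewrite x1 in cF2 *.
    have [e e0 he] := near_neg (fun l x => F2 l x) _ cF2 F2neg.
    exists e => // y l' ye le /andP[y0 y1] l'01.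
    have [_ _ F0 F10] := F_ends l'01.
    move: y1; rewrite le_eqVlt => /orP[/eqP ->|y1]; first by rewrite F0.
    have [_ H] := double_zero_right (C2_on_sub y0 (lexx 1) (C2_F l'01)) F0 F10 (lexx y) y1.
    apply/ltW/H => t /andP[yt t1]; apply: he => //.
    rewrite gtr0_norm ?subr_gt0// in ye; rewrite gtr0_norm ?subr_gt0//; lra.
  have [e e0 he] := near_neg (fun l x => F l x) _ cF (Fneg x x0 x1).
  by exists e => // y l' ye le _ _; apply/ltW/he.
move=> near_ok; near=> l' => l'01 x x0 x1.
have : `[0, 1 : R] `<=` (fun x => 0 <= l' <= 1 -> F l' x <= 0) by near: l'.
by apply => //=; rewrite in_itv/= x0.
Unshelve. all: by end_near. Qed.

(** At the supremum of the weights up to which the certificate holds, the certificate holds but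
    not openly. Contact at the endpoint 1 is excluded because Q > 0 before its first
    root, where the certificate fails. *)
Lemma first_touch l1 l2 lS : 0 < lS < 1 -> 0 < Psi p s lS ->
  ordered_real_roots (Qpoly p s) l1 l2 -> 0 < Psi p s l1 ->
  exists2 l, 0 < l < lS & (forall l', 0 <= l' -> l' <= l -> one_step l') /\
    exists2 x, 0 < x < 1 & F l x = 0.
Proof.
move=> /andP[lS0 lS1] PS hQ P1.
have [l1_gt0 Qpos] := Qpoly_signs p_gt2 ps hQ.
pose S := [set l | 0 <= l <= lS /\ forall l', 0 <= l' -> l' <= l -> one_step l'].
have S0 : S 0.
  split; first by rewrite lexx ltW.
  move=> l' l'0 l'l; have -> : l' = 0 by apply/le_anti; rewrite l'0 l'l.
  by apply: one_step_pure; left.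
have hs : has_sup S by split; [exists 0|exists lS => x [/andP[]]].
pose l := sup S.
have l0 : 0 <= l by apply: ub_le_sup => //; case: hs.
have lS' : l <= lS by apply: ge_sup => [|x [/andP[]]//]; exists 0.
have l01 : 0 <= l <= 1 by rewrite l0 (le_trans lS')// ltW.
have below l' : 0 <= l' -> l' < l -> one_step l'.
  move=> l'0 l'l; have : 0 < l - l' by rewrite subr_gt0.
  move=> /sup_adherent /(_ hs)[e [_ He]]; rewrite subKr => le.
  by apply: He => //; exact: ltW.
have okl : one_step l.
  move: l0; rewrite le_eqVlt => /orP[/eqP <-|l0']; first by apply: one_step_pure; left.
  by apply: one_step_closed => //; rewrite l0'; case/andP: l01.
have okle l' : 0 <= l' -> l' <= l -> one_step l'.
  by move=> l'0; rewrite le_eqVlt => /orP[/eqP ->//|]; exact: below.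
have lltS : l < lS.
  rewrite lt_neqAle lS' andbT; apply/eqP => E; move: okl; rewrite E.
  by apply: Psi_not_one_step => //; rewrite -E.
have l1l : l < l1.
  rewrite ltNge; apply/negP => l1l; have l101 : 0 <= l1 <= 1.
    by rewrite (ltW l1_gt0) (le_trans l1l)//; case/andP: l01.
  by apply: (Psi_not_one_step l101 P1); apply: okle => //; exact: ltW.
have F2le := one_step_F2 l01 okl.
have F2lt : F2 l 1 < 0.
  rewrite lt_neqAle F2le andbT; apply/eqP => F20.
  exact: (Qpoly_not_one_step l01 F20 (Qpos _ l1l) okl).
have [x x01 Fx] : exists2 x, 0 < x < 1 & F l x = 0.
  apply: contrapT => H.
  have Fneg x : 0 < x -> x < 1 -> F l x < 0.
    move=> x0 x1; rewrite lt_neqAle okl ?(ltW x0) ?(ltW x1)// andbT.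
    by apply/eqP => E; apply: H; exists x; rewrite ?x0.
  have /nbhs_ballP[e /= e0 he] := one_step_open l01 Fneg F2lt.
  pose l' := Num.min lS (l + e / 2).
  have ll' : l < l' by rewrite lt_min lltS/=; lra.
  have l'S : l' <= lS by rewrite ge_min lexx.
  have l'e : l' <= l + e / 2 by rewrite ge_min lexx orbT.
  have : l' <= l; last by rewrite leNgt ll'.
  apply: ub_le_sup; first by case: hs.
  split; first by rewrite l'S (le_trans l0)// ltW.
  move=> t t0 tl'; have [tl|lt] := leP t l; first exact: okle.
  apply: he.
    rewrite /ball/= distrC gtr0_norm ?subr_gt0//; lra.
  by rewrite t0 (le_trans tl')// (le_trans l'S)// ltW.
exists l.
  rewrite lltS andbT lt_neqAle l0 andbT; apply/eqP => E.
  case/andP: x01 => x0 x1; have [H _] := @pure_strict l (or_introl (esym E)).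
  by have := H x x0 x1; rewrite Fx ltxx.
by split => //; exists x.
Qed.

End OneStep.

(** * Piecewise tails *)

Section Pieces.
Context {R : realType}.
Variables (p s : nat).
Hypotheses (p_gt2 : (2 < p)%N) (ps : (p < s)%N).
Variables (a b : R).
Implicit Types (q v m c d e x : R) (N f E : R -> R).
Hypotheses (a0 : 0 <= a) (b0 : 0 <= b) (ab0 : 0 < a + b).
Local Notation X0 := (Xi p s a b).
Local Notation X1 := (Xi1 p s a b).
Local Notation X2 := (Xi2 p s a b).
Local Notation h := (hx p s a b).
Local Notation w := (wx p s a b).
Local Notation F := (Fl p s a b).
Local Notation F1 := (Fl1 p s a b).

(** N is the tail of the measure and f its density; E and E1 are the amounts by which the
    second and the first primitive of 1 / N^2 fall below xi and xi'. *)
Definition primitives N f E E1 c d := [/\ primitive_on (fun x => - N x) f c d,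
  primitive_on (fun x => X1 x - E1 x) (fun x => (N x ^+ 2)^-1) c d
  & primitive_on (fun x => X0 x - E x) (fun x => X1 x - E1 x) c d].

Lemma primitives_cat N f E E1 c d e : c <= d -> d <= e ->
  primitives N f E E1 c d -> primitives N f E E1 d e -> primitives N f E E1 c e.
Proof. by move=> cd de [? ? ?] [? ? ?]; split; exact: primitive_on_cat cd de _ _. Qed.

Lemma line_primitives q v m d N f E E1 : 0 <= q -> q <= d -> 0 < m -> 0 < v - m * (d - q) ->
  (forall x, q <= x < d -> f x = m) ->
  (forall x, q <= x <= d -> [/\ N x = v - m * (x - q), E x = F q v m x & E1 x = F1 q v m x]) ->
  primitives N f E E1 q d.
Proof.
move=> q0 qd m0 l0 fE NE.
have l x : x <= d -> 0 < v - m * (x - q).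
  by move=> xd; apply: (lt_le_trans l0); rewrite lerD2l lerN2 ler_pM2l// lerD2r.
have v0 : 0 < v by have := l q qd; rewrite subrr mulr0 subr0.
have [dF dF1] : C2_on (F q v m) (F1 q v m) (Fl2 p s a b q v m) q d by exact: Fl_C2.
have inv_l x : X2 x - Fl2 p s a b q v m x = ((v - m * (x - q)) ^+ 2)^-1.
  by rewrite /Fl2; ring.
have X1E x : X1 x - F1 q v m x = X1 q + (x - q) / (v * (v - m * (x - q))).
  by rewrite /Fl1; ring.
have dl x : is_derive x 1 (fun x => v - m * (x - q)) (- m).
  apply: (deriv_eq (deriv_sub (deriv_cst v x) (deriv_scale m (deriv_sub (deriv_id x) (deriv_cst q x))))).
  by ring.
have cl x : {for x, continuous (fun x => v - m * (x - q))} by exact: deriv_continuous (dl x).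
have itv x : x \in `[q, d[ -> q <= x <= d.
  by rewrite in_itv/= => /andP[-> /ltW].
split.
- apply: (@primitive_on_derive R _ _ (fun x => - (v - m * (x - q))) (fun=> m)).
  + by move=> x _; rewrite -{2}(opprK m); exact: deriv_opp (dl x).
  + by move=> x _; exact: cst_continuous.
  + by move=> x _; exact: ltW.
  + by move=> x; rewrite in_itv/= => /NE[-> _ _].
  + by move=> x; rewrite in_itv/= => /fE.
- apply: (@primitive_on_derive R _ _ (fun x => X1 x - F1 q v m x) (fun x => ((v - m * (x - q)) ^+ 2)^-1)).
  + move=> x; rewrite in_itv/= => /andP[qx xd].
    by rewrite -inv_l; apply: deriv_sub; [exact: deriv_Xi1|exact: dF1].
  + move=> x; rewrite in_itv/= => /andP[qx xd].
    by apply: continuous_inv; [exact: continuous_pow|rewrite exprn_gt0// l].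
  + by move=> x _; rewrite invr_ge0 sqr_ge0.
  + by move=> x; rewrite in_itv/= => /NE[_ _ ->].
  + by move=> x /itv /NE[-> _ _].
- apply: (@primitive_on_derive R _ _ (fun x => X0 x - F q v m x) (fun x => X1 x - F1 q v m x)).
  + move=> x; rewrite in_itv/= => /andP[qx xd].
    by apply: deriv_sub; [exact: deriv_Xi|exact: dF].
  + move=> x; rewrite in_itv/= => /andP[qx xd].
    exact: (deriv_continuous (deriv_sub (deriv_Xi1 p s a b x) (dF1 x qx xd))).
  + move=> x; rewrite in_itv/= => /andP[qx xd].
    rewrite X1E addr_ge0//; first exact: Xi1_ge0.
    by rewrite divr_ge0 ?subr_ge0// mulr_ge0 ?(ltW v0)// ltW// l.
  + by move=> x; rewrite in_itv/= => /NE[_ -> _].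
  + by move=> x /itv /NE[_ _ ->].
Qed.

Lemma full_primitives c d N f E E1 : 0 < c -> c <= d ->
  (forall x, c <= x < d -> f x = w x) ->
  (forall x, c <= x <= d -> [/\ N x = h x, E x = 0 & E1 x = 0]) ->
  primitives N f E E1 c d.
Proof.
move=> c0 cd fE NE.
have itv x : x \in `[c, d[ -> c <= x <= d by rewrite in_itv/= => /andP[-> /ltW].
have pos x : x \in `[c, d] -> 0 < x by rewrite in_itv/= => /andP[cx _]; exact: lt_le_trans cx.
have pos' x : x \in `[c, d[ -> 0 < x by rewrite in_itv/= => /andP[cx _]; exact: lt_le_trans cx.
split.
- apply: (@primitive_on_derive R _ _ (fun x => - h x) w).
  + move=> x /pos x0; rewrite -[w x]opprK; apply: deriv_opp.
    exact: deriv_hx.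
  + by move=> x /pos x0; exact: (deriv_continuous (deriv_wx p_gt2 ps a0 b0 ab0 x0)).
  + by move=> x /pos x0; apply/ltW/wx_gt0.
  + by move=> x; rewrite in_itv/= => /NE[-> _ _].
  + by move=> x; rewrite in_itv/= => /fE.
- apply: (@primitive_on_derive R _ _ X1 X2).
  + by move=> x _; exact: deriv_Xi1.
  + by move=> x _; exact: (deriv_continuous (deriv_Xi2 p s a b x)).
  + by move=> x /pos x0; apply/ltW/Xi2_gt0.
  + by move=> x; rewrite in_itv/= => /NE[_ _ ->]; rewrite subr0.
  + by move=> x xI; have [-> _ _] := NE x (itv x xI); rewrite hx2// pos'.
- apply: (@primitive_on_derive R _ _ X0 X1).
  + by move=> x _; exact: deriv_Xi.
  + by move=> x _; exact: (deriv_continuous (deriv_Xi1 p s a b x)).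
  + by move=> x /pos x0; apply/ltW/Xi1_gt0.
  + by move=> x; rewrite in_itv/= => /NE[_ -> _]; rewrite subr0.
  + by move=> x /itv /NE[_ _ ->]; rewrite subr0.
Qed.

Variables (v1 m1 v2 m2 q1 q2 : R).

Definition piecewise (f1 f2 f3 : R -> R) x : R :=
  if x < q1 then f1 x else if x < q2 then f2 x else f3 x.
Local Notation density := (piecewise (fun=> m1) w (fun=> m2)).

Hypotheses (q1_gt0 : 0 < q1) (q12 : q1 <= q2) (q2_le1 : q2 <= 1).
Hypotheses (fit_left : left_fit p s a b q1 v1 m1)
  (m2_gt0 : 0 < m2) (line2 : 0 < v2 - m2 * (1 - q2))
  (F_1 : F q2 v2 m2 1 = 0) (F1_1 : F1 q2 v2 m2 1 = 0).
Hypotheses (join : q1 = q2 -> v2 = v1 - m1 * q1)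
  (join1 : q1 < q2 -> h q1 = v1 - m1 * q1) (join2 : q1 < q2 -> h q2 = v2).
Hypotheses (F_left : forall x, 0 <= x -> x <= q1 -> F 0 v1 m1 x <= 0)
  (F_right : forall x, q2 <= x -> x <= 1 -> F q2 v2 m2 x <= 0).

Local Notation N := (piecewise (fun x => v1 - m1 * (x - 0)) h (fun x => v2 - m2 * (x - q2))).
Local Notation E := (piecewise (F 0 v1 m1) (fun=> 0) (F q2 v2 m2)).
Local Notation E1 := (piecewise (F1 0 v1 m1) (fun=> 0) (F1 q2 v2 m2)).

Let m1_gt0 : 0 < m1. Proof. by case: fit_left. Qed.
Let line1 x : x <= q1 -> 0 < v1 - m1 * (x - 0).
Proof.
move=> xq; case: fit_left => m0 l0 _ _; apply: (lt_le_trans l0).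
by rewrite lerD2l lerN2 ler_pM2l// subr0.
Qed.
Let line2x x : x <= 1 -> 0 < v2 - m2 * (x - q2).
Proof. by move=> x1; apply: (lt_le_trans line2); rewrite lerD2l lerN2 ler_pM2l// lerD2r. Qed.

Let pw_left f1 f2 f3 x : x < q1 -> piecewise f1 f2 f3 x = f1 x.
Proof. by rewrite /piecewise => ->. Qed.
Let pw_mid f1 f2 f3 x : q1 <= x -> x < q2 -> piecewise f1 f2 f3 x = f2 x.
Proof. by move=> qx xq; rewrite /piecewise ltNge qx xq. Qed.
Let pw_right f1 f2 f3 x : q2 <= x -> piecewise f1 f2 f3 x = f3 x.
Proof. by move=> qx; rewrite /piecewise !ltNge qx (le_trans q12 qx). Qed.

Let N_q1 : N q1 = v1 - m1 * (q1 - 0).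
Proof.
move: q12; rewrite subr0 le_eqVlt => /orP[/eqP e|lt].
  have q21 : q2 <= q1 by rewrite e.
  by rewrite pw_right// (join e) e subrr mulr0 subr0.
by rewrite pw_mid// join1.
Qed.

Let E_q1 : E q1 = 0.
Proof.
move: q12; rewrite le_eqVlt => /orP[/eqP e|lt]; last by rewrite pw_mid.
have q21 : q2 <= q1 by rewrite e.
by rewrite pw_right// e Fl_q.
Qed.

Let E1_q1 : E1 q1 = 0.
Proof.
move: q12; rewrite le_eqVlt => /orP[/eqP e|lt]; last by rewrite pw_mid.
have q21 : q2 <= q1 by rewrite e.
by rewrite pw_right// e Fl1_q.
Qed.

Let primitives_left : primitives N density E E1 0 q1.
Proof.
have [_ _ Fq F1q] := fit_left.
apply: (@line_primitives 0 v1 m1) => //; first exact: ltW.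
- exact: line1.
- by move=> x /andP[_ xq]; rewrite pw_left.
move=> x /andP[_]; rewrite le_eqVlt => /orP[/eqP ->|xq]; last by rewrite !pw_left.
by rewrite N_q1 E_q1 E1_q1 Fq F1q.
Qed.

Let primitives_mid : q1 < q2 -> primitives N density E E1 q1 q2.
Proof.
move=> lt; apply: full_primitives => //.
  by move=> x /andP[qx xq]; rewrite pw_mid.
move=> x /andP[qx]; rewrite le_eqVlt => /orP[/eqP ->|xq]; last by rewrite !pw_mid.
by rewrite !pw_right// Fl_q Fl1_q subrr mulr0 subr0 join2.
Qed.

Let primitives_right : primitives N density E E1 q2 1.
Proof.
apply: (@line_primitives q2 v2 m2) => //; first exact: (le_trans (ltW q1_gt0)).
- by move=> x /andP[qx _]; rewrite pw_right.
- by move=> x /andP[qx _]; rewrite !pw_right.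
Qed.

Let primitives01 : primitives N density E E1 0 1.
Proof.
apply: (primitives_cat (ltW q1_gt0) (le_trans q12 q2_le1) primitives_left).
move: q12; rewrite le_eqVlt => /orP[/eqP ->//|lt].
exact: (primitives_cat (ltW lt) q2_le1 (primitives_mid lt)).
Qed.

Lemma derive1_Xi : X0^`()%classic = X1.
Proof. by apply/funext => x; rewrite derive1E; have [_ <-] := deriv_Xi p s a b x. Qed.

(** An affine tail on [0, q1], the tail h on [q1, q2] and an affine tail on [q2, 1]; either of
    the last two pieces may be empty. *)
Lemma three_pieces nu : admissible_density density ->
  has_density_atom nu density (v2 - m2 * (1 - q2)) -> is_parisi_measure X0 nu.
Proof.
move=> fadm; have [pN pc pA] := primitives01.
have q1_ge0 := ltW q1_gt0; have zero_q1 := pw_left _ _ _ q1_gt0.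
have one_q2 f1 f2 f3 : piecewise f1 f2 f3 1 = f3 1 by rewrite pw_right.
have Ele0 x : x \in `[0, 1] -> E x <= 0.
  rewrite in_itv/= => /andP[x0 x1]; rewrite /piecewise.
  by case: ltP => [xq|qx]; [exact: F_left (ltW xq)|case: ltP => // q2x; exact: F_right].
apply: (@parisi_certificate R X0 N (fun x => X1 x - E1 x) (fun x => X0 x - E x) density
  (v2 - m2 * (1 - q2)) m1 m2 q1 q2) => //.
- by rewrite derive1_Xi => x; exact: (deriv_continuous (deriv_Xi1 p s a b x)).
- by rewrite derive1_Xi => x x0; exact: Xi1_ge0.
- rewrite derive1_Xi; apply: (@primitive_on_derive R _ _ X0 X1) => //.
  + by move=> x _; exact: deriv_Xi.
  + by move=> x _; exact: (deriv_continuous (deriv_Xi1 p s a b x)).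
  + by move=> x; rewrite in_itv/= => /andP[x0 _]; exact: Xi1_ge0.
- exact: Xi_0.
- move=> x; rewrite in_itv/= => /andP[x0 x1]; rewrite /piecewise.
  have [xq|qx] := ltP x q1; first by apply: line1; exact: ltW.
  by have [_|_] := ltP x q2; [apply: hx_gt0 => //; exact: lt_le_trans qx|exact: line2x].
- by rewrite zero_q1 Fl1_q subr0 (Xi1_0 p_gt2 ps).
- by rewrite derive1_Xi one_q2 F1_1 subr0.
- by rewrite zero_q1 Fl_q subr0 (Xi_0 p_gt2 ps).
- by rewrite one_q2 F_1 subr0.
- by move=> x x01; rewrite lerBrDr gerDl Ele0.
- by move=> x; rewrite in_itv/= => /andP[_ xq]; rewrite pw_left.
- by move=> x; rewrite in_itv/= => /andP[qx _]; rewrite pw_right.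
- by move=> x; rewrite in_itv/= derive1_Xi => /andP[qx xq]; rewrite pw_mid// subr0.
- by rewrite E_q1 subr0.
- by rewrite pw_right// Fl_q subr0.
Qed.

End Pieces.

(** * Parisi measures of each type *)

Section Admissible.
Context {R : realType}.
Implicit Types (f g : R -> R) (x y : R).

Lemma right_cvg f g x d : x < d -> (forall y, x <= y < d -> f y = g y) ->
  {for x, continuous g} -> f y @[y --> x^'+] --> f x.
Proof.
move=> xd fg cg; rewrite (fg x) ?lexx//.
apply: cvg_trans (cvg_at_right_filter cg); apply: near_eq_cvg; near=> y.
apply/esym/fg; apply/andP; split; first by near: y; exact: nbhs_right_ge.
by near: y; exact: nbhs_right_lt.
Unshelve. all: by end_near. Qed.

Variables (q1 q2 m1 m2 : R) (w : R -> R).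
Hypotheses (q12 : q1 <= q2) (m1_ge0 : 0 <= m1) (m12 : q2 < 1 -> m1 <= m2).
Hypotheses (cw : forall x, q1 <= x -> x < q2 -> {for x, continuous w})
  (w_nd : forall x y, q1 <= x -> x <= y -> y < q2 -> w x <= w y)
  (m1w : forall x, q1 <= x -> x < q2 -> m1 <= w x)
  (wm2 : forall x, q1 <= x -> x < q2 -> q2 < 1 -> w x <= m2).

Lemma admissible_pieces : admissible_density (piecewise q1 q2 (fun=> m1) w (fun=> m2)).
Proof.
split=> [x /[!in_itv]/= /andP[x0 x1]|x /[!in_itv]/= /andP[x0 x1]|x y /[!in_itv]/= /andP[x0 x1] /andP[y0 y1] xy].
- rewrite /piecewise; have [//|qx] := ltP x q1.
  have [xq|q2x] := ltP x q2; first exact: le_trans (m1w qx xq).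
  by apply: (le_trans m1_ge0); apply: m12; exact: le_lt_trans x1.
- have [xq|qx] := ltP x q1.
    apply: (@right_cvg _ (fun=> m1) _ q1) => //; last exact: cst_continuous.
    by move=> y /andP[_ yq]; rewrite /piecewise yq.
  have [xq|q2x] := ltP x q2.
    apply: (@right_cvg _ w _ q2) => //; last exact: cw.
    by move=> y /andP[xy yq]; rewrite /piecewise ltNge (le_trans qx xy) yq.
  apply: (@right_cvg _ (fun=> m2) _ 1) => //; last exact: cst_continuous.
  move=> y /andP[xy y1]; have q2y := le_trans q2x xy.
  by rewrite /piecewise !ltNge q2y (le_trans q12 q2y).
- rewrite /piecewise; have [xq|qx] := ltP x q1.
    have [//|qy] := ltP y q1; have [yq|q2y] := ltP y q2; first exact: m1w.
    by apply: m12; exact: le_lt_trans y1.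
  rewrite (ltNge y q1) (le_trans qx xy)/=; have [xq|q2x] := ltP x q2; last first.
    by rewrite (ltNge y q2) (le_trans q2x xy).
  have [yq|q2y] := ltP y q2; first exact: w_nd.
  by apply: wm2 => //; exact: le_lt_trans y1.
Qed.

End Admissible.

Section AtomicCdf.
Context {R : realType}.
Variables (m d q : R).
Hypotheses (m0 : 0 < m) (d0 : 0 <= d) (q0 : 0 < q) (q1 : q < 1).

(** Its cumulative function is m on [0, q) and m + d on [q, 1). *)
Definition two_atoms : borel_measure R :=
  measure_add (mscale (NngNum (ltW m0)) (dirac (0 : measurableTypeR R)))
    (mscale (NngNum d0) (dirac (q : measurableTypeR R))).

Lemma two_atomsE A : two_atoms A = (m%:E * \d_(0%R : measurableTypeR R) A + d%:E * \d_(q : measurableTypeR R) A)%E.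
Proof. by rewrite /two_atoms /measure_add/= /msum 2!big_ord_recl/= big_ord0 adde0. Qed.

Lemma two_atoms_cdf : has_cdf01 two_atoms (fun x => if x < q then m else m + d).
Proof.
split.
  rewrite two_atomsE !diracE !memNset ?mule0 ?adde0//= in_itv/= ?lexx ?ltr01 ?(ltW q0) ?q1//; exact.
move=> x; rewrite in_itv/= => /andP[x0 x1]; rewrite two_atomsE !diracE.
rewrite mem_set ?mule1/=; last by rewrite in_itv/= lexx.
have [xq|qx] := ltP x q.
  by rewrite memNset ?mule0 ?adde0//= in_itv/= (leNgt q x) xq andbF.
by rewrite mem_set ?mule1//= in_itv/= qx ltW.
Qed.

(** The mass d may be 0, so that one family serves for both one and two atoms. *)
Lemma two_atoms_support : support01 two_atoms = [set 0] `|` (if 0 < d then [set q] else set0).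
Proof.
have in0 : (0 : R) \in `[0, 1[ by rewrite in_itv/= lexx ltr01.
have inq : q \in `[0, 1[ by rewrite in_itv/= (ltW q0).
have closed1 (z : R) : closed [set z].
  exact/accessible_closed_set1/hausdorff_accessible/Rhausdorff.
apply/seteqP; split=> [x [x01 Hx]|x].
  apply: contrapT => /not_orP[/eqP x_0 x_q].
  have oU : open (~` [set 0] `&` ~` [set q]).
    by apply: openI; apply: closed_openC; exact: closed1.
  have [xq|xq] := eqVneq x q.
    have d_0 : d = 0.
      apply/le_anti; rewrite d0 andbT leNgt; apply/negP => d_gt0.
      by move: x_q; rewrite d_gt0.
    have := Hx (~` [set 0]) (closed_openC (closed1 0)).
    move=> /(_ (fun e => elimN eqP x_0 e)).
    by rewrite two_atomsE d_0 mul0e adde0 diracE memNset ?mule0 ?ltxx//= => -[]; exact.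
  have := Hx _ oU; rewrite two_atomsE !diracE !memNset ?mule0 ?adde0 ?ltxx.
  - by move=> /(_ (conj (elimN eqP x_0) (elimN eqP xq))).
  - by move=> [[_ +] _]; exact.
  - by move=> [[+ _] _]; exact.
have nonneg A : (0 <= m%:E * \d_(0%R : measurableTypeR R) A)%E by rewrite mule_ge0// lee_fin ltW.
have nonneg' A : (0 <= d%:E * \d_(q : measurableTypeR R) A)%E by rewrite mule_ge0.
move=> [->|].
  split => // U oU U0; rewrite two_atomsE; apply: (@lt_le_trans _ _ m%:E); first by rewrite lte_fin.
  by rewrite {1}diracE mem_set ?mule1 ?leeDl.
case: ifPn => // d_gt0 ->; split => // U oU Uq; rewrite two_atomsE.
apply: (@lt_le_trans _ _ d%:E); first by rewrite lte_fin.
by rewrite [X in (_ <= _ + _ * X)%E]diracE mem_set ?mule1 ?leeDr.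
Qed.

End AtomicCdf.

Section Phases.
Context {R : realType}.
Variables (p s : nat).
Hypotheses (p_gt2 : (2 < p)%N) (ps : (p < s)%N).
Variables (a b : R).
Hypotheses (a0 : 0 <= a) (b0 : 0 <= b) (ab0 : 0 < a + b).
Local Notation X0 := (Xi p s a b).
Local Notation h := (hx p s a b).
Local Notation w := (wx p s a b).
Local Notation F := (Fl p s a b).
Local Notation F1 := (Fl1 p s a b).
Local Notation fit := (left_fit p s a b).
Implicit Types (q v m x D : R).

Let dens_eq q1 q2 f1 f2 f3 (nu : borel_measure R) (g : R -> R) D :
  (forall x, 0 <= x -> x < 1 -> g x = piecewise q1 q2 f1 f2 f3 x) ->
  has_density_atom nu (piecewise q1 q2 f1 f2 f3) D -> has_density_atom nu g D.
Proof.
move=> e nuE A mA; rewrite nuE//; congr (_ + _)%E; apply: eq_integral => x.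
by rewrite inE => -[_ /=]; rewrite in_itv/= => /andP[x0 x1]; rewrite e.
Qed.

Let w_continuous x : 0 < x -> {for x, continuous w}.
Proof. by move=> x0; exact: (deriv_continuous (deriv_wx p_gt2 ps a0 b0 ab0 x0)). Qed.

Lemma kRSB_1 v m : fit 1 v m -> (forall x, 0 <= x -> x <= 1 -> F 0 v m x <= 0) -> kRSB X0 1.
Proof.
move=> f Fle; have [m0 l0 F_1 F1_1] := f.
(* The last piece is empty: it starts at 1 with the value v - m. *)
pose D := v - m - m * (1 - 1).
have DE : D = v - m * 1 by rewrite /D subrr mulr0 mulr1 subr0.
have D0 : 0 < D by rewrite DE.
pose g := piecewise 1 1 (fun=> m) w (fun=> m).
have gadm : admissible_density g.
  apply: admissible_pieces => //; first exact: ltW.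
  - by move=> x x1 /(le_lt_trans x1); rewrite ltxx.
  - by move=> x y x1 xy /(le_lt_trans xy) /(le_lt_trans x1); rewrite ltxx.
  - by move=> x x1 /(le_lt_trans x1); rewrite ltxx.
  - by move=> x x1 /(le_lt_trans x1); rewrite ltxx.
have nuE := density_atomP (adm_ge0 gadm) (admissible_measurable gadm) (ltW D0).
exists (density_atom (adm_ge0 gadm) (admissible_measurable gadm) (ltW D0)), g, D.
(* The second atom has mass 0, at an arbitrary place. *)
exists (two_atoms 2^-1 m0 (lexx 0)); split => //.
- apply: (three_pieces p_gt2 ps a0 b0 ab0 (v1 := v) (m1 := m) (v2 := v - m) (m2 := m) (q1 := 1) (q2 := 1)) => //.
  + exact: Fl_q.
  + exact: Fl1_q.
  + by rewrite mulr1.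
  + by rewrite ltxx.
  + by rewrite ltxx.
  + by move=> x x1 x1'; have -> : x = 1 by [apply/le_anti; rewrite x1 x1']; rewrite Fl_q.
- have h0 : 0 < 2^-1 :> R by rewrite invr_gt0.
  have h1 : 2^-1 < 1 :> R by rewrite invf_lt1// ltr1n.
  have [e H] := two_atoms_cdf m0 (lexx 0) h0 h1; split => // x x01; rewrite H// addr0 if_same.
  by move: x01; rewrite in_itv/= /g /piecewise => /andP[_ ->].
- rewrite two_atoms_support ?ltxx ?setU0; last 2 first.
  + by rewrite invr_gt0.
  + by rewrite invf_lt1// ltr1n.
  exact: card_set1.
Qed.

Lemma kRSB_2 q v1 m1 m2 : 0 < q -> q < 1 -> fit q v1 m1 -> m1 < m2 ->
  0 < v1 - m1 * q - m2 * (1 - q) ->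
  F q (v1 - m1 * q) m2 1 = 0 -> F1 q (v1 - m1 * q) m2 1 = 0 ->
  (forall x, 0 <= x -> x <= q -> F 0 v1 m1 x <= 0) ->
  (forall x, q <= x -> x <= 1 -> F q (v1 - m1 * q) m2 x <= 0) -> kRSB X0 2.
Proof.
move=> q0 q1 f mm D0 F_1 F1_1 Fl Fr; have [m0 l0 _ _] := f; have m20 := lt_trans m0 mm.
have d0 : 0 <= m2 - m1 by rewrite subr_ge0 ltW.
pose g := piecewise q q (fun=> m1) w (fun=> m2).
have gadm : admissible_density g.
  apply: admissible_pieces => //; first exact: ltW.
  - by move=> _; exact: ltW.
  - by move=> x x1 /(le_lt_trans x1); rewrite ltxx.
  - by move=> x y x1 xy /(le_lt_trans xy) /(le_lt_trans x1); rewrite ltxx.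
  - by move=> x x1 /(le_lt_trans x1); rewrite ltxx.
  - by move=> x x1 /(le_lt_trans x1); rewrite ltxx.
have nuE := density_atomP (adm_ge0 gadm) (admissible_measurable gadm) (ltW D0).
exists (density_atom (adm_ge0 gadm) (admissible_measurable gadm) (ltW D0)), g, (v1 - m1 * q - m2 * (1 - q)).
exists (two_atoms q m0 d0); split => //.
- apply: (three_pieces p_gt2 ps a0 b0 ab0 (v1 := v1) (m1 := m1) (v2 := v1 - m1 * q) (m2 := m2) (q1 := q) (q2 := q)) => //.
  + exact: ltW.
  + by rewrite ltxx.
  + by rewrite ltxx.
- have [e H] := two_atoms_cdf m0 d0 q0 q1; split => // x x01; rewrite H// /g /piecewise.
  by case: ltP => //; rewrite addrC subrK.
- rewrite two_atoms_support// subr_gt0 mm; apply/eq_cardSP; exists q; first by right.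
  have -> : ([set 0] `|` [set q]) `\ q = [set 0]; last exact: card_set1.
  apply/seteqP; split=> [x [[//|->] []//]|x ->]; split; first by left.
  by move=> /= e; move: q0; rewrite e ltxx.
Qed.

Lemma oneFRSB_left q v m : 0 < q -> q < 1 -> fit q v m -> h q = v - m * q ->
  (forall x, 0 <= x -> x <= q -> F 0 v m x <= 0) ->
  m <= w q -> (forall x y, q <= x -> x < y -> y <= 1 -> w x < w y) -> oneFRSB X0.
Proof.
move=> q0 q1 f hq Fle mw w_inc; have [m0 l0 _ _] := f.
have h1 : 0 < h 1 by exact: hx_gt0.
have w_le x y : q <= x -> x <= y -> y < 1 -> w x <= w y.
  move=> qx; rewrite le_eqVlt => /orP[/eqP ->//|xy] y1.
  by apply/ltW/w_inc => //; exact: ltW.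
pose D := h 1 - m * (1 - 1).
have DE : D = h 1 by rewrite /D subrr mulr0 subr0.
have D0 : 0 < D by rewrite DE.
pose g := piecewise q 1 (fun=> m) w (fun=> m).
have gadm : admissible_density g.
  apply: admissible_pieces => //; try exact: ltW.
  - by move=> x qx _; apply: w_continuous; exact: lt_le_trans qx.
  - by move=> x qx x1; apply: (le_trans mw); exact: w_le.
  - by move=> x _ _; rewrite ltxx.
have nuE := density_atomP (adm_ge0 gadm) (admissible_measurable gadm) (ltW D0).
exists (density_atom (adm_ge0 gadm) (admissible_measurable gadm) (ltW D0)), D, q, m, w; split => //.
- apply: (three_pieces p_gt2 ps a0 b0 ab0 (v1 := v) (m1 := m) (v2 := h 1) (m2 := m) (q1 := q) (q2 := 1)) => //.
  + exact: ltW.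
  + exact: Fl_q.
  + exact: Fl1_q.
  + by move=> e; move: q1; rewrite e ltxx.
  + by move=> x x1 x1'; have -> : x = 1 by [apply/le_anti; rewrite x1 x1']; rewrite Fl_q.
- by rewrite q0.
left; split.
  move=> x y /[!in_itv]/= /andP[qx _] /andP[_ y1] xy.
  by apply: w_inc => //; exact: ltW.
apply: dens_eq nuE => x x0 x1; rewrite /piecewise.
by case: ltP => // _; rewrite x1.
Qed.

Lemma twoFRSB_mid q1 q2 v1 m1 m2 : 0 < q1 -> q1 < q2 -> q2 < 1 ->
  fit q1 v1 m1 -> h q1 = v1 - m1 * q1 -> 0 < m2 -> 0 < h q2 - m2 * (1 - q2) ->
  F q2 (h q2) m2 1 = 0 -> F1 q2 (h q2) m2 1 = 0 ->
  (forall x, 0 <= x -> x <= q1 -> F 0 v1 m1 x <= 0) ->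
  (forall x, q2 <= x -> x <= 1 -> F q2 (h q2) m2 x <= 0) ->
  m1 <= w q1 -> (forall x y, q1 <= x -> x < y -> y <= q2 -> w x < w y) -> w q2 <= m2 ->
  twoFRSB X0.
Proof.
move=> q10 q12 q21 f hq m20 D0 F_1 F1_1 Fl Fr mw w_inc wm; have [m0 l0 _ _] := f.
have w_le x y : q1 <= x -> x <= y -> y <= q2 -> w x <= w y.
  move=> qx; rewrite le_eqVlt => /orP[/eqP ->//|xy] yq.
  by apply/ltW/w_inc.
pose g := piecewise q1 q2 (fun=> m1) w (fun=> m2).
have gadm : admissible_density g.
  apply: admissible_pieces => //; try exact: ltW.
  - by move=> _; apply: (le_trans mw); apply: le_trans wm; apply: w_le => //; exact: ltW.
  - by move=> x qx _; apply: w_continuous; exact: lt_le_trans qx.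
  - by move=> x y qx xy /ltW; exact: w_le.
  - by move=> x qx /ltW xq; apply: (le_trans mw); exact: w_le.
  - by move=> x qx /ltW xq _; apply: le_trans wm; exact: w_le.
have nuE := density_atomP (adm_ge0 gadm) (admissible_measurable gadm) (ltW D0).
exists (density_atom (adm_ge0 gadm) (admissible_measurable gadm) (ltW D0)), (h q2 - m2 * (1 - q2)), q1, q2, m1, m2, w; split => //.
- apply: (three_pieces p_gt2 ps a0 b0 ab0 (v1 := v1) (m1 := m1) (v2 := h q2) (m2 := m2) (q1 := q1) (q2 := q2)) => //.
  + exact: ltW.
  + exact: ltW.
  + by move=> e; move: q12; rewrite e ltxx.
- by rewrite (ltW q10).
move=> x y /[!in_itv]/= /andP[qx _] /andP[_ yq] xy.
by apply: w_inc => //; exact: ltW.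
Qed.

End Phases.

(** * The phase diagram *)

Section ZoomedPhases.
Context {R : realType}.
Variables (p s : nat).
Hypotheses (p_gt2 : (2 < p)%N) (ps : (p < s)%N).
Variable X : R.
Hypothesis X_gt0 : 0 < X.
Local Notation l := (lam p s X).
Local Notation k := (zoom p s X).
Local Notation X0 := (Xi p s (1 : R) 1).
Local Notation h := (hx p s (1 : R) 1).
Local Notation w := (wx p s (1 : R) 1).
Local Notation F := (Fl p s (1 : R) 1).
Local Notation F1 := (Fl1 p s (1 : R) 1).
Local Notation vf := (vfit p s (1 : R) 1).
Local Notation mf := (mfit p s (1 : R) 1).
Local Notation df := (dfit p s (1 : R) 1).
Implicit Types (q v m x y : R).

Let a0 : 0 <= l. Proof. by case/andP: (@lam_itv R p s X X_gt0) => /ltW. Qed.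
Let b0 : 0 <= 1 - l.
Proof. by rewrite subr_ge0; case/andP: (@lam_itv R p s X X_gt0) => _ /ltW. Qed.
Let ab0 : 0 < l + (1 - l). Proof. by rewrite addrC subrK. Qed.
Let k0 : 0 < k. Proof. exact: zoom_gt0. Qed.
Let kX0 : 0 < k * X. Proof. exact: (mulr_gt0 k0 X_gt0). Qed.
Let c0 : 0 < X0 X. Proof. by apply: Xi_gt0 => //; lra. Qed.

Let XqK q : X * (q / X) = q. Proof. by rewrite mulrC divfK// gt_eqF. Qed.
Let q_gt0 q : 0 < q -> 0 < q / X. Proof. by move=> q0; rewrite divr_gt0. Qed.
Let q_lt1 q : q < X -> q / X < 1. Proof. by move=> qX; rewrite ltr_pdivrMr// mul1r. Qed.
Let le_q q x : x <= q / X -> X * x <= q.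
Proof. by rewrite ler_pdivlMr// mulrC. Qed.
Let ge_q q x : q / X <= x -> q <= X * x.
Proof. by rewrite ler_pdivrMr// mulrC. Qed.
Let le_X x : x <= 1 -> X * x <= X.
Proof. by move=> x1; rewrite ler_piMr// ltW. Qed.
Let ge_0 x : 0 <= x -> 0 <= X * x.
Proof. by move=> x0; rewrite mulr_ge0// ltW. Qed.

Let fit_q q : 0 < q -> left_fit p s l (1 - l) (q / X) (k * vf q) (k * X * mf q).
Proof.
move=> q0; apply: left_fit_zoom => //; first exact: q_gt0.
by rewrite XqK; exact: fitP.
Qed.

Let end_q q : 0 < q -> k * vf q - k * X * mf q * (q / X) = k * df q.
Proof.
move=> q0; have -> : k * X * mf q * (q / X) = k * mf q * (X * (q / X)) by ring.
by rewrite XqK -(vmfit p s 1 1 q0); ring.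
Qed.

Let F_left_le0 q : 0 < q -> (forall x, 0 <= x -> x <= q -> F 0 (vf q) (mf q) x <= 0) ->
  forall x, 0 <= x -> x <= q / X -> Fl p s l (1 - l) 0 (k * vf q) (k * X * mf q) x <= 0.
Proof.
move=> q0 Fle x x0 xq; have f := fitP p_gt2 ps q0; have [m0 _ _ _] := f.
rewrite Fl_zoom//; last exact: (fit_v q0 f).
rewrite mulr0 pmulr_lle0 ?invr_gt0//; apply: Fle; [exact: ge_0|exact: le_q].
Qed.

Let F_right_le0 q v m : 0 < v -> 0 < m -> (forall x, q <= x -> x <= X -> F q v m x <= 0) ->
  forall x, q / X <= x -> x <= 1 -> Fl p s l (1 - l) (q / X) (k * v) (k * X * m) x <= 0.
Proof.
move=> v0 m0 Fle x xq x1; rewrite Fl_zoom// XqK pmulr_lle0 ?invr_gt0//.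
by apply: Fle; [exact: ge_q|exact: le_X].
Qed.

Let line_q q v m : 0 < v - m * (X - q) -> 0 < k * v - k * X * m * (1 - q / X).
Proof. by move=> l0; rewrite line_zoom mulr1 XqK mulr_gt0. Qed.

Let F_end q v m : 0 < v -> 0 < m -> F q v m X = 0 ->
  Fl p s l (1 - l) (q / X) (k * v) (k * X * m) 1 = 0.
Proof. by move=> v0 m0 e; rewrite Fl_zoom// XqK mulr1 e mul0r. Qed.

Let F1_end q v m : 0 < v -> 0 < v - m * (X - q) -> F1 q v m X = 0 ->
  Fl1 p s l (1 - l) (q / X) (k * v) (k * X * m) 1 = 0.
Proof. by move=> v0 l0 e; rewrite Fl1_zoom// XqK mulr1 ?e ?mulr0 ?mul0r. Qed.

Lemma zoom_F x : Fl p s l (1 - l) 0 (vfit p s l (1 - l) 1) (mfit p s l (1 - l) 1) x =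
  F 0 (vf X) (mf X) (X * x) / X0 X.
Proof.
have f := fitP p_gt2 ps X_gt0; have [m0 _ _ _] := f.
have [-> ->] := fit_zoom p_gt2 ps X_gt0 (ltr01 : 0 < (1 : R)).
by rewrite mulr1 Fl_zoom ?mulr0//; exact: (fit_v X_gt0 f).
Qed.

Lemma zoom_one_step : (forall x, 0 <= x -> x <= X -> F 0 (vf X) (mf X) x <= 0) <-> one_step p s l.
Proof.
split=> H x x0 x1.
  by rewrite zoom_F pmulr_lle0 ?invr_gt0// H// ?ge_0// le_X.
have := H (x / X); rewrite zoom_F XqK pmulr_lle0 ?invr_gt0//; apply.
  by rewrite divr_ge0// ltW.
by rewrite ler_pdivrMr// mul1r.
Qed.

Lemma zoom_kRSB_2 q m : 0 < q -> q < X -> mf q < m -> 0 < df q - m * (X - q) ->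
  F q (df q) m X = 0 -> F1 q (df q) m X = 0 ->
  (forall x, 0 <= x -> x <= q -> F 0 (vf q) (mf q) x <= 0) ->
  (forall x, q <= x -> x <= X -> F q (df q) m x <= 0) -> kRSB (mixture p s l) 2.
Proof.
move=> q0 qX mm l0 FX F1X Fl Fr.
have [m0 _ _ _] := fitP p_gt2 ps q0; have m0' := lt_trans m0 mm.
have d0 : 0 < df q by apply: dfit_gt0 => //; lra.
apply: (kRSB_2 p_gt2 ps a0 b0 ab0 (q := q / X) (v1 := k * vf q) (m1 := k * X * mf q) (m2 := k * X * m));
  rewrite ?end_q//.
- exact: q_gt0.
- exact: q_lt1.
- exact: fit_q.
- by rewrite (ltr_pM2l kX0).
- exact: line_q.
- exact: F_end.
- exact: F1_end.
- exact: F_left_le0.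
- exact: F_right_le0.
Qed.

Lemma zoom_h q : 0 < q -> hx p s l (1 - l) (q / X) = k * h q.
Proof. by move=> q0; rewrite hx_zoom ?XqK// q_gt0. Qed.

Lemma zoom_w q : 0 < q -> wx p s l (1 - l) (q / X) = k * X * w q.
Proof. by move=> q0; rewrite wx_zoom ?XqK// q_gt0. Qed.

Let w_incr q q' : 0 < q -> (forall x y, q <= x -> x < y -> y <= q' -> w x < w y) ->
  forall x y, q / X <= x -> x < y -> y <= q' / X -> wx p s l (1 - l) x < wx p s l (1 - l) y.
Proof.
move=> q0 H x y qx xy yq; have x0 := lt_le_trans (q_gt0 q0) qx.
rewrite !wx_zoom//; last exact: lt_trans xy.
rewrite (ltr_pM2l kX0); apply: H; [exact: ge_q|by rewrite ltr_pM2l|exact: le_q].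
Qed.

Lemma zoom_oneFRSB q : 0 < q -> q < X -> h q = df q ->
  (forall x, 0 <= x -> x <= q -> F 0 (vf q) (mf q) x <= 0) -> mf q <= w q ->
  (forall x y, q <= x -> x < y -> y <= X -> w x < w y) -> oneFRSB (mixture p s l).
Proof.
move=> q0 qX hq Fle mw wi.
apply: (oneFRSB_left p_gt2 ps a0 b0 ab0 (q := q / X) (v := k * vf q) (m := k * X * mf q)).
- exact: q_gt0.
- exact: q_lt1.
- exact: fit_q.
- by rewrite end_q// zoom_h// hq.
- exact: F_left_le0.
- by rewrite zoom_w// (ler_pM2l kX0).
- by have := w_incr q0 wi; rewrite divff// gt_eqF.
Qed.

Lemma zoom_twoFRSB q1 q2 m : 0 < q1 -> q1 < q2 -> q2 < X -> h q1 = df q1 -> 0 < m ->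
  0 < h q2 - m * (X - q2) -> F q2 (h q2) m X = 0 -> F1 q2 (h q2) m X = 0 ->
  (forall x, 0 <= x -> x <= q1 -> F 0 (vf q1) (mf q1) x <= 0) ->
  (forall x, q2 <= x -> x <= X -> F q2 (h q2) m x <= 0) ->
  mf q1 <= w q1 -> (forall x y, q1 <= x -> x < y -> y <= q2 -> w x < w y) -> w q2 <= m ->
  twoFRSB (mixture p s l).
Proof.
move=> q10 q12 q2X hq m0 l0 FX F1X Fl Fr mw wi wm.
have q20 := lt_trans q10 q12.
have h0 : 0 < h q2 by apply: hx_gt0 => //; lra.
apply: (twoFRSB_mid p_gt2 ps a0 b0 ab0 (q1 := q1 / X) (q2 := q2 / X) (v1 := k * vf q1)
  (m1 := k * X * mf q1) (m2 := k * X * m)); rewrite ?zoom_h ?zoom_w ?end_q ?hq ?(ler_pM2l kX0)//.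
- exact: q_gt0.
- by rewrite ltr_pM2r// invr_gt0.
- exact: q_lt1.
- exact: fit_q.
- exact: mulr_gt0.
- exact: line_q.
- exact: F_end.
- exact: F1_end.
- exact: F_left_le0.
- exact: F_right_le0.
- exact: w_incr.
Qed.

End ZoomedPhases.

Theorem theorem4 (R : realType) (p s : nat) (hp : (2 < p)%N) (hps : (p <= s)%N)
    (hDelta : 0 < Delta R p s)
    (l1s l2s : R) (hQ : ordered_real_roots (Qpoly p s) l1s l2s)
    (l21F l21F' : R) (hS : ordered_real_roots (Spoly p s) l21F l21F')
    (hPsi1 : 0 < Psi p s l1s) (hPsi2 : 0 < Psi p s l21F) :
  exists l12 l22F l21 : R,
    [/\ [/\ 0 < l12, l12 < l22F, l22F < l21F, l21F < l21 & l21 < 1],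
        forall l : R, 0 <= l <= l12 \/ l21 <= l <= 1 -> kRSB (mixture p s l) 1,
        forall l : R, l12 < l <= l22F -> kRSB (mixture p s l) 2,
        forall l : R, l22F < l < l21F -> twoFRSB (mixture p s l)
      & forall l : R, l21F <= l < l21 -> oneFRSB (mixture p s l)].
Proof.
have ps := Delta_lt hp hps hDelta.
have [x1 [x2 [[x10 x12 e2 e1] [form1 form2 form3]]]] := inflections hp ps hDelta hS.
have x20 := lt_trans x10 x12.
have egap_x2 : egap p s x2 < 0 by apply: Psi_egap => //; rewrite e2.
have [xb /[dup] xb12 /andP[x1b xb2] [eb egap_ge0]] := critical_exists hp ps x10 x12 form1 egap_x2.
have xb0 := lt_trans x10 x1b.
have hb : hx p s 1 1 xb = dfit p s 1 1 xb by apply/eqP; rewrite -subr_eq0; apply/eqP.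
have l21F01 : 0 < l21F < 1 by rewrite -e2; exact: lam_itv.
have [l12 /andP[l120 l12S] [ok_le [t /andP[t0 t1] Ft]]] := first_touch hp ps l21F01 hPsi2 hQ hPsi1.
have [|Xt Xt0 et] := @lam_surj R p s ps l12.
  by rewrite l120 (lt_trans l12S)//; case/andP: l21F01.
have x2t : x2 < Xt by rewrite -(lam_lt ps x20 Xt0) e2 et.
have Fle_t := (zoom_one_step hp ps Xt0).2 (eq_ind_r (one_step p s) (ok_le l12 (ltW l120) (lexx _)) et).
have qc0 : 0 < Xt * t by rewrite mulr_gt0.
have qct : Xt * t < Xt by rewrite gtr_pMr.
have F_touch : Fl p s 1 1 0 (vfit p s 1 1 Xt) (mfit p s 1 1 Xt) (Xt * t) = 0.
  have := zoom_F hp ps Xt0 t; rewrite et Ft => /esym/eqP.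
  have c0 : 0 < Xi p s 1 1 Xt by apply: Xi_gt0 => //; lra.
  by rewrite mulf_eq0 invr_eq0 (gt_eqF c0) orbF => /eqP.
have Tt := touch_T_gt0 hp ps x10 x12 form1 form2 form3 egap_x2 xb12 eb egap_ge0 x2t qc0 qct F_touch Fle_t.
have [b /andP[x2b bt] [Tneg Tpos]] := T_threshold hp ps x10 x12 form1 form2 form3 xb12 x2t Tt.
have b0 := lt_trans x20 x2b.
have left_le0 q : 0 < q -> q <= xb -> forall x, 0 <= x -> x <= q ->
    Fl p s 1 1 0 (vfit p s 1 1 q) (mfit p s 1 1 q) x <= 0.
  move=> q0 qb x; have f := fitP hp ps q0.
  apply: (fit_le0 hp ps x10 form1 form2 _ f); last by rewrite gap_fit// egap_ge0.
  by rewrite q0 (le_trans qb)// ltW.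
have mw := ltW (mb_lt_w hp ps x10 form1 form2 xb12 eb).
have one_ok l : 0 <= l <= 1 -> one_step p s l -> kRSB (mixture p s l) 1.
  move=> /andP[l0 l1] ok; have l0' : 0 <= 1 - l by rewrite subr_ge0.
  have l01 : 0 < l + (1 - l) by rewrite addrC subrK.
  exact: (kRSB_1 hp ps l0 l0' l01 (left_fit_exists hp ps l0 l0' l01 ltr01)).
have inv l : 0 < l < 1 -> exists2 X, 0 < X & lam p s X = l := @lam_surj R p s ps l.
(* Since lam decreases, the four phases are the ranges [Xt, oo), [b, Xt), (x2, b) and (xb, x2]
   of X, followed by (0, xb] where the fit on [0, X] is a certificate again. *)
exists l12, (lam p s b), (lam p s xb); split.
- split => //; [by rewrite -et lam_lt|by rewrite -e2 lam_lt|by rewrite -e2 lam_lt|].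
  by case/andP: (@lam_itv R p s xb xb0).
- move=> l [/andP[l0 ll]|/andP[ll l1]].
    apply: one_ok; last exact: ok_le.
    by rewrite l0 (le_trans ll)// ltW// (lt_trans l12S)//; case/andP: l21F01.
  have l0 : 0 < l by apply: lt_le_trans ll; case/andP: (@lam_itv R p s xb xb0).
  apply: one_ok; first by rewrite (ltW l0).
  move: l1; rewrite le_eqVlt => /orP[/eqP ->|l1]; first by apply: one_step_pure => //; right.
  have [|X X0 eX] := inv l; first by rewrite l0.
  have Xb : X <= xb by rewrite -(lam_le ps X0 xb0) eX.
  by rewrite -eX; apply/(zoom_one_step hp ps X0); exact: left_le0.
- move=> l /andP[ll lb].
  have [|X X0 eX] := inv l.
    rewrite (lt_trans l120)//= (le_lt_trans lb)//.
    by case/andP: (@lam_itv R p s b b0).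
  have Xt' : X < Xt by rewrite -(lam_lt ps X0 Xt0) eX et.
  have bX : b <= X by rewrite -(lam_le ps b0 X0) eX.
  have x2X := lt_le_trans x2b bX.
  have [q [m [[/andP[q0 qb] mm lX FX F1X] Fr]]] := two_step hp ps x10 x12 form1 form2 form3
    egap_x2 xb12 eb egap_ge0 x2t qc0 qct F_touch Fle_t x2X Xt' (Tpos X bX (ltW Xt')).
  rewrite -eX; apply: (zoom_kRSB_2 hp ps X0 q0 _ mm lX FX F1X (left_le0 q q0 qb) Fr).
  exact: le_lt_trans qb (lt_trans xb2 x2X).
- move=> l /andP[lb l2].
  have [|X X0 eX] := inv l.
    rewrite (lt_trans _ lb)/= ?(lt_trans l2)//; first by case/andP: l21F01.
    by case/andP: (@lam_itv R p s b b0).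
  have x2X : x2 < X by rewrite -(lam_lt ps x20 X0) eX e2.
  have Xb : X < b by rewrite -(lam_lt ps X0 b0) eX.
  have [q /andP[bq q2] Tq] := T_zero_exists hp ps x10 x12 form3 xb12 x2X (Tneg X (ltW x2X) Xb).
  have q0 := lt_trans xb0 bq; have qX := lt_trans q2 x2X.
  have x1q := ltW (lt_trans x1b bq).
  have h0 : 0 < hx p s 1 1 q by apply: hx_gt0 => //; lra.
  have m0 := mr_h_gt0 hp ps q0 qX; have lX := T_line_gt0 hp ps q0 qX.
  have F1X := T_F1 hp ps q0 qX.
  rewrite -eX; apply: (zoom_twoFRSB hp ps X0 xb0 bq qX hb m0 lX Tq F1X (left_le0 xb xb0 (lexx _)) _ mw).
  + move=> x qx xX; apply: (right_le0 hp ps x10 x12 form2 form3 x1q qX h0 m0 lX _ Tq F1X qx xX).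
    by rewrite T_gap_q.
  + move=> x y bx xy yq; apply: (w_increasing hp ps x10 form2 _ xy); last exact: le_trans (ltW q2).
    exact: le_trans (ltW x1b) bx.
  + exact: (T_zero_slope hp ps x10 x12 form2 form3 x1q q2 x2X Tq).
- move=> l /andP[l2 lb].
  have [|X X0 eX] := inv l.
    rewrite (lt_le_trans _ l2)/= ?(lt_trans lb)//; last by case/andP: l21F01.
    by case/andP: (@lam_itv R p s xb xb0).
  have Xx2 : X <= x2 by rewrite -(lam_le ps X0 x20) eX e2.
  have bX : xb < X by rewrite -(lam_lt ps xb0 X0) eX.
  rewrite -eX; apply: (zoom_oneFRSB hp ps X0 xb0 bX hb (left_le0 xb xb0 (lexx _)) mw).
  move=> x y bx xy yX; apply: (w_increasing hp ps x10 form2 _ xy); last exact: le_trans Xx2.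
  exact: le_trans (ltW x1b) bx.
Qed.
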